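(* Let $(A,\Delta)$ be a multiplier Hopf $^*$-algebra with positive integrals, acting by bounded operators on the Hilbert space $\mathcal H$ obtained from a positive right integral $\psi$; let $P$ and $M$ be the C$^*$-algebra and the von Neumann algebra generated by $A$ on $\mathcal H$, and let $V$ be the unitary on $\mathcal H\otimes\mathcal H$ given by $V(\Lambda(x)\otimes\Lambda(x'))=\sum_{(x)}\Lambda(x_{(1)})\otimes\Lambda(x_{(2)}x')$ for $x,x'\in A$. Define $\Delta_1$ on $M$ by $$\Delta_1(x)=V(x\otimes1)V^*.$$ Then $\Delta_1$ is a coproduct on the von Neumann algebra $M$. The restriction of $\Delta_1$ to $P$ is a coproduct on the C$^*$-algebra $P$. It extends the original coproduct on $A$.
   Context: A multiplier Hopf $^*$-algebra $(A,\Delta)$ is a $^*$-algebra $A$ over $\mathbb C$ with non-degenerate product (possibly without unit), with multiplier algebra $M(A)$, and a coassociative $^*$-homomorphism $\Delta:A\to M(A\otimes A)$ (algebraic tensor product) such that $a\otimes a'\mapsto\Delta(a)(1\otimes a')$ and $a\otimes a'\mapsto(a\otimes1)\Delta(a')$ are bijections of $A\otimes A$ onto itself. A left (respectively right) integral is a non-zero linear functional $\varphi$ (respectively $\psi$) with $(\iota\otimes\varphi)\Delta(a)=\varphi(a)1$ (respectively $(\psi\otimes\iota)\Delta(a)=\psi(a)1$) in $M(A)$ for all $a\in A$. ''With positive integrals'' means that positive left and right integrals exist ($\omega$ is positive if $\omega(a^*a)\ge 0$ for all $a$). Integrals are faithful. $\mathcal H$ is the Hilbert space completion of $A$ for the scalar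 product $\langle a',a\rangle=\psi(a^*a')$, and $\Lambda:A\to\mathcal H$ the canonical injection. $A$ acts faithfully and non-degenerately by bounded operators on $\mathcal H$ via $a\Lambda(x)=\Lambda(ax)$, and $A$ is identified with its image. $P$ is the norm closure and $M$ the weak closure of $A$ in the bounded operators on $\mathcal H$. A coproduct on a C$^*$-algebra $P$ is a non-degenerate coassociative $^*$-homomorphism $\Delta:P\to M(P\otimes P)$ (multiplier algebra of the minimal C$^*$-tensor product) such that $\Delta(P)(1\otimes P)$ and $(P\otimes1)\Delta(P)$ are contained in $P\otimes P$. A coproduct on a von Neumann algebra $M$ is a unital normal coassociative $^*$-homomorphism $\Delta:M\to M\otimes M$ (von Neumann tensor product). That $\Delta_1$ extends the coproduct of $A$ means that for $a\in A$ the operator $\Delta_1(a)$ maps $\Lambda(x)\otimes\Lambda(x')$ to $(\Lambda\otimes\Lambda)(\Delta(a)(x\otimes x'))$ for all $x,x'\in A$. *)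

(* Defs.v *)
From HB Require Import structures.
From mathcomp Require Import all_boot all_order all_algebra sesquilinear.
From mathcomp Require Import all_classical all_reals complex.
From mathcomp Require Import topology normedtype.
Set Implicit Arguments. Unset Strict Implicit. Unset Printing Implicit Defensive.
Import Order.TTheory GRing.Theory Num.Theory numFieldNormedType.Exports.
Local Open Scope classical_set_scope.
Local Open Scope quotient_scope.
Local Open Scope ring_scope.

Section AlgebraicTensorProduct.
Variables (K : comNzRingType) (U V : lmodType K).

(* The algebraic tensor product: formal sums of pairs, identified when every
   bilinear map agrees on them. *)
Definition formal_sum : choiceType := seq (U * V).

Definition tensor_rel : rel formal_sum := fun s s' =>
  `[< forall (W : lmodType K) (f : {bilinear U -> V -> W}),
        \sum_(p <- s) f p.1 p.2 = \sum_(p <- s') f p.1 p.2 >].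

Lemma tensor_relP : equiv_class_of tensor_rel.
Proof.
split.
- by move=> s; apply/asboolP.
- by move=> s s'; apply/asboolP/asboolP => h W f; rewrite h.
- move=> s' s s'' /asboolP h /asboolP h'; apply/asboolP => W f.
  by rewrite h h'.
Qed.

Canonical tensor_equiv_rel := EquivRelPack tensor_relP.

Definition tensor := {eq_quot tensor_equiv_rel}.
HB.instance Definition _ := Choice.on tensor.

(* The linear map induced by f; meaningful for bilinear f only. *)
Definition tlift (W : lmodType K) (f : U -> V -> W) (t : tensor) : W :=
  \sum_(p <- repr t) f p.1 p.2.

Lemma tlift_pi (W : lmodType K) (f : {bilinear U -> V -> W}) (s : formal_sum) :
  tlift f (\pi_tensor s) = \sum_(p <- s) f p.1 p.2.
Proof.
rewrite /tlift; have /eqmodP/asboolP := reprK (\pi_tensor s); exact.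
Qed.

Lemma tlift_ext (t t' : tensor) :
  (forall (W : lmodType K) (f : {bilinear U -> V -> W}), tlift f t = tlift f t') ->
  t = t'.
Proof.
move=> h; rewrite -[t]reprK -[t']reprK; apply/eqmodP/asboolP => W f; exact: h.
Qed.

Definition tadd (t t' : tensor) : tensor := \pi_tensor (repr t ++ repr t').
Definition topp (t : tensor) : tensor := \pi_tensor [seq (- p.1, p.2) | p <- repr t].
Definition tscale (c : K) (t : tensor) : tensor :=
  \pi_tensor [seq (c *: p.1, p.2) | p <- repr t].
Definition tzero : tensor := \pi_tensor [::].
Definition tpure (u : U) (v : V) : tensor := \pi_tensor [:: (u, v)].

Section Lift.
Variables (W : lmodType K) (f : {bilinear U -> V -> W}).

Lemma tlift_add t t' : tlift f (tadd t t') = tlift f t + tlift f t'.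
Proof. by rewrite tlift_pi big_cat. Qed.

Lemma tlift_opp t : tlift f (topp t) = - tlift f t.
Proof. by rewrite tlift_pi big_map -sumrN; apply: eq_bigr => p _; rewrite linearNl. Qed.

Lemma tlift_scale c t : tlift f (tscale c t) = c *: tlift f t.
Proof.
rewrite tlift_pi big_map scaler_sumr.
by apply: eq_bigr => p _; rewrite linearZl_LR.
Qed.

Lemma tlift_zero : tlift f tzero = 0.
Proof. by rewrite tlift_pi big_nil. Qed.

Lemma tlift_pure u v : tlift f (tpure u v) = f u v.
Proof. by rewrite tlift_pi big_seq1. Qed.

End Lift.

Let tE := (tlift_add, tlift_opp, tlift_scale, tlift_zero).

Fact taddA : associative tadd.
Proof. by move=> x y z; apply: tlift_ext => W f; rewrite !tE addrA. Qed.
Fact taddC : commutative tadd.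
Proof. by move=> x y; apply: tlift_ext => W f; rewrite !tE addrC. Qed.
Fact tadd0 : left_id tzero tadd.
Proof. by move=> x; apply: tlift_ext => W f; rewrite !tE add0r. Qed.
Fact taddN : left_inverse tzero topp tadd.
Proof. by move=> x; apply: tlift_ext => W f; rewrite !tE addNr. Qed.

HB.instance Definition _ := GRing.isZmodule.Build tensor taddA taddC tadd0 taddN.

Fact tscaleA c d t : tscale c (tscale d t) = tscale (c * d) t.
Proof. by apply: tlift_ext => W f; rewrite !tE scalerA. Qed.
Fact tscale1 : left_id 1 tscale.
Proof. by move=> t; apply: tlift_ext => W f; rewrite !tE scale1r. Qed.
Fact tscaleDr : right_distributive tscale +%R.
Proof. by move=> c t t'; apply: tlift_ext => W f; rewrite !tE scalerDr. Qed.
Fact tscaleDl t : {morph tscale^~ t : c d / c + d}.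
Proof. by move=> c d; apply: tlift_ext => W f; rewrite !tE scalerDl. Qed.

HB.instance Definition _ :=
  GRing.Zmodule_isLmodule.Build K tensor tscaleA tscale1 tscaleDr tscaleDl.

Fact tlift_is_linear (W : lmodType K) (f : {bilinear U -> V -> W}) :
  linear (tlift f).
Proof. by move=> c t t'; rewrite !tE. Qed.

HB.instance Definition _ (W : lmodType K) (f : {bilinear U -> V -> W}) :=
  GRing.isLinear.Build K tensor W *:%R (tlift f) (tlift_is_linear f).

Fact tpure_is_bilinear : bilinear_for *:%R *:%R tpure.
Proof.
split=> [v c u u'|u c v v']; apply: tlift_ext => W f;
  by rewrite linearP /= !tlift_pure linearPl || rewrite linearP /= !tlift_pure linearPr.
Qed.

HB.instance Definition _ := bilinear_isBilinear.Build K U V tensor *:%R *:%R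
  tpure tpure_is_bilinear.

Lemma tensorE (t : tensor) : t = \sum_(p <- repr t) tpure p.1 p.2.
Proof.
apply: tlift_ext => W f; rewrite linear_sum /=.
by apply: eq_bigr => p _; rewrite tlift_pure.
Qed.

Lemma tensor_ind (P : tensor -> Prop) :
  (forall u v, P (tpure u v)) -> P 0 -> (forall t t', P t -> P t' -> P (t + t')) ->
  forall t, P t.
Proof. by move=> p0 p1 pD t; rewrite (tensorE t); elim/big_ind: _. Qed.

Lemma tlift_unique (W : lmodType K) (f : U -> V -> W) (g : {linear tensor -> W}) :
  (forall u v, g (tpure u v) = f u v) -> g =1 tlift f.
Proof.
move=> h t; rewrite {1}(tensorE t) linear_sum.
by apply: eq_bigr => p _; rewrite h.
Qed.

Lemma tlift_pureP (W : lmodType K) (f : U -> V -> W) u v :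
  bilinear_for *:%R *:%R f -> tlift f (tpure u v) = f u v.
Proof.
move=> hf; pose B := bilinear_isBilinear.Build K U V W *:%R *:%R f hf.
pose F : {bilinear U -> V -> W} := HB.pack f B.
exact: (tlift_pure F).
Qed.

Lemma tlift_linearP (W : lmodType K) (f : U -> V -> W) :
  bilinear_for *:%R *:%R f -> linear (tlift f).
Proof.
move=> hf; pose B := bilinear_isBilinear.Build K U V W *:%R *:%R f hf.
pose F : {bilinear U -> V -> W} := HB.pack f B.
exact: (tlift_is_linear F).
Qed.

End AlgebraicTensorProduct.

Notation "u ⊗ v" := (tpure u v) (at level 40, left associativity) : ring_scope.

Definition tmap (K : comNzRingType) (U V U' V' : lmodType K)
    (f : U -> U') (g : V -> V') : tensor U V -> tensor U' V' :=
  tlift (fun u v => f u ⊗ g v).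

Lemma tmap_bilinear (K : comNzRingType) (U V U' V' : lmodType K)
    (f : U -> U') (g : V -> V') : linear f -> linear g ->
  bilinear_for *:%R *:%R (fun u v => f u ⊗ g v).
Proof.
by move=> hf hg; split=> [v c u u'|u c v v'] /=; rewrite (hf, hg) (linearPl, linearPr).
Qed.

Definition tassoc (K : comNzRingType) (U V W : lmodType K) :
    tensor (tensor U V) W -> tensor U (tensor V W) :=
  tlift (fun t w => tlift (fun u v => u ⊗ (v ⊗ w)) t).

(* *-algebras, possibly without unit. *)
HB.mixin Record Lmodule_isStarAlgebra (C : numClosedFieldType) A
    of GRing.Lmodule C A := {
  amul : A -> A -> A;
  star : A -> A;
  amulA : associative amul;
  amul_bilinear : bilinear_for *:%R *:%R amul;
  star_antilinear : forall (c : C) a b, star (c *: a + b) = c^* *: star a + star b;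
  starM : forall a b, star (amul a b) = amul (star b) (star a);
  starK : involutive star }.

#[short(type="starAlgType")]
HB.structure Definition StarAlgebra (C : numClosedFieldType) :=
  {A of Lmodule_isStarAlgebra C A & GRing.Lmodule C A}.

Notation "a ∙ b" := (amul a b) (at level 40, left associativity) : ring_scope.

HB.instance Definition _ (C : numClosedFieldType) (A : starAlgType C) :=
  bilinear_isBilinear.Build C A A A *:%R *:%R (@amul C A) amul_bilinear.

Section StarTheory.
Variables (C : numClosedFieldType) (A : starAlgType C).
Lemma starD : {morph @star C A : a b / a + b}.
Proof. by move=> a b; rewrite -[a]scale1r star_antilinear rmorph1 !scale1r. Qed.
Lemma star0 : star (0 : A) = 0.
Proof. by have := star_antilinear (-1) (0 : A) 0; rewrite rmorphN1 scaleN1r addNr scaleN1r addNr. Qed.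
Lemma starZ (c : C) (a : A) : star (c *: a) = c^* *: star a.
Proof. by rewrite -[c *: a]addr0 star_antilinear star0 addr0. Qed.
End StarTheory.

(* W with scalars acting through conjugation: the target that turns the
   antilinear involution of a tensor product into a linear map. *)
Section ConjugateModule.
Variables (C : numClosedFieldType) (W : lmodType C).
Definition conj_module : Type := W.
HB.instance Definition _ := GRing.Zmodule.on conj_module.
Definition cscale (c : C) (w : conj_module) : conj_module := c^* *: (w : W).
Fact cscaleA c d w : cscale c (cscale d w) = cscale (c * d) w.
Proof. by rewrite /cscale scalerA rmorphM. Qed.
Fact cscale1 : left_id 1 cscale.
Proof. by move=> w; rewrite /cscale rmorph1 scale1r. Qed.
Fact cscaleDr : right_distributive cscale +%R.
Proof. by move=> c w w'; rewrite /cscale scalerDr. Qed.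
Fact cscaleDl w : {morph cscale^~ w : c d / c + d}.
Proof. by move=> c d; rewrite /cscale rmorphD scalerDl. Qed.
HB.instance Definition _ :=
  GRing.Zmodule_isLmodule.Build C conj_module cscaleA cscale1 cscaleDr cscaleDl.
End ConjugateModule.

Section TensorStarAlgebra.
Variables (C : numClosedFieldType) (A B : starAlgType C).
Local Notation AB := (tensor A B).

Definition tmul_pure (a : A) (b : B) (a' : A) (b' : B) : AB := (a ∙ a') ⊗ (b ∙ b').

Fact tmul_pure_bilinear a b : bilinear_for *:%R *:%R (tmul_pure a b).
Proof.
by split=> [y c x x'|x c y y']; rewrite /tmul_pure linearPr (linearPl, linearPr).
Qed.
HB.instance Definition _ a b :=
  bilinear_isBilinear.Build C A B AB *:%R *:%R (tmul_pure a b) (tmul_pure_bilinear a b).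

Definition tmul_left (t' : AB) (a : A) (b : B) : AB := tlift (tmul_pure a b) t'.

Fact tmul_left_bilinear t' : bilinear_for *:%R *:%R (tmul_left t').
Proof.
split=> [y c x x'|x c y y']; rewrite /= /tmul_left /tlift scaler_sumr -big_split /=;
  apply: eq_bigr => p _; rewrite /tmul_pure.
- by rewrite linearPl linearPl.
- by rewrite linearPl linearPr.
Qed.
HB.instance Definition _ t' :=
  bilinear_isBilinear.Build C A B AB *:%R *:%R (tmul_left t') (tmul_left_bilinear t').

Definition tmul (t t' : AB) : AB := tlift (tmul_left t') t.

Lemma tmul_pureE a b a' b' : tmul (a ⊗ b) (a' ⊗ b') = (a ∙ a') ⊗ (b ∙ b').
Proof. by rewrite /tmul tlift_pure /= /tmul_left tlift_pure. Qed.

Fact tmul_bilinear : bilinear_for *:%R *:%R tmul.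
Proof.
split=> [y c x x'|x c y y']; first by rewrite /tmul linearP.
rewrite /= /tmul /tlift scaler_sumr -big_split /=.
by apply: eq_bigr => p _; rewrite /tmul_left linearP.
Qed.
HB.instance Definition _ :=
  bilinear_isBilinear.Build C AB AB AB *:%R *:%R tmul tmul_bilinear.

Lemma tmulDl x y z : tmul (x + y) z = tmul x z + tmul y z.
Proof. exact: linearDl. Qed.
Lemma tmulDr z x y : tmul z (x + y) = tmul z x + tmul z y.
Proof. exact: linearDr. Qed.
Lemma tmul0l z : tmul 0 z = 0.
Proof. exact: linear0l. Qed.
Lemma tmul0r z : tmul z 0 = 0.
Proof. exact: linear0r. Qed.

Fact tmulA : associative tmul.
Proof.
elim/tensor_ind => [a b||t t' ht ht' y z]; last 2 first.
- by move=> y z; rewrite !tmul0l.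
- by rewrite !tmulDl ht ht'.
elim/tensor_ind => [a' b'||t t' ht ht' z]; last 2 first.
- by move=> z; rewrite tmul0l !tmul0r tmul0l.
- by rewrite tmulDl !tmulDr tmulDl ht ht'.
elim/tensor_ind => [a'' b''||t t' ht ht']; last 2 first.
- by rewrite !tmul0r.
- by rewrite !tmulDr ht ht'.
by rewrite !tmul_pureE !amulA.
Qed.

Definition tstar (t : AB) : AB := \sum_(p <- repr t) star p.1 ⊗ star p.2.

Section WellDefined.
Variables (W : lmodType C) (f : {bilinear A -> B -> W}).
Definition tstar_lift (a : A) (b : B) : conj_module W := f (star a) (star b).
Fact tstar_lift_bilinear : bilinear_for *:%R *:%R tstar_lift.
Proof.
by split=> [y c x x'|x c y y']; rewrite /tstar_lift star_antilinear (linearPl, linearPr).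
Qed.
HB.instance Definition _ :=
  bilinear_isBilinear.Build C A B (conj_module W) *:%R *:%R tstar_lift tstar_lift_bilinear.
Lemma tlift_tstar t : tlift f (tstar t) = tlift tstar_lift t.
Proof.
by rewrite /tstar linear_sum; apply: eq_bigr => p _ /=; rewrite tlift_pure.
Qed.
End WellDefined.

Lemma tstar_antilinear (c : C) t t' : tstar (c *: t + t') = c^* *: tstar t + tstar t'.
Proof. by apply: tlift_ext => W f; rewrite linearP /= !tlift_tstar linearP. Qed.

Lemma tstar_pure a b : tstar (a ⊗ b) = star a ⊗ star b.
Proof. by apply: tlift_ext => W f; rewrite tlift_tstar !tlift_pure. Qed.

Lemma tstarD : {morph tstar : t t' / t + t'}.
Proof. by move=> t t'; rewrite -[t]scale1r tstar_antilinear rmorph1 !scale1r. Qed.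
Lemma tstar0 : tstar 0 = 0.
Proof. by apply: tlift_ext => W f; rewrite tlift_tstar !linear0. Qed.

Fact tstarM t t' : tstar (tmul t t') = tmul (tstar t') (tstar t).
Proof.
elim/tensor_ind: t => [a b||x y hx hy]; last 2 first.
- by rewrite tmul0l tstar0 tmul0r.
- by rewrite tmulDl !tstarD tmulDr hx hy.
elim/tensor_ind: t' => [a' b'||x y hx hy]; last 2 first.
- by rewrite tmul0r tstar0 tmul0l.
- by rewrite tmulDr !tstarD tmulDl hx hy.
by rewrite !(tmul_pureE, tstar_pure) !starM.
Qed.

Fact tstarK : involutive tstar.
Proof.
elim/tensor_ind => [a b||x y hx hy].
- by rewrite !tstar_pure !starK.
- by rewrite !tstar0.
- by rewrite !tstarD hx hy.
Qed.

HB.instance Definition _ := Lmodule_isStarAlgebra.Build C AB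
  tmulA tmul_bilinear tstar_antilinear tstarM tstarK.

Lemma tstar_pureE a b : star (a ⊗ b) = star a ⊗ star b.
Proof. exact: tstar_pure. Qed.

End TensorStarAlgebra.

Section Multipliers.
Variables (C : numClosedFieldType).

(* A multiplier m of B is encoded by the pair (b |-> m b, b |-> b m). *)
Definition multiplier (B : lmodType C) : lmodType C :=
  ((B -> B) * (B -> B))%type.

Definition is_multiplier (B : starAlgType C) (m : multiplier B) : Prop :=
  [/\ linear m.1 /\ linear m.2,
      forall b b', m.1 (b ∙ b') = m.1 b ∙ b',
      forall b b', m.2 (b ∙ b') = b ∙ m.2 b'
    & forall b b', b ∙ m.1 b' = m.2 b ∙ b'].

Definition munit (B : starAlgType C) : multiplier B := (id, id).
Definition minj (B : starAlgType C) (b : B) : multiplier B := (amul b, amul^~ b).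
Definition mmul (B : starAlgType C) (m n : multiplier B) : multiplier B :=
  (m.1 \o n.1, n.2 \o m.2).
Definition mstar (B : starAlgType C) (m : multiplier B) : multiplier B :=
  (star \o m.2 \o star, star \o m.1 \o star).
Definition mtensor (A B : starAlgType C) (m : multiplier A) (n : multiplier B) :
    multiplier (tensor A B) :=
  (tmap m.1 n.1, tmap m.2 n.2).

(* hopfT1 (a ⊗ b) is Delta(a)(1 (x) b) and hopfT2 (a ⊗ b) is (a (x) 1)Delta(b);
   both are determined by Delta. As Delta takes values in multipliers of A ⊗ A,
   coassociativity is stated after multiplying by a (x) 1 (x) 1 on the left and
   by 1 (x) 1 (x) c on the right:
   (a (x) 1 (x) 1)(Delta (x) id)(Delta(b)(1 (x) c))
     = (id (x) Delta)((a (x) 1)Delta(b))(1 (x) 1 (x) c). *)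
Record multiplier_hopf (A : starAlgType C) := MultiplierHopf {
  nondegl : forall a : A, (forall b, a ∙ b = 0) -> a = 0;
  nondegr : forall a : A, (forall b, b ∙ a = 0) -> a = 0;
  Delta : {linear A -> multiplier (tensor A A)};
  Delta_multiplier : forall a, is_multiplier (Delta a);
  DeltaM : forall a b, Delta (a ∙ b) = mmul (Delta a) (Delta b);
  Delta_star : forall a, Delta (star a) = mstar (Delta a);
  hopfT1 : {linear tensor A A -> tensor A A};
  hopfT1E : forall a b,
    minj (hopfT1 (a ⊗ b)) = mmul (Delta a) (mtensor (munit A) (minj b));
  hopfT1_bij : bijective hopfT1;
  hopfT2 : {linear tensor A A -> tensor A A};
  hopfT2E : forall a b,
    minj (hopfT2 (a ⊗ b)) = mmul (mtensor (minj a) (munit A)) (Delta b);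
  hopfT2_bij : bijective hopfT2;
  coassoc : forall a b c : A,
    tassoc (tlift (fun x y => hopfT2 (a ⊗ x) ⊗ y) (hopfT1 (b ⊗ c))) =
    tlift (fun x y => x ⊗ hopfT1 (y ⊗ c)) (hopfT2 (a ⊗ b)) }.

End Multipliers.

Section MultiplierHopfTheory.
Variables (C : numClosedFieldType) (A : starAlgType C) (h : multiplier_hopf A).

(* Delta(a)(b (x) 1) and (1 (x) b)Delta(a), see hopfT3E and hopfT4E. *)
Definition hopfT3 (a b : A) : tensor A A := star (hopfT2 h (star b ⊗ star a)).
Definition hopfT4 (a b : A) : tensor A A := star (hopfT1 h (star a ⊗ star b)).

Lemma minj_star (B : starAlgType C) (b : B) : minj (star b) = mstar (minj b).
Proof.
congr pair; apply/funext => x; rewrite /= starM starK //.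
Qed.

Lemma mstar_mmul (B : starAlgType C) (m n : multiplier B) :
  mstar (mmul m n) = mmul (mstar n) (mstar m).
Proof.
by congr pair; apply/funext => x; rewrite /= starK.
Qed.

Lemma tmap_star (B B' : starAlgType C) (f g : B -> B) (f' g' : B' -> B') :
  linear f -> linear f' -> linear g -> linear g' ->
  star \o f \o star =1 g -> star \o f' \o star =1 g' ->
  star \o tmap f f' \o star = tmap g g' :> (tensor B B' -> tensor B B').
Proof.
move=> lf lf' lg lg' fg fg'; apply/funext => t.
have fl := tmap_bilinear lf lf'; have gl := tmap_bilinear lg lg'.
have fD x y : tmap f f' (x + y) = tmap f f' x + tmap f f' y.
  by have := tlift_linearP fl 1 x y; rewrite !scale1r.
have gD x y : tmap g g' (x + y) = tmap g g' x + tmap g g' y.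
  by have := tlift_linearP gl 1 x y; rewrite !scale1r.
have f0 : tmap f f' 0 = 0 by apply: (addrI (tmap f f' 0)); rewrite -fD !addr0.
have g0 : tmap g g' 0 = 0 by apply: (addrI (tmap g g' 0)); rewrite -gD !addr0.
elim/tensor_ind: t => [a b||x y hx hy].
- rewrite /= tstar_pureE /tmap !tlift_pureP // tstar_pureE.
  by congr (_ ⊗ _); [exact: fg | exact: fg'].
- by rewrite /= star0 f0 star0 g0.
- by rewrite /= starD fD starD gD; congr (_ + _).
Qed.

Lemma linear_amull (B : starAlgType C) (b : B) : linear (amul b).
Proof. by move=> c x y; rewrite linearPr. Qed.
Lemma linear_amulr (B : starAlgType C) (b : B) : linear (amul^~ b).
Proof. by move=> c x y; rewrite linearPl. Qed.
Lemma linear_id (B : starAlgType C) : linear (@id B).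
Proof. by []. Qed.
Hint Resolve linear_amull linear_amulr linear_id : core.

Lemma mstar_mtensorl (b : A) :
  mstar (mtensor (minj b) (munit A)) = mtensor (minj (star b)) (munit A).
Proof.
rewrite /mstar /mtensor /=; congr (_, _); apply: tmap_star => // x;
  by rewrite /= ?starM ?starK.
Qed.

Lemma mstar_mtensorr (b : A) :
  mstar (mtensor (munit A) (minj b)) = mtensor (munit A) (minj (star b)).
Proof.
rewrite /mstar /mtensor /=; congr (_, _); apply: tmap_star => // x;
  by rewrite /= ?starM ?starK.
Qed.

Lemma hopfT4E a b : minj (hopfT4 a b) = mmul (mtensor (munit A) (minj b)) (Delta h a).
Proof.
by rewrite /hopfT4 minj_star hopfT1E mstar_mmul mstar_mtensorr starK -Delta_star starK.
Qed.

Lemma hopfT3E a b : minj (hopfT3 a b) = mmul (Delta h a) (mtensor (minj b) (munit A)).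
Proof.
by rewrite /hopfT3 minj_star hopfT2E mstar_mmul mstar_mtensorl starK -Delta_star starK.
Qed.

(* psi (x) id and id (x) phi on the algebraic tensor product. *)
Definition slicel (psi : {scalar A}) : tensor A A -> A :=
  tlift (fun x y => psi x *: y).
Definition slicer (phi : {scalar A}) : tensor A A -> A :=
  tlift (fun x y => phi y *: x).

(* (id (x) phi) Delta(a), as the multiplier with
   b |-> (id (x) phi)(Delta(a)(b (x) 1)) and b |-> (id (x) phi)((b (x) 1)Delta(a)). *)
Definition coproduct_slicer (phi : {scalar A}) (a : A) : multiplier A :=
  (fun b => slicer phi (hopfT3 a b), fun b => slicer phi (hopfT2 h (b ⊗ a))).

(* (psi (x) id) Delta(a), as the multiplier with
   b |-> (psi (x) id)(Delta(a)(1 (x) b)) and b |-> (psi (x) id)((1 (x) b)Delta(a)). *)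
Definition coproduct_slicel (psi : {scalar A}) (a : A) : multiplier A :=
  (fun b => slicel psi (hopfT1 h (a ⊗ b)), fun b => slicel psi (hopfT4 a b)).

Definition left_integral (phi : {scalar A}) : Prop :=
  (exists a, phi a != 0) /\
  forall a, coproduct_slicer phi a = phi a *: munit A.

Definition right_integral (psi : {scalar A}) : Prop :=
  (exists a, psi a != 0) /\
  forall a, coproduct_slicel psi a = psi a *: munit A.

Definition positive_functional (omega : {scalar A}) : Prop :=
  forall a, 0 <= omega (star a ∙ a).

End MultiplierHopfTheory.


(* The scalar product is linear in its first argument, and the library norm is
   the associated one, so that completeness is completeness for that norm. *)
HB.mixin Record CompleteNormedModule_isHilbert (R : realType) H
    of CompleteNormedModule R[i] H := {
  inner : {dot H for @Num.conj R[i]};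
  inner_norm : forall x : H, `|x| ^+ 2 = inner x x }.

#[short(type="hilbertType")]
HB.structure Definition Hilbert (R : realType) :=
  {H of CompleteNormedModule_isHilbert R H & CompleteNormedModule R[i] H}.

Definition lspan (K : nzRingType) (V : lmodType K) (X : set V) : set V :=
  [set v | exists2 s : seq (K * V),
     (forall p, p \in s -> X p.2) & v = \sum_(p <- s) p.1 *: p.2].

(* (H, Lam) is the Hilbert space completion of A for <a', a> = psi (a^* a'). *)
Definition hilbert_completion (R : realType) (A : starAlgType R[i])
    (psi : {scalar A}) (H : hilbertType R) (Lam : {linear A -> H}) : Prop :=
  (forall a a', inner (Lam a') (Lam a) = psi (star a ∙ a')) /\
  closure (range Lam) = setT.

(* HK, together with (x, y) |-> ox x y, is the Hilbert space tensor product of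
   H and K; this determines HK up to a unique unitary. *)
Definition hilbert_tensor (R : realType) (H K HK : hilbertType R)
    (ox : H -> K -> HK) : Prop :=
  [/\ bilinear_for *:%R *:%R ox,
      forall x y x' y', inner (ox x y) (ox x' y') = inner x x' * inner y y'
    & closure (lspan [set ox x y | x in [set: H] & y in [set: K]]) = setT].

Section Operators.
Variable R : realType.
Implicit Types H K : hilbertType R.

Definition bounded_op H K : set (H -> K) :=
  [set T | linear T /\ continuous T].

Definition is_adjoint H K (T : H -> K) (S : K -> H) : Prop :=
  forall x y, inner (T x) y = inner x (S y).

(* T^*; it exists and is unique for every bounded operator T. *)
Definition adj H K (T : H -> K) : K -> H := xget 0 (is_adjoint T).

Definition self_adjoint H (T : H -> H) : Prop := is_adjoint T T.

Definition unitary_op H (V : H -> H) : Prop :=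
  [/\ bounded_op V, adj V \o V = id & V \o adj V = id].

(* The operator S (x) T on H (x) K; it exists and is unique for bounded S, T. *)
Definition op_tensor H K (HK : hilbertType R) (ox : H -> K -> HK)
    (S : H -> H) (T : K -> K) : HK -> HK :=
  xget 0 [set U : HK -> HK |
    bounded_op U /\ forall x y, U (ox x y) = ox (S x) (T y)].

Definition norm_closure H (X : set (H -> H)) : set (H -> H) :=
  [set T | bounded_op T /\
     forall e : R[i], 0 < e ->
       exists2 S, X S & forall x, `|T x - S x| <= e * `|x| ].

Definition weak_closure H (X : set (H -> H)) : set (H -> H) :=
  [set T | bounded_op T /\
     forall (s : seq (H * H)) (e : R[i]), 0 < e ->
       exists2 S, X S & forall p, p \in s -> `|inner (T p.1 - S p.1) p.2| < e].

Definition star_subalgebra H (X : set (H -> H)) : Prop :=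
  [/\ X `<=` @bounded_op H H, X 0,
      forall (c : R[i]) S T, X S -> X T -> X (c *: S + T),
      forall S T, X S -> X T -> X (S \o T)
    & forall S, X S -> X (adj S)].

(* Concrete C^*-algebras, acting non-degenerately. *)
Definition cstar_algebra H (X : set (H -> H)) : Prop :=
  [/\ star_subalgebra X, norm_closure X `<=` X
    & closure (lspan [set T x | T in X & x in [set: H]]) = setT].

Definition von_neumann_algebra H (X : set (H -> H)) : Prop :=
  [/\ star_subalgebra X, X id & weak_closure X `<=` X].

(* The minimal tensor product of concrete C^*-algebras is the spatial one. *)
Definition cstar_tensor H K (HK : hilbertType R) (ox : H -> K -> HK)
    (X : set (H -> H)) (Y : set (K -> K)) : set (HK -> HK) :=
  norm_closure (lspan [set op_tensor ox S T | S in X & T in Y]).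

Definition vn_tensor H K (HK : hilbertType R) (ox : H -> K -> HK)
    (X : set (H -> H)) (Y : set (K -> K)) : set (HK -> HK) :=
  weak_closure (lspan [set op_tensor ox S T | S in X & T in Y]).

(* The multiplier algebra M(X) of a C^*-algebra X acting non-degenerately on H,
   realized on H as the idealizer of X. *)
Definition cstar_multipliers H (X : set (H -> H)) : set (H -> H) :=
  [set T | bounded_op T /\ forall S, X S -> X (T \o S) /\ X (S \o T)].

Definition star_hom H K (X : set (H -> H)) (Y : set (K -> K))
    (f : (H -> H) -> K -> K) : Prop :=
  [/\ forall S, X S -> Y (f S),
      forall (c : R[i]) S T, X S -> X T -> f (c *: S + T) = c *: f S + f T,
      forall S T, X S -> X T -> f (S \o T) = f S \o f T
    & forall S, X S -> f (adj S) = adj (f S)].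

Definition op_le H (S T : H -> H) : Prop := forall x, 0 <= inner (T x - S x) x.

Definition op_sup H (X D : set (H -> H)) (S : H -> H) : Prop :=
  [/\ X S, self_adjoint S, forall T, D T -> op_le T S
    & forall U, X U -> self_adjoint U -> (forall T, D T -> op_le T U) ->
        op_le S U].

(* Normal: preserving suprema of bounded upward directed sets of self-adjoint
   elements (a set having a supremum is bounded). *)
Definition normal_map H K (X : set (H -> H)) (Y : set (K -> K))
    (f : (H -> H) -> K -> K) : Prop :=
  forall (D : set (H -> H)) (S : H -> H),
    D `<=` X -> (forall T, D T -> self_adjoint T) -> D !=set0 ->
    (forall T T', D T -> D T' -> exists2 U, D U & op_le T U /\ op_le T' U) ->
    op_sup X D S -> op_sup Y (f @` D) (f S).

End Operators.

(* In the two definitions below, HH is H (x) H and HHH is H (x) H (x) H, seen as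
   (H (x) H) (x) H through oxl and as H (x) (H (x) H) through oxr. *)
Section Coproducts.
Variables (R : realType) (H HH HHH : hilbertType R).
Variables (ox : H -> H -> HH) (oxl : HH -> H -> HHH) (oxr : H -> HH -> HHH).

(* Phi and Psi are Delta (x) id and id (x) Delta; a *-homomorphism on M(P (x) P)
   is determined by its values on simple tensors when, as here, it is
   non-degenerate on P (x) P. *)
Definition cstar_coproduct (P : set (H -> H)) (Delta : (H -> H) -> HH -> HH) :
    Prop :=
  let PP := cstar_tensor ox P P in
  let MPP := cstar_multipliers PP in
  [/\ cstar_algebra P,
      star_hom P MPP Delta,
      PP `<=` norm_closure (lspan [set Delta S \o Z | S in P & Z in PP]),
      exists Phi Psi : (HH -> HH) -> HHH -> HHH,
        [/\ star_hom MPP (cstar_multipliers (cstar_tensor oxl PP P)) Phi,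
            forall S T, P S -> P T ->
              Phi (op_tensor ox S T) = op_tensor oxl (Delta S) T,
            star_hom MPP (cstar_multipliers (cstar_tensor oxr P PP)) Psi,
            forall S T, P S -> P T ->
              Psi (op_tensor ox S T) = op_tensor oxr S (Delta T)
          & forall S, P S -> Phi (Delta S) = Psi (Delta S)]
    & forall S T, P S -> P T ->
        PP (Delta S \o op_tensor ox id T) /\ PP (op_tensor ox S id \o Delta T)].

(* Phi and Psi are Delta (x) id and id (x) Delta; a normal *-homomorphism on
   M (x) M is determined by its values on simple tensors. *)
Definition vn_coproduct (M : set (H -> H)) (Delta : (H -> H) -> HH -> HH) :
    Prop :=
  let MM := vn_tensor ox M M in
  [/\ von_neumann_algebra M,
      star_hom M MM Delta,
      Delta id = id,
      normal_map M MM Delta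
    & exists Phi Psi : (HH -> HH) -> HHH -> HHH,
        [/\ star_hom MM (vn_tensor oxl MM M) Phi /\
              normal_map MM (vn_tensor oxl MM M) Phi,
            forall S T, M S -> M T ->
              Phi (op_tensor ox S T) = op_tensor oxl (Delta S) T,
            star_hom MM (vn_tensor oxr M MM) Psi /\
              normal_map MM (vn_tensor oxr M MM) Psi,
            forall S T, M S -> M T ->
              Psi (op_tensor ox S T) = op_tensor oxr S (Delta T)
          & forall S, M S -> Phi (Delta S) = Psi (Delta S)]].

End Coproducts.

(* Lam (x) Lam on the algebraic tensor product. *)
Definition Lam2 (R : realType) (A : starAlgType R[i]) (H HH : hilbertType R)
    (ox : H -> H -> HH) (Lam : A -> H) : tensor A A -> HH :=
  tlift (fun x x' => ox (Lam x) (Lam x')).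

(* Main.v *)
Require Import Defs.
From HB Require Import structures.
From mathcomp Require Import all_boot all_order all_algebra sesquilinear.
From mathcomp Require Import all_classical all_reals complex.
From mathcomp Require Import topology normedtype.
From mathcomp Require Import ring lra.

(* On A one has Delta1(a)(1 (x) b) = T1(a (x) b) and (a (x) 1)Delta1(b) = T2(a (x) b),
   because V is T1 transported to the Hilbert space. The operators of A (x) A form
   a non-degenerate *-algebra, since A is spanned by products; so these two
   identities give the C*-algebraic statements on A, and norm continuity extends
   them to P.

   For M, the range of Delta1 is controlled by the bicommutant theorem: whether
   V (x (x) 1) V* commutes with an operator Y is the question whether x (x) 1
   commutes with V* Y V, and slicing turns this into a weakly closed condition on
   x. Normality holds because a bounded increasing net converges strongly to its
   supremum, which amplification and conjugation by a unitary preserve.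

   Delta1 (x) id and id (x) Delta1 are Z |-> U (Z (x) 1) U* for unitaries U built
   from V and the flip, so both are covered by the same arguments. Coassociativity
   is read off the axiom of A after multiplication by a (x) 1 (x) 1 on the left and
   1 (x) 1 (x) c on the right, cancelled by non-degeneracy; it passes to M since it
   amounts to the commutation of x (x) 1 (x) 1 with a fixed unitary. *)

Set Implicit Arguments.
Unset Strict Implicit.
Unset Printing Implicit Defensive.
Import Order.TTheory GRing.Theory Num.Theory numFieldNormedType.Exports.
Local Open Scope classical_set_scope.
Local Open Scope ring_scope.

(** * Semi-inner products and orthogonal projections *)

(** [A] has no unit and [Delta1 (act a)] is in general only a multiplier of [A ⊗ A]. This shapes the
    statements: membership in the von Neumann tensor product is tested against a commutant,
    membership in the multiplier algebra against composites with elements of [P ⊗ P], and the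
    spanning of [A] by products stands in for the unit. That spanning comes from the surjectivity of
    [T2] and slicing with [psi]. Analysis on tensor products rests on one device: an algebraic
    tensor is rewritten with orthogonal right legs, so that norms and quadratic forms of [S ⊗ 1]
    become weighted sums of those of [S]. Boundedness, positivity and normality of amplifications
    are all obtained in this way. Orthogonal projection is developed for complete semi-inner
    products on modules, because it is applied both to [H], for the Riesz representation behind
    adjoints, and to [H^n], for the bicommutant theorem. *)

Section LinearMaps.
Variables (K : nzRingType) (U V : lmodType K) (f : U -> V).
Hypothesis lf : linear f.
Lemma linD x y : f (x + y) = f x + f y.
Proof. by rewrite -[x]scale1r lf !scale1r. Qed.
Lemma lin0 : f 0 = 0.
Proof. by apply: (addrI (f 0)); rewrite -linD !addr0. Qed.
Lemma linB x y : f (x - y) = f x - f y.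
Proof. by rewrite -scaleN1r addrC lf scaleN1r addrC. Qed.
Lemma lin_sum (I : Type) (s : seq I) (F : I -> U) :
  f (\sum_(i <- s) F i) = \sum_(i <- s) f (F i).
Proof. by apply: big_morph; [exact: linD | exact: lin0]. Qed.
End LinearMaps.

Section Span.
Variables (K : nzRingType) (V : lmodType K).
Implicit Types (X D : set V).

Definition subspace D : Prop :=
  D 0 /\ forall c x y, D x -> D y -> D (c *: x + y).

Lemma subspace_sum D (I : Type) (s : seq I) (c : I -> K) (F : I -> V) :
  subspace D -> (forall i, D (F i)) -> D (\sum_(i <- s) c i *: F i).
Proof.
move=> [D0 DP] DF; elim: s => [|i s IH]; first by rewrite big_nil.
by rewrite big_cons; apply: DP.
Qed.

Lemma lspan_subset X D : subspace D -> X `<=` D -> lspan X `<=` D.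
Proof.
move=> [D0 DP] XD _ [s hs ->]; elim: s hs => [|p s IH] hs; first by rewrite big_nil.
rewrite big_cons; apply: DP; first by apply: XD; apply: hs; rewrite inE eqxx.
by apply: IH => q qs; apply: hs; rewrite inE; apply/orP; right.
Qed.

Lemma sub_lspan X : X `<=` lspan X.
Proof.
move=> x Xx; exists [:: (1, x)]; last by rewrite big_seq1 scale1r.
by move=> p; rewrite inE => /eqP ->.
Qed.

Lemma subspace_lspan X : subspace (lspan X).
Proof.
split; first by exists [::] => //; rewrite big_nil.
move=> c _ _ [s hs ->] [s' hs' ->].
exists ([seq (c * p.1, p.2) | p <- s] ++ s').
  move=> p; rewrite mem_cat => /orP[/mapP[q qs ->]|]; first exact: (hs q qs).
  exact: hs'.
rewrite big_cat big_map scaler_sumr; congr (_ + _).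
by apply: eq_bigr => p _; rewrite scalerA.
Qed.

Lemma lspanS X X' : X `<=` X' -> lspan X `<=` lspan X'.
Proof.
move=> XX'; apply: lspan_subset; first exact: subspace_lspan.
by move=> x /XX'; exact: sub_lspan.
Qed.
End Span.

Section SemiInner.
Variables (C : numClosedFieldType) (W : lmodType C) (ip : W -> W -> C).

Definition semi_inner : Prop :=
  [/\ forall c x x' y, ip (c *: x + x') y = c * ip x y + ip x' y,
      forall x y, ip y x = (ip x y)^*
    & forall x, 0 <= ip x x].

Hypothesis ipP : semi_inner.

Lemma ipC x y : ip y x = (ip x y)^*. Proof. by case: ipP. Qed.
Lemma ip_ge0 x : 0 <= ip x x. Proof. by case: ipP. Qed.
Lemma ipDl x x' y : ip (x + x') y = ip x y + ip x' y.
Proof. by case: ipP => h _ _; rewrite -[x]scale1r h mul1r scale1r. Qed.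
Lemma ip0l y : ip 0 y = 0.
Proof. by apply: (addrI (ip 0 y)); rewrite -ipDl !addr0. Qed.
Lemma ipZl c x y : ip (c *: x) y = c * ip x y.
Proof. by case: ipP => h _ _; rewrite -[c *: x]addr0 h ip0l addr0. Qed.
Lemma ipNl x y : ip (- x) y = - ip x y.
Proof. by rewrite -scaleN1r ipZl mulN1r. Qed.
Lemma ipBl x x' y : ip (x - x') y = ip x y - ip x' y.
Proof. by rewrite ipDl ipNl. Qed.
Lemma ipDr x x' y : ip y (x + x') = ip y x + ip y x'.
Proof. by rewrite !(ipC _ y) ipDl rmorphD. Qed.
Lemma ip0r y : ip y 0 = 0.
Proof. by rewrite ipC ip0l rmorph0. Qed.
Lemma ipZr c x y : ip y (c *: x) = c^* * ip y x.
Proof. by rewrite !(ipC _ y) ipZl rmorphM. Qed.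
Lemma ipNr x y : ip y (- x) = - ip y x.
Proof. by rewrite !(ipC _ y) ipNl rmorphN. Qed.
Lemma ipBr x x' y : ip y (x - x') = ip y x - ip y x'.
Proof. by rewrite ipDr ipNr. Qed.
Lemma ip_suml (I : Type) (s : seq I) (P : pred I) (F : I -> W) y :
  ip (\sum_(i <- s | P i) F i) y = \sum_(i <- s | P i) ip (F i) y.
Proof. by apply: (big_morph (ip^~ y)) => [x x'|]; rewrite ?ip0l ?ipDl. Qed.
Lemma ip_sumr (I : Type) (s : seq I) (P : pred I) (F : I -> W) y :
  ip y (\sum_(i <- s | P i) F i) = \sum_(i <- s | P i) ip y (F i).
Proof. by apply: (big_morph (ip y)) => [x x'|]; rewrite ?ip0r ?ipDr. Qed.

Let ipE := (ipDl, ipNl, ipZl, ipDr, ipNr, ipZr).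

Lemma ip_conj x : (ip x x)^* = ip x x.
Proof. by rewrite -ipC. Qed.

Lemma cauchy_schwarz x y : `|ip x y| ^+ 2 <= ip x x * ip y y.
Proof.
have [b0|bn0] := eqVneq (ip y y) 0; last first.
  have b_gt0 : 0 < ip y y by rewrite lt_def bn0 ip_ge0.
  have := ip_ge0 (ip y y *: x - ip x y *: y).
  rewrite !ipE ip_conj normCK (ipC x y).
  set a := ip x x; set b := ip y y; set c := ip x y.
  rewrite (_ : _ - _ = b * (a * b - c * c^*)); last by ring.
  by rewrite pmulr_rge0 // subr_ge0.
rewrite b0 mulr0; have [->|c0] := eqVneq (ip x y) 0.
  by rewrite normr0 expr0n.
have c_gt0 : 0 < `|ip x y| ^+ 2 by rewrite exprn_gt0 ?normr_gt0.
set c := ip x y in c_gt0 *.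
(* With [ip y y = 0] the form at [x - (t * c) *: y] is affine in [t], namely [ip x x - 2 t |c|^2];
   this [t] gives it the value [-(ip x x + 2)], which cannot be nonnegative. *)
pose t := (ip x x + 1) / `|c| ^+ 2.
have t_ge0 : 0 <= t by rewrite divr_ge0 ?addr_ge0 ?ip_ge0 ?exprn_ge0.
have := ip_ge0 (x - (t * c) *: y).
rewrite !ipE b0 !mulr0 rmorphM /= (ipC x y).
rewrite (CrealP (ger0_real t_ge0)) -/c.
rewrite (_ : _ - _ = ip x x - t * `|c| ^+ 2 - t * `|c| ^+ 2); last first.
  by rewrite normCK; ring.
rewrite /t mulfVK ?gt_eqF //.
rewrite (_ : _ - _ = - (ip x x + 1 + 1)); last by ring.
rewrite oppr_ge0 => h; have := le_lt_trans h ltr01.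
by rewrite gtrDr => /lt_le_trans/(_ (addr_ge0 (ip_ge0 x) ler01)); rewrite ltxx.
Qed.

Lemma ip_eq0r x y : ip y y = 0 -> ip x y = 0.
Proof.
move=> y0; have := cauchy_schwarz x y.
by rewrite y0 mulr0 -normrX normr_le0 expf_eq0 /= => /eqP.
Qed.

Lemma ip_symB x y : ip (x - y) (x - y) = ip (y - x) (y - x).
Proof. by rewrite -opprB ipNl ipNr opprK. Qed.

(* The first-order condition at a near-minimiser of the distance to a line. *)
Lemma near_minimizer_ip v z e : 0 <= e ->
  (forall c, ip v v <= ip (v - c *: z) (v - c *: z) + e) ->
  `|ip v z| ^+ 2 <= e * ip z z.
Proof.
move=> e0 hv; have [b0|bn0] := eqVneq (ip z z) 0.
  by rewrite ip_eq0r // normr0 expr0n mulr_ge0 ?ip_ge0.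
have b_gt0 : 0 < ip z z by rewrite lt_def bn0 ip_ge0.
have bC : (ip z z)^-1^* = (ip z z)^-1 by rewrite fmorphV /= ip_conj.
(* The coefficient of the projection of [v] on [z] gives the largest decrease,
   [|ip v z|^2 / ip z z]. *)
rewrite -ler_pdivrMr //; have := hv (ip v z / ip z z).
rewrite !ipE rmorphM /= bC (ipC v z) normCK.
set a := ip v v; set c := ip v z; set b := ip z z in bn0 *.
rewrite (_ : _ + e = a + (e - c * c^* / b)); last by field.
by rewrite lerDl subr_ge0.
Qed.

End SemiInner.

Section Projection.
Variables (R : realType) (W : lmodType R[i]) (ip : W -> W -> R[i]).

Definition ip_complete : Prop := forall u : nat -> W,
  (forall e, 0 < e -> exists N, forall m n, (N <= m)%N -> (N <= n)%N ->
     ip (u m - u n) (u m - u n) < e) ->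
  exists l, forall e, 0 < e -> exists N, forall n, (N <= n)%N ->
     ip (u n - l) (u n - l) < e.

Lemma eq0_small (a : R[i]) : 0 <= a -> (forall e, 0 < e -> a <= e) -> a = 0.
Proof.
move=> a0 ha; apply/eqP/negPn/negP => an0.
have a_gt0 : 0 < a by rewrite lt_def an0.
have := ha (a / 2) (divr_gt0 a_gt0 (ltr0Sn _ _)).
by rewrite ler_pdivlMr ?ltr0Sn // ger_pMr // -[X in _ <= X]addr0 -natr1 lerD2l ler10.
Qed.

Lemma invn_real n : n.+1%:R^-1 = (n.+1%:R^-1 : R)%:C%C.
Proof. by rewrite -[n.+1%:R](rmorph_nat (real_complex R)) -fmorphV. Qed.

Lemma small_invn (e : R[i]) : 0 < e -> exists N, forall n, (N <= n)%N -> n.+1%:R^-1 < e.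
Proof.
move=> e0; have eR := RRe_real (gtr0_real e0).
have r0 : 0 < complex.Re e by rewrite -ltcR eR.
exists (Num.truncn (complex.Re e)^-1) => n Nn.
rewrite -eR invn_real ltcR.
rewrite invf_plt ?posrE ?ltr0Sn //.
by rewrite (lt_le_trans (truncnS_gt _)) // ler_nat ltnS.
Qed.

Lemma sqr_normD (x y : R[i]) : `|x + y| ^+ 2 <= 2 * (`|x| ^+ 2 + `|y| ^+ 2).
Proof.
have h : `|x + y| ^+ 2 <= (`|x| + `|y|) ^+ 2 by rewrite lerXn2r ?nnegrE ?addr_ge0 ?ler_normD.
apply: le_trans h _; rewrite -subr_ge0.
rewrite (_ : _ - _ = (`|x| - `|y|) ^+ 2); last by ring.
by rewrite real_exprn_even_ge0 // rpredB ?normr_real.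
Qed.

Hypotheses (ipP : semi_inner ip) (ip_cpl : ip_complete).

(** [D] is not assumed closed, so [p] is only adherent to it. Near-minimisers [u n] of the distance
    to [x] leave residuals almost orthogonal to [D]; as [u m - u n] lies in [D] and is itself a
    difference of two residuals, it is almost orthogonal to itself, which makes [u] Cauchy. *)
Lemma orthogonal_projection (D : set W) (x : W) : subspace D ->
  exists2 p, forall e, 0 < e -> exists2 y, D y & ip (p - y) (p - y) < e
           & forall y, D y -> ip (x - p) y = 0.
Proof.
move=> [D0 DP].
have DB y z : D y -> D z -> D (y - z).
  by move=> Dy Dz; rewrite -scaleN1r addrC; apply: DP.
pose E : set R := [set complex.Re (ip (x - y) (x - y)) | y in D].
have reE y : (complex.Re (ip (x - y) (x - y)))%:C%C = ip (x - y) (x - y).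
  by rewrite RRe_real // ger0_real // ip_ge0.
have Elb : has_inf E.
  split; first by exists (complex.Re (ip (x - 0) (x - 0))), 0.
  by exists 0 => _ [y _ <-]; rewrite -ler0c reE ip_ge0.
have near_min n : exists y, D y /\
    forall z, D z -> ip (x - y) (x - y) <= ip (x - z) (x - z) + n.+1%:R^-1.
  have n0 : (0 : R) < n.+1%:R^-1 by rewrite invr_gt0 ltr0Sn.
  have [_ [y Dy <-] hy] := inf_adherent n0 Elb.
  exists y; split=> // z Dz.
  rewrite -(reE y) -(reE z) invn_real -rmorphD lecR (le_trans (ltW hy)) // lerD2r.
  by apply: ge_inf; [case: Elb | exists z].
have [u hu] := choice near_min.
have uD n : D (u n) by case: (hu n).
have key n z : D z -> `|ip (x - u n) z| ^+ 2 <= n.+1%:R^-1 * ip z z.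
  move=> Dz; apply: near_minimizer_ip => // [|c].
    by rewrite invr_ge0 ler0n.
  rewrite -addrA -opprD; case: (hu n) => _; apply.
  by rewrite addrC; exact: DP.
have [p hp] : exists l, forall e, 0 < e -> exists N, forall n, (N <= n)%N ->
    ip (u n - l) (u n - l) < e.
  apply: ip_cpl => e e0.
  (* Two residuals contribute [2 * (e / 5 + e / 5)], which leaves [ip w w] at most [4 e / 5],
     strictly below [e]. *)
  have e8 : 0 < e / 5 by rewrite divr_gt0 ?ltr0Sn.
  have [N hN] := small_invn e8; exists N => m n Nm Nn.
  set w := u m - u n; have Dw : D w by exact: DB.
  have [-> //|wn0] := eqVneq (ip w w) 0.
  have w0 : 0 < ip w w by rewrite lt_def wn0 ip_ge0.
  have : `|ip w w| ^+ 2 <= (e / 5 * 4) * ip w w.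
    have wE : ip w w = ip (x - u n) w - ip (x - u m) w.
      by rewrite -ipNl // -ipDl // opprB addrC addrA subrK.
    rewrite {1}wE; apply: le_trans (sqr_normD _ _) _; rewrite normrN.
    have -> : (e / 5 * 4) = 2 * (e / 5 + e / 5) by field.
    rewrite -mulrA ler_pM2l ?ltr0Sn // mulrDl.
    by rewrite lerD // (le_trans (key _ _ Dw)) // ler_wpM2r ?ip_ge0 // ltW // hN.
  rewrite ger0_norm ?ip_ge0 // expr2 ler_pM2r // => h; apply: le_lt_trans h _.
  by rewrite mulrAC ltr_pdivrMr ?ltr0Sn // ltr_pM2l // ltr_nat.
exists p => [e e0|y Dy].
  have [N hN] := hp e e0; exists (u N) => //.
  by rewrite ip_symB // hN.
apply/eqP; rewrite -normr_eq0 -sqrf_eq0; apply/eqP.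
apply: eq0_small => [|e e0]; first by rewrite exprn_ge0.
(* The added 1 keeps the divisor positive when [ip y y = 0]; the 4 in [e / (4 * K)] pays for
   [sqr_normD] on two terms. *)
set K := ip y y + 1; have K0 : 0 < K by rewrite ltr_wpDl ?ip_ge0.
have d0 : 0 < e / (4 * K) by rewrite divr_gt0 // mulr_gt0 ?ltr0Sn.
have [N1 hN1] := small_invn d0; have [N2 hN2] := hp _ d0.
set n := maxn N1 N2.
have -> : ip (x - p) y = ip (x - u n) y + ip (u n - p) y.
  by rewrite -ipDl // addrA subrK.
apply: le_trans (sqr_normD _ _) _.
have yK : ip y y <= K by rewrite lerDl.
have -> : e = 2 * (e / (4 * K) * K + e / (4 * K) * K).
  by field; rewrite gt_eqF.
rewrite ler_pM2l ?ltr0Sn // lerD //.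
  apply: le_trans (key _ _ Dy) _; rewrite ler_pM ?ip_ge0 ?invr_ge0 ?ler0n //.
  by rewrite ltW // hN1 // leq_maxl.
apply: le_trans (cauchy_schwarz ipP _ _) _; rewrite ler_pM ?ip_ge0 //.
by rewrite ltW // hN2 // leq_maxr.
Qed.
End Projection.

(** * Adjoints of bounded operators *)

Section HilbertBasics.
Variables (R : realType) (H : hilbertType R).
Implicit Types (x y z : H) (D : set H).

Lemma inner_semi : semi_inner (@inner R H).
Proof.
split=> [c x x' y|x y|x]; first by rewrite linearPl.
  by rewrite (hermC inner) expr0 mul1r.
by rewrite -inner_norm exprn_ge0.
Qed.

Lemma inner_eq0 x : inner x x = 0 -> x = 0.
Proof. by rewrite -inner_norm => /eqP; rewrite expf_eq0 normr_eq0 /= => /eqP. Qed.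

Lemma inner_le x y : `|inner x y| <= `|x| * `|y|.
Proof.
rewrite -(@ler_pXn2r _ 2) ?nnegrE ?mulr_ge0 //.
by rewrite exprMn !inner_norm (cauchy_schwarz inner_semi).
Qed.

Lemma innerC x y : inner y x = (inner x y)^*.
Proof. exact: (ipC inner_semi). Qed.

Lemma inner_sqr_lt x (e : R[i]) : 0 < e -> (inner x x < e ^+ 2) = (`|x| < e).
Proof. by move=> e0; rewrite -inner_norm ltr_pXn2r ?nnegrE // ltW. Qed.

Lemma norm_sqrtC_lt x (e : R[i]) : 0 < e -> (`|x| < sqrtC e) = (inner x x < e).
Proof. by move=> e0; rewrite -inner_sqr_lt ?sqrtC_gt0 // sqrtCK. Qed.

Lemma inner_complete : ip_complete (@inner R H).
Proof.
move=> u cu.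
have : cvg (u @ \oo).
  apply: cauchy_cvg; apply: cauchy_exP => e e0.
  have [N hN] := cu (e ^+ 2) (exprn_gt0 _ e0).
  exists (u N); exists N => // n /= Nn.
  by rewrite -ball_normE /= -inner_sqr_lt // hN.
move=> /cvgrPdist_lt hl; exists (lim (u @ \oo)) => e e0.
have [N _ hN] := hl (sqrtC e) (etrans (sqrtC_gt0 _) e0).
exists N => n /hN; rewrite distrC norm_sqrtC_lt //.
Qed.

Lemma denseP D : closure D = setT <->
  forall x (e : R[i]), 0 < e -> exists2 y, D y & `|x - y| < e.
Proof.
split=> [clD x e e0|hD].
  have : closure D x by rewrite clD.
  move=> /(_ _ (nbhsx_ballx x e e0)) [y [Dy]].
  by rewrite -ball_normE; exists y.
apply/seteqP; split=> // x _ B /nbhs_ballP[e e0 eB].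
have [y Dy xy] := hD x e e0.
by exists y; split=> //; apply: eB; rewrite -ball_normE.
Qed.

Lemma inner_eq0_dense D x :
  closure D = setT -> (forall y, D y -> inner x y = 0) -> x = 0.
Proof.
move=> /denseP hD h; apply/eqP; rewrite -normr_eq0; apply/eqP.
apply: eq0_small => // e e0.
have [->|x0] := eqVneq x 0; first by rewrite normr0 ltW.
have [y Dy xy] := hD x e e0.
rewrite -(@ler_pM2l _ `|x|) ?normr_gt0 // -expr2 inner_norm.
have -> : inner x x = inner x (x - y).
  by rewrite (ipBr inner_semi) (h y Dy) subr0.
rewrite -[inner x (x - y)]ger0_norm; last first.
  by rewrite (ipBr inner_semi) (h y Dy) subr0 (ip_ge0 inner_semi).
by apply: le_trans (inner_le _ _) _; rewrite ler_wpM2l // ltW.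
Qed.

Lemma inner_inj_dense D x x' :
  closure D = setT -> (forall y, D y -> inner x y = inner x' y) -> x = x'.
Proof.
move=> hD h; apply/eqP; rewrite -subr_eq0; apply/eqP.
apply: inner_eq0_dense hD _ => y Dy.
by rewrite (ipBl inner_semi) h ?subrr.
Qed.

Lemma inner_inj x x' : (forall y, inner x y = inner x' y) -> x = x'.
Proof.
move=> h; apply: (@inner_inj_dense setT) => //.
by apply/denseP => z e e0; exists z; rewrite // subrr normr0.
Qed.

(* f is a multiple of the inner product with the component of x0 orthogonal to
   the kernel of f, which is closed since f is bounded. *)
Lemma riesz (f : H -> R[i]) (C : R[i]) :
  (forall c x y, f (c *: x + y) = c * f x + f y) -> 0 < C ->
  (forall x, `|f x| <= C * `|x|) -> exists y, forall x, f x = inner x y.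
Proof.
move=> fP C0 fC.
have f0 : f 0 = 0.
  by have := fP (-1) 0 0; rewrite scaler0 addr0 mulN1r addNr.
have fB x y : f (x - y) = f x - f y.
  by rewrite -scaleN1r addrC fP mulN1r addrC.
have fZ c x : f (c *: x) = c * f x by rewrite -[c *: x]addr0 fP f0 addr0.
case: (pselect (exists x, f x != 0)) => [[x0 fx0]|nf]; last first.
  exists 0 => x; rewrite (ip0r inner_semi); apply/eqP/negPn/negP => fx.
  by apply: nf; exists x.
have Dsub : subspace [set x | f x = 0].
  by split=> // c x y /= fx fy; rewrite fP fx fy mulr0 addr0.
have [p hp hort] := orthogonal_projection inner_semi inner_complete x0 Dsub.
have fp : f p = 0.
  apply/eqP; rewrite -normr_eq0; apply/eqP; apply: eq0_small => // e e0.
  have e' : 0 < (e / C) ^+ 2 by rewrite exprn_gt0 // divr_gt0.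
  have [y /= fy] := hp _ e'; rewrite inner_sqr_lt ?divr_gt0 // => py.
  rewrite -[f p]subr0 -fy -fB; apply: le_trans (fC _) _.
  by rewrite mulrC -ler_pdivlMr // ltW.
set z := x0 - p in hort.
have fz : f z != 0 by rewrite fB fp subr0.
have zz : inner z z != 0.
  by apply: contra_neq fz => /inner_eq0 ->.
(* [f z *: x - f x *: z] is in the kernel of [f], hence orthogonal to [z]; solving this relation for
   [f x] gives the vector. The conjugate is due to the antilinearity of [inner] in its second
   argument. *)
exists ((f z / inner z z)^* *: z) => x.
have : inner z (f z *: x - f x *: z) = 0.
  by apply: hort => /=; rewrite fB !fZ mulrC subrr.
rewrite (ipC inner_semi) => /eqP; rewrite conjC_eq0 (ipBl inner_semi) => /eqP.
rewrite !(ipZl inner_semi) => /eqP; rewrite subr_eq0 => /eqP h.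
by rewrite (ipZr inner_semi) conjCK mulrAC h mulfK.
Qed.

End HilbertBasics.

Section BoundedOperators.
Variable R : realType.
Implicit Types H K L : hilbertType R.

Lemma bounded_opP H K (T : H -> K) : bounded_op T <->
  linear T /\ exists2 C, 0 < C & forall x, `|T x| <= C * `|x|.
Proof.
split=> [[lT cT]|[lT [C C0 hC]]].
  pose B := GRing.isLinear.Build R[i] H K *:%R T lT.
  pose F : {linear H -> K} := HB.pack T B.
  split=> //.
  have /linear_boundedP := (proj2 (linear_bounded_continuous F) cT).
  move=> [M [Mr hM]].
  have M1 : 0 < `|M| + 1 by rewrite ltr_wpDl.
  exists (`|M| + 1) => // x; apply: hM.
  by rewrite (le_lt_trans (real_ler_norm Mr)) // ltrDl.
split=> // x.
apply/cvgrPdist_lt => e e0.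
near=> y.
have -> : T x - T y = T (x - y).
  by rewrite -scaleN1r addrC -lT scaleN1r addrC.
apply: le_lt_trans (hC _) _.
rewrite mulrC -ltr_pdivlMr //.
near: y; apply: cvgr_dist_lt => //; exact: divr_gt0.
Unshelve. all: by end_near.
Qed.

Lemma bounded_linear H K (T : H -> K) : bounded_op T -> linear T.
Proof. by case. Qed.

Lemma bounded_bound H K (T : H -> K) : bounded_op T ->
  exists2 C, 0 < C & forall x, `|T x| <= C * `|x|.
Proof. by case/bounded_opP. Qed.

Lemma fun_linE H K (c : R[i]) (S T : H -> K) x : (c *: S + T) x = c *: S x + T x.
Proof. by []. Qed.
Lemma fun0E H K (x : H) : (0 : H -> K) x = 0.
Proof. by []. Qed.

Lemma bounded_op_id H : @bounded_op R H H id.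
Proof. by apply/bounded_opP; split=> //; exists 1 => // x; rewrite mul1r. Qed.

Lemma bounded_op_comp H K L (S : K -> L) (T : H -> K) :
  bounded_op S -> bounded_op T -> bounded_op (S \o T).
Proof.
move=> [lS cS] [lT cT]; split=> [c x y|x] /=; first by rewrite lT lS.
by apply: continuous_comp; [exact: cT | exact: cS].
Qed.

Lemma bounded_op_lin H K (c : R[i]) (S T : H -> K) :
  bounded_op S -> bounded_op T -> bounded_op (c *: S + T).
Proof.
move=> /bounded_opP[lS [C C0 hC]] /bounded_opP[lT [D D0 hD]]; apply/bounded_opP; split.
  move=> a x y; rewrite !fun_linE lS lT !scalerDr !scalerA (mulrC c) -!addrA.
  by congr (_ + _); rewrite addrCA.
exists (`|c| * C + D); first by rewrite ltr_wpDl // mulr_ge0 // ltW.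
move=> x; rewrite fun_linE; apply: le_trans (ler_normD _ _) _.
by rewrite normrZ mulrDl lerD // -mulrA ler_wpM2l.
Qed.

Lemma bounded_op0 H K : @bounded_op R H K 0.
Proof.
apply/bounded_opP; split=> [c x y|]; first by rewrite !fun0E scaler0 addr0.
by exists 1 => // x; rewrite fun0E normr0 mul1r.
Qed.

Lemma bounded_ext_dense H K (D : set H) (S T : H -> K) :
  bounded_op S -> bounded_op T -> closure D = setT ->
  (forall x, D x -> S x = T x) -> S = T.
Proof.
move=> bS bT /denseP hD ST; apply/funext => x; apply/eqP; rewrite -subr_eq0 -normr_eq0.
apply/eqP; apply: eq0_small => // e e0.
have [C C0 hC] := bounded_bound bS; have [C' C'0 hC'] := bounded_bound bT.
have [y Dy xy] := hD x (e / (C + C')) (divr_gt0 e0 (addr_gt0 C0 C'0)).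
have -> : S x - T x = S (x - y) - T (x - y).
  rewrite (linB (bounded_linear bS)) (linB (bounded_linear bT)).
  by rewrite (ST y Dy) opprB addrA subrK.
apply: le_trans (ler_normB _ _) _.
apply: le_trans (lerD (hC _) (hC' _)) _.
by rewrite -mulrDl mulrC -ler_pdivlMr ?addr_gt0 // ltW.
Qed.

Lemma bounded_inner_ext H K (D : set H) (D' : set K) (S T : H -> K) :
  bounded_op S -> bounded_op T -> closure D = setT -> closure D' = setT ->
  (forall x y, D x -> D' y -> inner (S x) y = inner (T x) y) -> S = T.
Proof.
move=> bS bT hD hD' ST; apply: (bounded_ext_dense bS bT hD) => x Dx.
by apply: (inner_inj_dense hD') => y; exact: ST.
Qed.

Lemma adjoint_unique H K (T : H -> K) (S S' : K -> H) :
  is_adjoint T S -> is_adjoint T S' -> S = S'.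
Proof.
move=> h h'; apply/funext => y; apply: inner_inj => x.
by rewrite innerC -h h' -innerC.
Qed.

(** For each [y] the functional [x |-> inner (T x) y] is bounded, so Riesz represents it, and choice
    collects the representing vectors into a function. *)
Lemma adjP H K (T : H -> K) : bounded_op T -> is_adjoint T (adj T).
Proof.
move=> bT; apply: (@xgetPex _ 0 (is_adjoint T)).
have [C C0 hC] := bounded_bound bT.
have h y : exists z, forall x, inner (T x) y = inner x z.
  apply: (@riesz _ _ _ (C * (`|y| + 1))) => [c x x'||x].
  - by rewrite (bounded_linear bT) (ipDl (inner_semi _)) (ipZl (inner_semi _)).
  - by rewrite mulr_gt0 // ltr_wpDl.
  apply: le_trans (inner_le _ _) _.
  rewrite mulrAC ler_pM // ?lerDl //.
by have [S hS] := choice h; exists S => x y; exact: hS.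
Qed.

Lemma adj_eq H K (T : H -> K) (S : K -> H) : is_adjoint T S -> adj T = S.
Proof.
move=> h; apply: adjoint_unique (h).
by apply: (@xgetPex _ 0 (is_adjoint T)); exists S.
Qed.

Lemma is_adjoint_sym H K (T : H -> K) (S : K -> H) : is_adjoint T S -> is_adjoint S T.
Proof. by move=> h x y; rewrite innerC -h -innerC. Qed.

(** Follows from [|adj T y|^2 = inner (T (adj T y)) y] by Cauchy-Schwarz and division by
    [|adj T y|]. *)
Lemma adj_bound H K (T : H -> K) (C : R[i]) : bounded_op T -> 0 <= C ->
  (forall x, `|T x| <= C * `|x|) -> forall y, `|adj T y| <= C * `|y|.
Proof.
move=> bT C0 hC y; have hT := adjP bT.
have [->|n0] := eqVneq (adj T y) 0; first by rewrite normr0 mulr_ge0.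
rewrite -(@ler_pM2l _ `|adj T y|) ?normr_gt0 // -expr2 inner_norm -hT.
rewrite -[inner _ y]ger0_norm; last by rewrite hT (ip_ge0 (inner_semi _)).
by apply: le_trans (inner_le _ _) _; rewrite mulrA ler_wpM2r // mulrC hC.
Qed.

Lemma bounded_adj H K (T : H -> K) : bounded_op T -> bounded_op (adj T).
Proof.
move=> bT; have hT := adjP bT; apply/bounded_opP; split.
  move=> c y y'; apply: inner_inj => x; rewrite (ipDl (inner_semi _)) (ipZl (inner_semi _)).
  rewrite !(is_adjoint_sym hT).
  by rewrite (ipDl (inner_semi _)) (ipZl (inner_semi _)).
have [C C0 hC] := bounded_bound bT; exists C => //.
by apply: adj_bound => //; exact: ltW.
Qed.

Lemma adjK H K (T : H -> K) : bounded_op T -> adj (adj T) = T.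
Proof. by move=> bT; apply: adj_eq; apply: is_adjoint_sym; apply: adjP. Qed.

Lemma adj_comp H K L (S : K -> L) (T : H -> K) : bounded_op S -> bounded_op T ->
  adj (S \o T) = adj T \o adj S.
Proof. by move=> bS bT; apply: adj_eq => x y; rewrite /= !adjP. Qed.

Lemma adj_lin H K (c : R[i]) (S T : H -> K) : bounded_op S -> bounded_op T ->
  adj (c *: S + T) = c^* *: adj S + adj T.
Proof.
move=> bS bT; apply: adj_eq => x y; rewrite !fun_linE.
rewrite (ipDl (inner_semi _)) (ipZl (inner_semi _)) (ipDr (inner_semi _)).
by rewrite (ipZr (inner_semi _)) conjCK !adjP.
Qed.

Lemma adj_id H : adj (@id H) = id.
Proof. by apply: adj_eq. Qed.

Lemma adj0 H K : adj (0 : H -> K) = 0.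
Proof. by apply: adj_eq => x y; rewrite !fun0E (ip0l (inner_semi _)) (ip0r (inner_semi _)). Qed.

End BoundedOperators.

(** * Operators on Hilbert tensor products *)

Section Extension.
Variable R : realType.

Lemma norm_complete (H : hilbertType R) (u : nat -> H) :
  (forall e : R[i], 0 < e -> exists N, forall m n, (N <= m)%N -> (N <= n)%N ->
     `|u m - u n| < e) ->
  exists l, forall e : R[i], 0 < e -> exists N, forall n, (N <= n)%N -> `|u n - l| < e.
Proof.
move=> cu; have [e e0|l hl] := @inner_complete R H u.
  have [N hN] := cu (sqrtC e) (etrans (sqrtC_gt0 _) e0).
  by exists N => m n Nm Nn; rewrite -norm_sqrtC_lt // hN.
exists l => e e0; have [N hN] := hl (e ^+ 2) (exprn_gt0 _ e0).
by exists N => n Nn; rewrite -inner_sqr_lt // hN.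
Qed.

Lemma le_small (a b M : R[i]) : 0 < M ->
  (forall e, 0 < e -> a <= b + M * e) -> a <= b.
Proof.
move=> M0 h; apply/ler_addgt0Pr => e e0.
by have := h (e / M) (divr_gt0 e0 M0); rewrite mulrCA mulfV ?gt_eqF // mulr1.
Qed.

(** The order of [R[i]] compares only numbers with the same imaginary part, so the reality of [a]
    has to be passed to the limit before its sign. *)
Lemma ge0_approx (a : R[i]) :
  (forall e, 0 < e -> exists2 b, 0 <= b & `|a - b| <= e) -> 0 <= a.
Proof.
move=> close.
have areal : a \is Num.real.
  rewrite CrealE; apply/eqP/esym/eqP; rewrite -subr_eq0 -normr_eq0; apply/eqP.
  apply: eq0_small => // e e0.
  have [b b0 ab] := close (e / 2) (divr_gt0 e0 (ltr0Sn _ _)).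
  have -> : a - a^* = (a - b) - (a - b)^*.
    by rewrite rmorphB /= (CrealP (ger0_real b0)) opprB addrA subrK.
  apply: le_trans (ler_normB _ _) _; rewrite norm_conjC.
  by rewrite [e](splitr e) lerD.
apply: (@le_small 0 a 1) => // e e0; rewrite mul1r.
have [b b0 ab] := close e e0; apply: le_trans (b0) _; rewrite -lerBlDl.
apply: le_trans ab; rewrite distrC real_ler_norm // rpredB //.
exact: ger0_real b0.
Qed.

(* The extension is the closure of the graph of J t |-> F t. *)
Lemma bounded_extension (E : lmodType R[i]) (H K : hilbertType R)
    (J : {linear E -> H}) (F : {linear E -> K}) (C : R[i]) :
  0 < C -> (forall t, `|F t| <= C * `|J t|) -> closure (range J) = setT ->
  exists U : H -> K, [/\ bounded_op U, forall x, `|U x| <= C * `|x|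
                      & forall t, U (J t) = F t].
Proof.
move=> C0 hC /denseP hJ.
(* [J] may have a kernel, so [F] is not first descended to the range of [J]: the graph is closed
   directly, and the bound [hC] makes it single-valued. *)
pose G v w := forall e : R[i], 0 < e -> exists t, `|v - J t| < e /\ `|w - F t| < e.
have Gtot v : exists w, G v w.
  have /choice[u hu] n : exists t, `|v - J t| < (n.+1%:R^-1 : R[i]).
    have [|_ [t _ <-]] := hJ v (n.+1%:R^-1); first by rewrite invr_gt0 ltr0Sn.
    by exists t.
  have [e e0|w hw] := @norm_complete K (F \o u).
    have e' : 0 < e / (2 * C) by rewrite divr_gt0 // mulr_gt0 ?ltr0Sn.
    have [N hN] := small_invn e'; exists N => m n Nm Nn /=.
    rewrite -linearB; apply: le_lt_trans (hC _) _; rewrite linearB.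
    have -> : e = C * (e / (2 * C) + e / (2 * C)) by field; rewrite gt_eqF.
    rewrite ltr_pM2l // (le_lt_trans (ler_distD v _ _)) //.
    rewrite ltrD // ?(lt_trans (hu _)) ?hN //.
    by rewrite distrC (lt_trans (hu _)) ?hN.
  exists w => e e0; have [N hN] := small_invn e0; have [N' hN'] := hw e e0.
  exists (u (maxn N N')); split; last by rewrite distrC hN' // leq_maxr.
  by rewrite (lt_trans (hu _)) // hN // leq_maxl.
have Gbound v w : G v w -> `|w| <= C * `|v|.
  move=> g; apply: (@le_small _ _ (1 + C)) => [|e e0]; first by rewrite addr_gt0.
  have [t [vt wt]] := g e e0.
  have -> : w = (w - F t) + F t by rewrite subrK.
  apply: le_trans (ler_normD _ _) _.
  have -> : C * `|v| + (1 + C) * e = e + C * (`|v| + e) by ring.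
  rewrite lerD // ?(ltW wt) // (le_trans (hC _)) // ler_wpM2l ?(ltW C0) //.
  have -> : J t = v - (v - J t) by rewrite opprB addrC subrK.
  by rewrite (le_trans (ler_normB _ _)) // lerD // ltW.
have Glin c v w v' w' : G v w -> G v' w' -> G (c *: v + v') (c *: w + w').
  move=> g g' e e0.
  have M0 : 0 < `|c| + 1 by rewrite ltr_wpDl.
  have d0 : 0 < e / (`|c| + 1) by rewrite divr_gt0.
  have [t [vt wt]] := g _ d0; have [t' [vt' wt']] := g' _ d0.
  have est (L : hilbertType R) (x y x' y' : L) :
      `|x - y| < e / (`|c| + 1) -> `|x' - y'| < e / (`|c| + 1) ->
      `|c *: x + x' - (c *: y + y')| < e.
    move=> h h'; rewrite opprD addrACA -scalerBr.
    apply: le_lt_trans (ler_normD _ _) _; rewrite normrZ.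
    have -> : e = `|c| * (e / (`|c| + 1)) + e / (`|c| + 1).
      by field; rewrite gt_eqF.
    by rewrite ler_ltD // ler_wpM2l // ltW.
  exists (c *: t + t'); have -> : J (c *: t + t') = c *: J t + J t' by rewrite linearP.
  have -> : F (c *: t + t') = c *: F t + F t' by rewrite linearP.
  by split; apply: est.
have [U hU] := choice Gtot.
have Guniq v w w' : G v w -> G v w' -> w = w'.
  move=> g g'; apply/eqP; rewrite -subr_eq0 -normr_le0.
  have := Gbound _ _ (Glin (-1) _ _ _ _ g' g).
  by rewrite !scaleN1r addNr normr0 mulr0 addrC.
exists U; split=> [|x|t]; last 2 first.
- exact: Gbound.
- apply: Guniq (hU _) _ => e e0; exists t; by rewrite !subrr !normr0.
apply/bounded_opP; split=> [c x y|]; last by exists C => // x; exact: Gbound.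
by apply: Guniq (hU _) _; apply: Glin.
Qed.
End Extension.

Section HilbertTensor.
Variables (R : realType) (H K HK : hilbertType R) (ox : H -> K -> HK).
Hypothesis Hox : hilbert_tensor ox.

Lemma ox_bilinear : bilinear_for *:%R *:%R ox. Proof. by case: Hox. Qed.
Lemma inner_ox x y x' y' : inner (ox x y) (ox x' y') = inner x x' * inner y y'.
Proof. by case: Hox. Qed.

Lemma oxl_linear y : linear (ox^~ y).
Proof. by case: ox_bilinear => h _ c x x'; exact: h. Qed.
Lemma oxr_linear x : linear (ox x).
Proof. by case: ox_bilinear => _ h c y y'; exact: h. Qed.

Lemma norm_ox x y : `|ox x y| = `|x| * `|y|.
Proof.
apply/eqP; rewrite -(@eqrXn2 _ 2) ?mulr_ge0 //.
by rewrite exprMn !inner_norm inner_ox.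
Qed.

Lemma bounded_oxl y : bounded_op (ox^~ y).
Proof.
apply/bounded_opP; split; first exact: oxl_linear.
exists (`|y| + 1) => [|x]; first by rewrite ltr_wpDl.
by rewrite norm_ox mulrC ler_wpM2r // lerDl.
Qed.
Lemma bounded_oxr x : bounded_op (ox x).
Proof.
apply/bounded_opP; split; first exact: oxr_linear.
exists (`|x| + 1) => [|y]; first by rewrite ltr_wpDl.
by rewrite norm_ox ler_wpM2r // lerDl.
Qed.

Definition ox_lift : tensor H K -> HK := tlift ox.
HB.instance Definition _ :=
  GRing.isLinear.Build R[i] (tensor H K) HK *:%R ox_lift (tlift_linearP ox_bilinear).

Lemma ox_liftE x y : ox_lift (x ⊗ y) = ox x y.
Proof. exact: tlift_pureP ox_bilinear. Qed.

Lemma ox_lift0 : ox_lift 0 = 0. Proof. exact: linear0. Qed.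
Lemma ox_liftD t t' : ox_lift (t + t') = ox_lift t + ox_lift t'.
Proof. exact: linearD. Qed.

Lemma linear_pure_sum (W : lmodType R[i]) (F : {linear tensor H K -> W}) (b : H -> K -> W) :
  (forall x y, F (x ⊗ y) = b x y) -> forall n (f : nat -> H) (g : nat -> K),
  F (\sum_(i < n) f i ⊗ g i) = \sum_(i < n) b (f i) (g i).
Proof. by move=> FE n f g; rewrite linear_sum; apply: eq_bigr. Qed.

Lemma dense_ox_lift : closure (range ox_lift) = setT.
Proof.
case: Hox => _ _ /denseP h; apply/denseP => x e e0.
have [y hy xy] := h x e e0; exists y => //.
move: y hy {xy}; apply: lspan_subset; last first.
  by move=> _ [u _ [v _ <-]]; exists (u ⊗ v) => //; exact: ox_liftE.
split; first by exists 0 => //; rewrite linear0.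
by move=> c _ _ [t _ <-] [t' _ <-]; exists (c *: t + t') => //; rewrite linearP.
Qed.

Lemma bounded_ext_ox (L : hilbertType R) (D : set H) (E : set K) (U U' : HK -> L) :
  bounded_op U -> bounded_op U' -> closure D = setT -> closure E = setT ->
  (forall x y, D x -> E y -> U (ox x y) = U' (ox x y)) -> U = U'.
Proof.
move=> bU bU' hD hE UU'; apply: (bounded_ext_dense bU bU' dense_ox_lift).
move=> _ [t _ <-]; elim/tensor_ind: t => [x y||t t' ht ht'].
- rewrite ox_liftE.
  have h x0 y0 : D x0 -> U (ox x0 y0) = U' (ox x0 y0).
    move=> Dx; have := bounded_ext_dense (bounded_op_comp bU (bounded_oxr x0))
      (bounded_op_comp bU' (bounded_oxr x0)) hE.
    by move=> h; have /= -> // := congr1 (@^~ y0) (h (fun y => UU' x0 y Dx)).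
  have := bounded_ext_dense (bounded_op_comp bU (bounded_oxl y))
    (bounded_op_comp bU' (bounded_oxl y)) hD.
  by move=> h'; have /= := congr1 (@^~ x) (h' (fun x => h x y)).
- by rewrite linear0 !lin0 //; exact: bounded_linear.
- rewrite linearD (linD (bounded_linear bU)) (linD (bounded_linear bU')).
  by rewrite ht ht'.
Qed.

Lemma closure_setT (T : topologicalType) : closure [set: T] = setT.
Proof. by apply/seteqP; split=> // x _; apply: subset_closure. Qed.

Lemma bounded_ext_pure (L : hilbertType R) (U U' : HK -> L) :
  bounded_op U -> bounded_op U' ->
  (forall x y, U (ox x y) = U' (ox x y)) -> U = U'.
Proof.
by move=> bU bU' h; apply: (bounded_ext_ox bU bU' (closure_setT _) (closure_setT _)).
Qed.

Definition orthogonal_family (n : nat) (g : nat -> K) : Prop :=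
  forall i j, (i < n)%N -> (j < n)%N -> i != j -> inner (g i) (g j) = 0.

(* Gram-Schmidt, performed on the right legs without normalising. *)
Lemma orthogonal_rep (t : tensor H K) : exists n (f : nat -> H) (g : nat -> K),
  t = \sum_(i < n) f i ⊗ g i /\ orthogonal_family n g.
Proof.
rewrite (tensorE t); elim: {t}(repr t) => [|[x y] s [n [f [g [sE og]]]]].
  by exists 0, (fun=> 0), (fun=> 0); rewrite big_nil big_ord0.
rewrite big_cons /= sE {sE}.
(* For [g i = 0] the quotient is 0 by the convention on division, which is the right value since
   [inner y (g i)] vanishes too. *)
pose c i := inner y (g i) / inner (g i) (g i).
pose y' := y - \sum_(i < n) c i *: g i.
have y'0 j : (j < n)%N -> inner y' (g j) = 0.
  move=> jn; rewrite (ipBl (inner_semi _)) (ip_suml (inner_semi _)).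
  rewrite (bigD1 (Ordinal jn)) //= big1 => [|i ij]; last first.
    by rewrite (ipZl (inner_semi _)) og ?mulr0.
  rewrite (ipZl (inner_semi _)) addr0 /c.
  have [g0|g0] := eqVneq (inner (g j) (g j)) 0; last by rewrite divfK ?subrr.
  by rewrite g0 mulr0 subr0 (ip_eq0r (inner_semi _)).
(* The components of [y] along the old [g i] are moved to the left legs: [x ⊗ y] is [x ⊗ y'] plus
   the sum of the [(c i *: x) ⊗ g i]. *)
exists n.+1, (fun i => if i == n then x else f i + c i *: x),
  (fun i => if i == n then y' else g i); split.
  rewrite big_ord_recr /= eqxx addrC.
  have -> : x ⊗ y = x ⊗ y' + \sum_(i < n) (c i *: x) ⊗ g i.
    have {1}-> : y = y' + \sum_(i < n) c i *: g i by rewrite subrK.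
    rewrite linearDr linear_sumr; congr (_ + _).
    by apply: eq_bigr => i _; rewrite linearZr_LR linearZl_LR.
  rewrite -addrA -big_split /=; congr (_ + _).
  apply: eq_bigr => i _; rewrite ltn_eqF ?ltn_ord //.
  by rewrite linearDl addrC.
move=> i j; rewrite !ltnS (leq_eqVlt i) (leq_eqVlt j).
case: eqP => [->|_] /= hi; case: eqP => [->|_] /= hj; rewrite ?eqxx //.
- by move=> _; exact: y'0.
- by move=> _; rewrite innerC y'0 ?conjC0.
- exact: og.
Qed.

Lemma inner_orthogonal_family n (f f' : nat -> H) (g : nat -> K) :
  orthogonal_family n g ->
  inner (\sum_(i < n) ox (f i) (g i)) (\sum_(i < n) ox (f' i) (g i)) =
  \sum_(i < n) inner (f i) (f' i) * inner (g i) (g i).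
Proof.
move=> og; rewrite (ip_suml (inner_semi _)); apply: eq_bigr => i _.
rewrite (ip_sumr (inner_semi _)) (bigD1 i) //= inner_ox big1 ?addr0 // => j ji.
by rewrite inner_ox og ?mulr0 // eq_sym.
Qed.

(** When the right legs are orthogonal, the squared norm of the sum of the [S (f i) ⊗ g i] is the
    sum of the [|S (f i)|^2 |g i|^2], so the bound of [S] applies summand by summand. *)
Lemma op_left_exists (S : H -> H) (C : R[i]) : bounded_op S -> 0 < C ->
  (forall x, `|S x| <= C * `|x|) ->
  exists U : HK -> HK, [/\ bounded_op U, forall x, `|U x| <= C * `|x|
                        & forall x y, U (ox x y) = ox (S x) y].
Proof.
move=> bS C0 hC.
have lS := bounded_linear bS.
have SB : bilinear_for *:%R *:%R (fun x y => ox (S x) y).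
  split=> [y c x x'|x c y y'] /=; last exact: oxr_linear.
  by rewrite lS; exact: oxl_linear.
pose F0 : tensor H K -> HK := tlift (fun x y => ox (S x) y).
pose B := GRing.isLinear.Build R[i] (tensor H K) HK *:%R F0 (tlift_linearP SB).
pose F : {linear tensor H K -> HK} := HB.pack F0 B.
have FE x y : F (x ⊗ y) = ox (S x) y by exact: tlift_pureP SB.
have [t|U [bU hU UE]] := @bounded_extension R _ _ _ ox_lift F C C0 _ dense_ox_lift.
  have [n [f [g [-> og]]]] := orthogonal_rep t.
  rewrite (linear_pure_sum FE) (linear_pure_sum ox_liftE).
  rewrite -(@ler_pXn2r _ 2) ?nnegrE ?mulr_ge0 ?(ltW C0) // exprMn !inner_norm.
  rewrite (inner_orthogonal_family (S \o f) (S \o f)) // inner_orthogonal_family // mulr_sumr.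
  apply: ler_sum => i _ /=; rewrite mulrA ler_wpM2r ?(ip_ge0 (inner_semi _)) //.
  by rewrite -!inner_norm -exprMn ler_pXn2r ?nnegrE ?mulr_ge0 // ltW.
by exists U; split=> // x y; rewrite -ox_liftE UE FE.
Qed.

(** Both tensor products give simple tensors the same inner products, hence their sums the same
    norm. The flip is obtained from it by exchanging the factors in [ox']. *)
Lemma tensor_iso_exists (HK' : hilbertType R) (ox' : H -> K -> HK') :
  hilbert_tensor ox' ->
  exists U : HK -> HK', bounded_op U /\ forall x y, U (ox x y) = ox' x y.
Proof.
move=> [ox'B ox'I _].
pose F0 : tensor H K -> HK' := tlift ox'.
pose B := GRing.isLinear.Build R[i] (tensor H K) HK' *:%R F0 (tlift_linearP ox'B).
pose F : {linear tensor H K -> HK'} := HB.pack F0 B.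
have FE x y : F (x ⊗ y) = ox' x y by exact: tlift_pureP ox'B.
have [t|U [bU hU UE]] := @bounded_extension R _ _ _ ox_lift F 1 ltr01 _ dense_ox_lift.
  rewrite mul1r -(@ler_pXn2r _ 2) ?nnegrE // !inner_norm (tensorE t).
  rewrite (linear_sum F) (linear_sum ox_lift) !(ip_suml (inner_semi _)) le_eqVlt.
  apply/orP; left; apply/eqP.
  apply: eq_bigr => p _; rewrite !(ip_sumr (inner_semi _)); apply: eq_bigr => q _.
  by rewrite !FE ox'I -inner_ox -!ox_liftE.
by exists U; split=> // x y; rewrite -ox_liftE UE FE.
Qed.

(** On a tensor with orthogonal right legs the form is a sum of nonnegative terms, and such tensors
    are dense. *)
Lemma op_left_ge0 (S : H -> H) (U : HK -> HK) : bounded_op U ->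
  (forall x y, U (ox x y) = ox (S x) y) -> (forall x, 0 <= inner (S x) x) ->
  forall z, 0 <= inner (U z) z.
Proof.
move=> bU UE S0.
have pos t : 0 <= inner (U (ox_lift t)) (ox_lift t).
  have [n [f [g [-> og]]]] := orthogonal_rep t; rewrite (linear_pure_sum ox_liftE).
  rewrite (lin_sum (bounded_linear bU)).
  rewrite (eq_bigr (fun i : 'I_n => ox (S (f i)) (g i))) => [|i _]; last exact: UE.
  rewrite (inner_orthogonal_family (S \o f)) // sumr_ge0 // => i _.
  by rewrite mulr_ge0 ?(ip_ge0 (inner_semi _)) //; exact: S0.
move=> z; have [C C0 hC] := bounded_bound bU.
(* Replacing [z] by [w] changes the form by at most [C |z| d + C d |w|], which is at most [M d] once
   [d <= 1] gives [|w| <= |z| + 1]. The choice [d = e / (M + e)] secures both [d <= 1] and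
   [M d <= e]. *)
apply: ge0_approx => e e0; pose M := C * (2 * `|z| + 1).
  have M0 : 0 < M by rewrite mulr_gt0 // ltr_wpDl // mulr_ge0.
  pose d := e / (M + e).
  have d0 : 0 < d by rewrite divr_gt0 // addr_gt0.
  have d1 : d <= 1 by rewrite ler_pdivrMr ?addr_gt0 // mul1r lerDr ltW.
  have dM : M * d <= e.
    by rewrite mulrA ler_pdivrMr ?addr_gt0 // mulrC ler_wpM2l ?(ltW e0) // lerDl ltW.
  have [_ [t _ <-] zt] := (denseP _).1 dense_ox_lift z d d0.
  set w := ox_lift t in zt *; exists (inner (U w) w); first exact: pos.
  have -> : inner (U z) z - inner (U w) w = inner (U z) (z - w) + inner (U (z - w)) w.
    rewrite (linB (bounded_linear bU)) (ipBr (inner_semi _)) (ipBl (inner_semi _)).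
    by rewrite addrA subrK.
  apply: le_trans dM; apply: le_trans (ler_normD _ _) _.
  have wz : `|w| <= `|z| + 1.
    have -> : w = z - (z - w) by rewrite opprB addrC subrK.
    by rewrite (le_trans (ler_normB _ _)) // lerD // (le_trans (ltW zt)).
  have -> : M * d = C * `|z| * d + C * d * (`|z| + 1) by rewrite /M; ring.
  rewrite lerD // (le_trans (inner_le _ _)) // ler_pM //; first exact: ltW.
  by rewrite (le_trans (hC _)) // ler_wpM2l // ltW.
Qed.

End HilbertTensor.

Section OpTensor.
Variables (R : realType) (H K HK : hilbertType R) (ox : H -> K -> HK).
Hypothesis Hox : hilbert_tensor ox.

Lemma hilbert_tensor_swap : hilbert_tensor (fun y x => ox x y).
Proof.
case: Hox => [[hl hr] hi hd]; split=> [|y x y' x'|]; first by split.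
  by rewrite hi mulrC.
rewrite -hd; congr (closure (lspan _)); apply/seteqP.
by split=> _ [u _ [v _ <-]]; exists v => //; exists u.
Qed.
End OpTensor.

Section OpTensorTheory.
Variables (R : realType) (H K HK : hilbertType R) (ox : H -> K -> HK).
Hypothesis Hox : hilbert_tensor ox.
Implicit Types (S : H -> H) (T : K -> K).

Lemma op_tensor_exists S T (C D : R[i]) : bounded_op S -> bounded_op T ->
  0 < C -> (forall x, `|S x| <= C * `|x|) -> 0 < D -> (forall y, `|T y| <= D * `|y|) ->
  exists U : HK -> HK, [/\ bounded_op U, forall z, `|U z| <= C * D * `|z|
                        & forall x y, U (ox x y) = ox (S x) (T y)].
Proof.
move=> bS bT C0 hC D0 hD.
have [U [bU hU UE]] := op_left_exists Hox bS C0 hC.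
have [U' [bU' hU' UE']] := op_left_exists (hilbert_tensor_swap Hox) bT D0 hD.
exists (U \o U'); split=> [|z|x y]; first exact: bounded_op_comp.
  by rewrite -mulrA (le_trans (hU _)) // ler_wpM2l // ltW.
by rewrite /= UE' UE.
Qed.

Lemma op_tensorP S T : bounded_op S -> bounded_op T ->
  bounded_op (op_tensor ox S T) /\
  forall x y, op_tensor ox S T (ox x y) = ox (S x) (T y).
Proof.
move=> bS bT; apply: (@xgetPex _ 0 [set U : HK -> HK |
  bounded_op U /\ forall x y, U (ox x y) = ox (S x) (T y)]).
have [C C0 hC] := bounded_bound bS; have [D D0 hD] := bounded_bound bT.
by have [U [bU _ UE]] := op_tensor_exists bS bT C0 hC D0 hD; exists U.
Qed.

Lemma bounded_op_tensor S T : bounded_op S -> bounded_op T ->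
  bounded_op (op_tensor ox S T).
Proof. by move=> bS bT; case: (op_tensorP bS bT). Qed.

Lemma op_tensorE S T x y : bounded_op S -> bounded_op T ->
  op_tensor ox S T (ox x y) = ox (S x) (T y).
Proof. by move=> bS bT; case: (op_tensorP bS bT). Qed.

Lemma op_tensor_eq S T (U : HK -> HK) : bounded_op S -> bounded_op T ->
  bounded_op U -> (forall x y, U (ox x y) = ox (S x) (T y)) -> op_tensor ox S T = U.
Proof.
move=> bS bT bU UE; have [b E] := op_tensorP bS bT.
by apply: (bounded_ext_pure Hox b bU) => x y; rewrite E UE.
Qed.

Lemma op_tensor_bound S T (C D : R[i]) : bounded_op S -> bounded_op T ->
  0 < C -> (forall x, `|S x| <= C * `|x|) -> 0 < D -> (forall y, `|T y| <= D * `|y|) ->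
  forall z, `|op_tensor ox S T z| <= C * D * `|z|.
Proof.
move=> bS bT C0 hC D0 hD; have [U [bU hU UE]] := op_tensor_exists bS bT C0 hC D0 hD.
by rewrite (op_tensor_eq bS bT bU UE).
Qed.

Lemma op_tensor_comp S T S' T' : bounded_op S -> bounded_op T ->
  bounded_op S' -> bounded_op T' ->
  op_tensor ox S T \o op_tensor ox S' T' = op_tensor ox (S \o S') (T \o T').
Proof.
move=> bS bT bS' bT'; apply/esym/op_tensor_eq; try exact: bounded_op_comp.
  by apply: bounded_op_comp; exact: bounded_op_tensor.
by move=> x y; rewrite /= !op_tensorE.
Qed.

Lemma op_tensor_id : op_tensor ox id id = id.
Proof. by apply: op_tensor_eq; do ?exact: bounded_op_id. Qed.

Lemma adj_op_tensor S T : bounded_op S -> bounded_op T ->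
  adj (op_tensor ox S T) = op_tensor ox (adj S) (adj T).
Proof.
move=> bS bT; have bS' := bounded_adj bS; have bT' := bounded_adj bT.
have b := bounded_op_tensor bS bT.
apply/esym; apply: op_tensor_eq => //; first exact: bounded_adj.
move=> x y; apply: (inner_inj_dense (dense_ox_lift Hox)) => _ [t _ <-].
rewrite (is_adjoint_sym (adjP b)); elim/tensor_ind: t => [u v||t t' ht ht'].
- rewrite ox_liftE // op_tensorE // !(inner_ox Hox).
  by rewrite (is_adjoint_sym (adjP bS)) (is_adjoint_sym (adjP bT)).
- by rewrite (ox_lift0 Hox) (lin0 (bounded_linear b)) !(ip0r (inner_semi _)).
- by rewrite (ox_liftD Hox) (linD (bounded_linear b)) !(ipDr (inner_semi _)) ht ht'.
Qed.

Lemma op_tensor_linl (c : R[i]) S S' T : bounded_op S -> bounded_op S' -> bounded_op T ->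
  op_tensor ox (c *: S + S') T = c *: op_tensor ox S T + op_tensor ox S' T.
Proof.
move=> bS bS' bT; apply: op_tensor_eq => //; first exact: bounded_op_lin.
  by apply: bounded_op_lin; exact: bounded_op_tensor.
by move=> x y; rewrite !fun_linE !op_tensorE // (oxl_linear Hox).
Qed.

Lemma op_tensor_linr (c : R[i]) S T T' : bounded_op S -> bounded_op T -> bounded_op T' ->
  op_tensor ox S (c *: T + T') = c *: op_tensor ox S T + op_tensor ox S T'.
Proof.
move=> bS bT bT'; apply: op_tensor_eq => //; first exact: bounded_op_lin.
  by apply: bounded_op_lin; exact: bounded_op_tensor.
by move=> x y; rewrite !fun_linE !op_tensorE // (oxr_linear Hox).
Qed.

Lemma op_tensor_ge0 S : bounded_op S -> (forall x, 0 <= inner (S x) x) ->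
  forall z, 0 <= inner (op_tensor ox S id z) z.
Proof.
move=> bS; apply: (op_left_ge0 Hox).
  exact: bounded_op_tensor bS (bounded_op_id _).
by move=> x y; rewrite op_tensorE //; exact: bounded_op_id.
Qed.
End OpTensorTheory.

(** * Norm and weak closures of operator algebras *)

Section Closures.
Variable R : realType.
Implicit Types H K : hilbertType R.

Lemma subspace_bounded H K : subspace (@bounded_op R H K).
Proof. by split=> [|c S T]; [exact: bounded_op0 | exact: bounded_op_lin]. Qed.

Lemma lspan_bounded H K (X : set (H -> K)) : X `<=` @bounded_op R H K ->
  lspan X `<=` @bounded_op R H K.
Proof. by apply: lspan_subset; exact: subspace_bounded. Qed.

Lemma norm_closure_bounded H (X : set (H -> H)) : norm_closure X `<=` @bounded_op R H H.
Proof. by move=> T []. Qed.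
Lemma weak_closure_bounded H (X : set (H -> H)) : weak_closure X `<=` @bounded_op R H H.
Proof. by move=> T []. Qed.

Lemma sub_norm_closure H (X : set (H -> H)) : X `<=` @bounded_op R H H -> X `<=` norm_closure X.
Proof.
move=> Xb T XT; split; first exact: Xb.
by move=> e e0; exists T => // x; rewrite subrr normr0 mulr_ge0 // ltW.
Qed.

Lemma sub_weak_closure H (X : set (H -> H)) : X `<=` @bounded_op R H H -> X `<=` weak_closure X.
Proof.
move=> Xb T XT; split; first exact: Xb.
by move=> s e e0; exists T => // p _; rewrite subrr (ip0l (inner_semi _)) normr0.
Qed.

Lemma norm_closureS H (X Y : set (H -> H)) : X `<=` Y -> norm_closure X `<=` norm_closure Y.
Proof.
move=> XY T [bT hT]; split=> // e e0; have [S XS hS] := hT e e0.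
by exists S => //; exact: XY.
Qed.

Lemma norm_closure_idem H (X : set (H -> H)) : norm_closure (norm_closure X) `<=` norm_closure X.
Proof.
move=> T [bT hT]; split=> // e e0.
have e2 : 0 < e / 2 by rewrite divr_gt0 ?ltr0Sn.
have [S [_ hS] TS] := hT _ e2; have [S' XS' SS'] := hS _ e2.
exists S' => // x; rewrite (le_trans (ler_distD (S x) _ _)) //.
by rewrite [e]splitr mulrDl lerD.
Qed.

Lemma weak_closure_idem H (X : set (H -> H)) : weak_closure (weak_closure X) `<=` weak_closure X.
Proof.
move=> T [bT hT]; split=> // s e e0.
have e2 : 0 < e / 2 by rewrite divr_gt0 ?ltr0Sn.
have [S [_ hS] TS] := hT s _ e2; have [S' XS' SS'] := hS s _ e2.
exists S' => // p ps.
have -> : T p.1 - S' p.1 = (T p.1 - S p.1) + (S p.1 - S' p.1) by rewrite addrA subrK.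
rewrite (ipDl (inner_semi _)) (le_lt_trans (ler_normD _ _)) //.
by rewrite [e]splitr ltrD ?TS ?SS'.
Qed.

Lemma norm_sub_weak_closure H (X : set (H -> H)) : norm_closure X `<=` weak_closure X.
Proof.
move=> T [bT hT]; split=> // s e e0.
pose M := \sum_(p <- s) `|p.1| * `|p.2| + 1.
have M0 : 0 < M by rewrite ltr_wpDl // sumr_ge0 // => p _; rewrite mulr_ge0.
have [S XS hS] := hT _ (divr_gt0 e0 M0); exists S => // p ps.
apply: le_lt_trans (inner_le _ _) _.
have : `|p.1| * `|p.2| < M.
  apply: (@le_lt_trans _ _ (\sum_(p <- s) `|p.1| * `|p.2|)); last by rewrite ltrDl ltr01.
  by rewrite (big_rem p) //= lerDl sumr_ge0 // => q _; rewrite mulr_ge0.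
rewrite -(ltr_pM2l (divr_gt0 e0 M0)) divfK ?gt_eqF // => h.
by apply: le_lt_trans h; rewrite mulrA ler_wpM2r.
Qed.

Lemma norm_closure_lin H (X : set (H -> H)) : subspace X -> subspace (norm_closure X).
Proof.
move=> [X0 XP]; split.
  split; first exact: bounded_op0.
  by move=> e e0; exists 0 => // x; rewrite subrr normr0 mulr_ge0 // ltW.
move=> c S T [bS hS] [bT hT]; split; first exact: bounded_op_lin.
move=> e e0; have M0 : 0 < `|c| + 1 by rewrite ltr_wpDl.
have d0 : 0 < e / (`|c| + 1) by rewrite divr_gt0.
have [S' XS' SS'] := hS _ d0; have [T' XT' TT'] := hT _ d0.
exists (c *: S' + T'); first exact: XP.
move=> x; rewrite !fun_linE opprD addrACA -scalerBr.
apply: le_trans (ler_normD _ _) _; rewrite normrZ.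
have -> : e * `|x| = `|c| * (e / (`|c| + 1) * `|x|) + e / (`|c| + 1) * `|x|.
  by field; rewrite gt_eqF.
by rewrite lerD // ler_wpM2l.
Qed.

Lemma weak_closure_lin H (X : set (H -> H)) : subspace X -> subspace (weak_closure X).
Proof.
move=> [X0 XP]; split.
  split; first exact: bounded_op0.
  by move=> s e e0; exists 0 => // p _; rewrite subrr (ip0l (inner_semi _)) normr0.
move=> c S T [bS hS] [bT hT]; split; first exact: bounded_op_lin.
move=> s e e0; have M0 : 0 < `|c| + 1 by rewrite ltr_wpDl.
have d0 : 0 < e / (`|c| + 1) by rewrite divr_gt0.
have [S' XS' SS'] := hS s _ d0; have [T' XT' TT'] := hT s _ d0.
exists (c *: S' + T'); first exact: XP.
move=> p ps; rewrite !fun_linE opprD addrACA -scalerBr.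
rewrite (ipDl (inner_semi _)) (ipZl (inner_semi _)).
apply: le_lt_trans (ler_normD _ _) _; rewrite normrM.
have -> : e = `|c| * (e / (`|c| + 1)) + e / (`|c| + 1).
  by field; rewrite gt_eqF.
by rewrite ler_ltD ?TT' // ler_wpM2l // ltW // SS'.
Qed.

Lemma norm_closure_comp H (X Y Z : set (H -> H)) : Y `<=` @bounded_op R H H ->
  (forall S T, X S -> Y T -> Z (S \o T)) ->
  forall S T, norm_closure X S -> norm_closure Y T -> norm_closure Z (S \o T).
Proof.
move=> Yb XYZ S T [bS hS] [bT hT]; split; first exact: bounded_op_comp.
move=> e e0; have [C C0 hC] := bounded_bound bS.
have d0 : 0 < e / (2 * C) by rewrite divr_gt0 // mulr_gt0 ?ltr0Sn.
have [T' YT' TT'] := hT _ d0; have [D D0 hD] := bounded_bound (Yb _ YT').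
(* The tolerance for [S'] depends on a bound of [T'], so [T'] is chosen first. *)
have d'0 : 0 < e / (2 * D) by rewrite divr_gt0 // mulr_gt0 ?ltr0Sn.
have [S' XS' SS'] := hS _ d'0; exists (S' \o T'); first exact: XYZ.
move=> x /=; have -> : S (T x) - S' (T' x) = S (T x - T' x) + (S (T' x) - S' (T' x)).
  by rewrite (linB (bounded_linear bS)) addrA subrK.
apply: le_trans (ler_normD _ _) _.
have -> : e * `|x| = C * (e / (2 * C) * `|x|) + e / (2 * D) * (D * `|x|).
  by field; rewrite !gt_eqF.
apply: lerD; first by apply: le_trans (hC _) _; rewrite ler_wpM2l // ltW.
by apply: le_trans (SS' _) _; rewrite ler_wpM2l // ltW.
Qed.

(** Lipschitz continuity for the operator norm, phrased with explicit bounds [b] to match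
    [norm_closure]. *)
Definition op_lipschitz H K (C : R[i]) (f : (H -> H) -> K -> K) : Prop :=
  forall S T (b : R[i]), bounded_op S -> bounded_op T -> 0 < b ->
    (forall x, `|S x - T x| <= b * `|x|) -> forall y, `|f S y - f T y| <= C * b * `|y|.

Lemma norm_closure_map H K (C : R[i]) (f : (H -> H) -> K -> K)
    (X : set (H -> H)) (Y : set (K -> K)) :
  X `<=` @bounded_op R H H -> (forall T, bounded_op T -> bounded_op (f T)) ->
  0 < C -> op_lipschitz C f -> (forall S, X S -> Y (f S)) ->
  forall T, norm_closure X T -> norm_closure Y (f T).
Proof.
move=> Xb fb C0 fC XY T [bT hT]; split; first exact: fb.
move=> e e0; have [S XS hS] := hT _ (divr_gt0 e0 C0).
exists (f S); first exact: XY.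
move=> y; have := fC T S _ bT (Xb _ XS) (divr_gt0 e0 C0) hS y.
by rewrite mulrCA divff ?mulr1 // gt_eqF.
Qed.

Lemma op_lipschitz_adj H : op_lipschitz 1 (@adj R H H).
Proof.
move=> S T b bS bT b0 ST y.
have bST : bounded_op ((-1) *: T + S) by exact: bounded_op_lin.
have h x : `|((-1) *: T + S) x| <= b * `|x|.
  by rewrite fun_linE scaleN1r addrC.
have := adj_bound bST (ltW b0) h y.
by rewrite adj_lin // fun_linE rmorphN1 scaleN1r addrC mul1r.
Qed.

(* The matrix coefficients of f(T) are dominated by single matrix coefficients
   of T, so that f is weakly continuous. *)
Lemma weak_closure_map H K (f : (H -> H) -> K -> K) (X : set (H -> H)) (Y : set (K -> K)) :
  X `<=` @bounded_op R H H -> (forall T, bounded_op T -> bounded_op (f T)) ->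
  (forall p : K * K, exists q : H * H, forall S T, bounded_op S -> bounded_op T ->
     `|inner (f S p.1 - f T p.1) p.2| <= `|inner (S q.1 - T q.1) q.2|) ->
  (forall S, X S -> Y (f S)) ->
  forall T, weak_closure X T -> weak_closure Y (f T).
Proof.
move=> Xb fb /choice[q hq] XY T [bT hT]; split; first exact: fb.
move=> s e e0; have [S XS hS] := hT (map q s) e e0.
exists (f S); first exact: XY.
move=> p ps; apply: le_lt_trans (hq p T S bT (Xb _ XS)) _.
by apply: hS; exact: map_f.
Qed.

Lemma star_norm_closure H (X : set (H -> H)) :
  star_subalgebra X -> star_subalgebra (norm_closure X).
Proof.
move=> [Xb X0 XP XM XA]; split=> [||c S T|S T|S].
- exact: norm_closure_bounded.
- by apply: sub_norm_closure.
- by apply: (norm_closure_lin _).2.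
- exact: norm_closure_comp.
- apply: (norm_closure_map Xb _ ltr01 (@op_lipschitz_adj H)) => // T.
  exact: bounded_adj.
Qed.

(** Composition is weakly continuous in each argument separately but not jointly. The right factor
    is therefore taken in [X] first and in the closure afterwards, [weak_closure_idem] absorbing the
    double closure. *)
Lemma star_weak_closure H (X : set (H -> H)) :
  star_subalgebra X -> star_subalgebra (weak_closure X).
Proof.
move=> [Xb X0 XP XM XA].
have rM S T : weak_closure X S -> X T -> weak_closure X (S \o T).
  move=> XS XT; have bT := Xb _ XT.
  apply: (weak_closure_map (f := fun S => S \o T)) XS => // [S' bS'|p|S' XS'].
  - exact: bounded_op_comp.
  - by exists (T p.1, p.2).
  - exact: XM.
split=> [||c S T|S T XS XT|S].
- exact: weak_closure_bounded.
- by apply: sub_weak_closure.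
- by apply: (weak_closure_lin _).2.
- have bS := weak_closure_bounded XS; apply: weak_closure_idem.
  apply: (weak_closure_map (f := fun T => S \o T)) XT => // [T' bT'|p|T' XT'].
  + exact: bounded_op_comp.
  + exists (p.1, adj S p.2) => U W bU bW /=.
    by rewrite -(linB (bounded_linear bS)) (adjP bS).
  + exact: rM.
- apply: weak_closure_map => // [T|p]; first exact: bounded_adj.
  exists (p.2, p.1) => U W bU bW /=.
  rewrite (ipBl (inner_semi _)) [X in _ <= `|X|](ipBl (inner_semi _)).
  rewrite !(innerC p.2) -!(adjP bU) -!(adjP bW).
  by rewrite -rmorphB norm_conjC.
Qed.

Lemma star_lspan H (G : set (H -> H)) : G `<=` @bounded_op R H H ->
  (forall S T, G S -> G T -> G (S \o T)) -> (forall S, G S -> G (adj S)) ->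
  star_subalgebra (lspan G).
Proof.
move=> Gb GM GA; have spb := lspan_bounded Gb.
have [sp0 spP] := subspace_lspan G.
split=> // [S T GS GT|S GS].
- have bS := spb _ GS.
  suff : lspan G `<=` [set T' : H -> H | lspan G (S \o T')] by apply.
  apply: lspan_subset; first split=> [|c T1 T2 h1 h2] /=.
  + suff -> : S \o (0 : H -> H) = 0 by [].
    by apply/funext => x; rewrite /= (lin0 (bounded_linear bS)).
  + suff -> : S \o (c *: T1 + T2) = c *: (S \o T1) + (S \o T2) by exact: spP.
    by apply/funext => x /=; rewrite !fun_linE (bounded_linear bS).
  move=> T' GT' /=.
  suff : lspan G `<=` [set S' : H -> H | lspan G (S' \o T')] by apply.
  apply: lspan_subset; first by split=> [|c S1 S2 h1 h2] /=; [exact: sp0 | exact: spP].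
  by move=> S' GS' /=; apply: sub_lspan; exact: GM.
- suff : lspan G `<=` [set S' : H -> H | bounded_op S' /\ lspan G (adj S')] by move=> /(_ _ GS)[].
  apply: lspan_subset; first split=> [|c S1 S2 [b1 h1] [b2 h2]] /=.
  + by split; [exact: bounded_op0 | rewrite adj0].
  + by split; [exact: bounded_op_lin | rewrite adj_lin //; exact: spP].
  by move=> S' GS' /=; split; [exact: Gb | apply: sub_lspan; exact: GA].
Qed.

Lemma star_op_tensor H K (HK : hilbertType R) (ox : H -> K -> HK)
    (X : set (H -> H)) (Y : set (K -> K)) :
  hilbert_tensor ox -> star_subalgebra X -> star_subalgebra Y ->
  star_subalgebra (lspan [set op_tensor ox S T | S in X & T in Y]).
Proof.
move=> Hox [Xb X0 XP XM XA] [Yb Y0 YP YM YA]; apply: star_lspan.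
- by move=> _ [S XS [T YT <-]]; apply: bounded_op_tensor => //; [exact: Xb|exact: Yb].
- move=> _ _ [S XS [T YT <-]] [S' XS' [T' YT' <-]].
  exists (S \o S'); first exact: XM.
  exists (T \o T'); first exact: YM.
  by rewrite op_tensor_comp //; do ?[exact: Xb|exact: Yb].
- move=> _ [S XS [T YT <-]]; exists (adj S); first exact: XA.
  exists (adj T); first exact: YA.
  by rewrite adj_op_tensor //; [exact: Xb|exact: Yb].
Qed.
End Closures.

(** * The bicommutant theorem *)

Section Bicommutant.
Variables (R : realType) (H : hilbertType R).

Definition commutant (X : set (H -> H)) : set (H -> H) :=
  [set T | bounded_op T /\ forall S, X S -> S \o T = T \o S].

Definition nondegenerate (X : set (H -> H)) : Prop :=
  closure (lspan [set T x | T in X & x in [set: H]]) = setT.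

Lemma nondegenerate_eq0 (X : set (H -> H)) (x : H) : star_subalgebra X ->
  nondegenerate X -> (forall S, X S -> S x = 0) -> x = 0.
Proof.
move=> [Xb _ _ _ XA] Xn h; apply: (inner_eq0_dense Xn) => y.
apply: (lspan_subset (D := [set y | inner x y = 0])).
  split=> [|c u v /= hu hv]; first by rewrite /= (ip0r (inner_semi _)).
  by rewrite (ipDr (inner_semi _)) (ipZr (inner_semi _)) hu hv mulr0 addr0.
move=> _ [S XS [z _ <-]] /=.
rewrite -[S](adjK (Xb _ XS)) -(adjP (bounded_adj (Xb _ XS))) h ?(ip0l (inner_semi _)) //.
exact: XA.
Qed.

Section Amplification.
Variable n : nat.
(** [H^n] carries the direct sum form [ip] as a bare module: a complete semi-inner product is all
    that [orthogonal_projection] asks for. *)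
Let W : lmodType R[i] := 'I_n -> H.
Let ip (v w : W) : R[i] := \sum_(i < n) inner (v i) (w i).

Lemma sum_inner_semi : semi_inner ip.
Proof.
split=> [c v v' w|v w|v].
- rewrite /ip mulr_sumr -big_split /=; apply: eq_bigr => i _.
  by rewrite -(ipZl (inner_semi _)) -(ipDl (inner_semi _)).
- by rewrite /ip rmorph_sum /=; apply: eq_bigr => i _; rewrite innerC.
- by rewrite /ip sumr_ge0 // => i _; rewrite (ip_ge0 (inner_semi _)).
Qed.

Lemma inner_le_sum (v : W) i : inner (v i) (v i) <= ip v v.
Proof.
by rewrite /ip (bigD1 i) //= lerDl sumr_ge0 // => j _; exact: ip_ge0 (inner_semi _) _.
Qed.

Lemma sum_inner_eq0 (v : W) : ip v v = 0 -> v = 0.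
Proof.
move=> v0; apply/funext => i; apply: inner_eq0; apply/eqP.
by rewrite eq_le (ip_ge0 (inner_semi _)) andbT -v0 inner_le_sum.
Qed.

Lemma sum_inner_complete : ip_complete ip.
Proof.
move=> u cu.
have /choice[l hl] (i : 'I_n) : exists l, forall e : R[i], 0 < e ->
    exists N, forall m, (N <= m)%N -> inner (u m i - l) (u m i - l) < e.
  apply: (@inner_complete R H (fun m => u m i)) => e e0.
  have [N hN] := cu e e0; exists N => m m' Nm Nm'.
  exact: le_lt_trans (inner_le_sum (u m - u m') i) (hN _ _ Nm Nm').
exists l => e e0; have d0 : 0 < e / n.+1%:R by rewrite divr_gt0 ?ltr0Sn.
have /choice[N hN] i := hl i _ d0.
exists (\max_i N i) => m Nm.
apply: (@le_lt_trans _ _ (\sum_(i < n) e / n.+1%:R)).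
  apply: ler_sum => i _; apply: ltW; apply: hN.
  exact: leq_trans (leq_bigmax i) Nm.
rewrite sumr_const card_ord -[_ *+ n]mulr_natr mulrAC ltr_pdivrMr ?ltr0Sn //.
by rewrite ltr_pM2l // ltr_nat.
Qed.

Variable X : set (H -> H).
Hypotheses (Xstar : star_subalgebra X) (Xn : nondegenerate X).
Variable x : W.

(** The orbit of the tuple [x] under the diagonal action of [X]. It need not be closed, so
    projection on its closure is handled below as a relation [is_proj]. *)
Let D : set W := [set w | exists2 a, X a & w = (fun i => a (x i))].

Let Dsub : subspace D.
Proof.
have [_ X0 XP _ _] := Xstar; split; first by exists 0.
move=> c _ _ [a Xa ->] [b Xb ->]; exists (c *: a + b); first exact: XP.
by apply/funext => i.
Qed.

Let adherent (p : W) := forall e, 0 < e -> exists2 y, D y & ip (p - y) (p - y) < e.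
Let is_proj (w p : W) := adherent p /\ forall y, D y -> ip (w - p) y = 0.

Let ip_adherent_eq0 z p : (forall y, D y -> ip z y = 0) -> adherent p -> ip z p = 0.
Proof.
move=> zD ap; apply/eqP; rewrite -normr_eq0 -sqrf_eq0; apply/eqP.
apply: eq0_small => [|e e0]; first by rewrite exprn_ge0.
have M0 : 0 < ip z z + 1 by rewrite ltr_wpDl ?(ip_ge0 sum_inner_semi).
have [y Dy py] := ap _ (divr_gt0 e0 M0).
have -> : ip z p = ip z (p - y) by rewrite (ipBr sum_inner_semi) (zD y) ?subr0.
apply: le_trans (cauchy_schwarz sum_inner_semi _ _) _.
have -> : e = (ip z z + 1) * (e / (ip z z + 1)) by field; rewrite gt_eqF.
by rewrite ler_pM ?(ip_ge0 sum_inner_semi) ?lerDl // ltW.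
Qed.

Let is_proj_uniq w p p' : is_proj w p -> is_proj w p' -> p = p'.
Proof.
move=> [ap wp] [ap' wp']; apply/eqP; rewrite -subr_eq0; apply/eqP.
have h y : D y -> ip (p - p') y = 0.
  move=> Dy; have -> : p - p' = (w - p') - (w - p).
    by rewrite opprB [RHS]addrC addrA subrK.
  by rewrite (ipBl sum_inner_semi) wp // wp' // subrr.
apply: sum_inner_eq0; rewrite (ipBr sum_inner_semi).
by rewrite !(ip_adherent_eq0 h) // subrr.
Qed.

Let is_proj_lin c w w' p p' : is_proj w p -> is_proj w' p' ->
  is_proj (c *: w + w') (c *: p + p').
Proof.
move=> [ap wp] [ap' wp']; split=> [e e0|y Dy]; last first.
  rewrite opprD addrACA -scalerBr (ipDl sum_inner_semi) (ipZl sum_inner_semi).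
  by rewrite wp // wp' // mulr0 addr0.
(* Fits the bound [|c a + b|^2 <= 2 (|c|^2 |a|^2 + |b|^2)], which comes from positivity at
   [c *: a - b]. *)
have M0 : 0 < 2 * (`|c| ^+ 2 + 1) by rewrite mulr_gt0 ?ltr0Sn // ltr_wpDl ?exprn_ge0.
have [y Dy py] := ap _ (divr_gt0 e0 M0); have [y' Dy' py'] := ap' _ (divr_gt0 e0 M0).
exists (c *: y + y'); first exact: Dsub.2.
rewrite opprD addrACA -scalerBr.
move: (p - y) py (p' - y') py' => a py b py'.
apply: (@le_lt_trans _ _ (2 * (`|c| ^+ 2 * ip a a + ip b b))).
  rewrite -subr_ge0; have := ip_ge0 sum_inner_semi (c *: a - b).
  rewrite !(ipDl sum_inner_semi) !(ipDr sum_inner_semi) !(ipNl sum_inner_semi).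
  rewrite !(ipNr sum_inner_semi) !(ipZl sum_inner_semi) !(ipZr sum_inner_semi) normCK.
  by move=> h; apply: le_trans h _; rewrite le_eqVlt; apply/orP; left; apply/eqP; ring.
have -> : e = 2 * (`|c| ^+ 2 * (e / (2 * (`|c| ^+ 2 + 1))) + e / (2 * (`|c| ^+ 2 + 1))).
  have cn : `|c| ^+ 2 + 1 != 0 by rewrite gt_eqF // ltr_wpDl ?exprn_ge0.
  by field.
by rewrite ltr_pM2l ?ltr0Sn // ler_ltD // ler_wpM2l ?exprn_ge0 // ltW.
Qed.

(** The orbit is invariant under [a] and [adj a]: the first keeps [a p] adherent to it, the second
    keeps [a (w - p)] orthogonal to it. *)
Let is_proj_act (a : H -> H) w p : X a -> is_proj w p ->
  is_proj (fun i => a (w i)) (fun i => a (p i)).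
Proof.
have [Xb _ _ XM XA] := Xstar.
move=> Xa [ap wp]; have la := bounded_linear (Xb _ Xa); split=> [e e0|_ [b Xb' ->]].
  have [C C0 hC] := bounded_bound (Xb _ Xa).
  have [_ [b Xb' ->] py] := ap (e / C ^+ 2) (divr_gt0 e0 (exprn_gt0 _ C0)).
  exists (fun i => a (b (x i))); first by exists (a \o b) => //; exact: XM.
  rewrite ltr_pdivlMr ?exprn_gt0 // mulrC in py; apply: le_lt_trans py.
  rewrite /ip mulr_sumr; apply: ler_sum => i _ /=.
  rewrite -!inner_norm -exprMn ler_pXn2r ?nnegrE ?mulr_ge0 ?(ltW C0) //.
  by rewrite -[(_ - _) i]/(a (p i) - a (b (x i))) -(linB la) hC.
rewrite -(wp (fun i => adj a (b (x i)))); last first.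
  by exists (adj a \o b) => //; apply: XM => //; exact: XA.
apply: eq_bigr => i _.
by rewrite -[(_ - _) i in LHS]/(a (w i) - a (p i)) -(linB la) (adjP (Xb _ Xa)).
Qed.

Let is_proj_D w : D w -> is_proj w w.
Proof.
by split=> [e e0|y _]; [exists w|]; rewrite // subrr (ip0l sum_inner_semi).
Qed.

(** The projection [E] on the closure of the orbit commutes with the diagonal action of [X], so its
    matrix entries lie in the commutant of [X] and [T] commutes with them. Hence [T] acting
    diagonally commutes with [E]; as [E x = x], the tuple of the [T (x i)] is fixed by [E], that is,
    adherent to the orbit. *)
Lemma bicommutant_approx (T : H -> H) : commutant (commutant X) T ->
  forall e : R[i], 0 < e ->
    exists2 a, X a & \sum_(i < n) inner (T (x i) - a (x i)) (T (x i) - a (x i)) < e.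
Proof.
have [Xb _ _ XM XA] := Xstar.
move=> [bT TX].
have /choice[E hE] w : exists p, is_proj w p.
  have [p ap wp] := orthogonal_projection sum_inner_semi sum_inner_complete w Dsub.
  by exists p.
have Euniq w p : is_proj w p -> E w = p by exact: is_proj_uniq.
have Elin c w w' : E (c *: w + w') = c *: E w + E w'.
  by apply: Euniq; exact: is_proj_lin.
have E0 : E 0 = 0 by apply: Euniq; apply: is_proj_D; exact: Dsub.1.
have ED w w' : E (w + w') = E w + E w' by rewrite -[w]scale1r Elin !scale1r.
have Eact a w : X a -> E (fun i => a (w i)) = (fun i => a (E w i)).
  by move=> Xa; apply: Euniq; exact: is_proj_act.
have Ele w : ip (E w) (E w) <= ip w w.
  have [aE wE] := hE w.
  have h : ip (w - E w) (E w) = 0 by exact: ip_adherent_eq0.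
  have -> : ip w w = ip (E w) (E w) + ip (w - E w) (w - E w).
    rewrite [X in _ + X](ipBr sum_inner_semi) h subr0 [X in _ + X](ipBl sum_inner_semi).
    have -> : ip (E w) w = ip (E w) (E w).
      apply/eqP; rewrite -subr_eq0 -(ipBr sum_inner_semi).
      by rewrite (ipC sum_inner_semi) h conjC0.
    by rewrite addrC subrK.
  by rewrite lerDl (ip_ge0 sum_inner_semi).
(* [dl j] embeds [H] as the [j]-th coordinate, so that [m i j] below is a matrix entry of [E]. *)
pose dl (j : 'I_n) (z : H) : W := fun k => if k == j then z else 0.
have dlin j c z z' : dl j (c *: z + z') = c *: dl j z + dl j z'.
  apply/funext => k; rewrite -[RHS]/(c *: dl j z k + dl j z' k) /dl.
  by case: eqP; rewrite // scaler0 addr0.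
have dip j z : ip (dl j z) (dl j z) = inner z z.
  rewrite /ip (bigD1 j) //= /dl eqxx big1 ?addr0 // => k /negPf ->.
  by rewrite (ip0l (inner_semi _)).
have dact j a z : X a -> (fun i => a (dl j z i)) = dl j (a z).
  move=> Xa; apply/funext => k; rewrite /dl; case: eqP => // _.
  exact: lin0 (bounded_linear (Xb _ Xa)).
pose m i j z := E (dl j z) i.
have mC i j : commutant X (m i j).
  split; last first.
    by move=> a Xa; apply/funext => z; rewrite /= /m -dact // Eact.
  apply/bounded_opP; split=> [c z z'|]; first by rewrite /m dlin Elin.
  exists 1 => // z; rewrite mul1r -(@ler_pXn2r _ 2) ?nnegrE // !inner_norm.
  by rewrite -(dip j z) (le_trans _ (Ele _)) // inner_le_sum.
have wsum w : w = \sum_(j < n) dl j (w j).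
  apply/funext => k; rewrite fct_sumE (bigD1 k) //= /dl eqxx big1 ?addr0 // => j.
  by rewrite eq_sym => /negPf ->.
have ET w i : E (fun k => T (w k)) i = T (E w i).
  have Esum (F : 'I_n -> W) : E (\sum_(j < n) F j) = \sum_(j < n) E (F j).
    by apply: big_morph; [exact: ED | exact: E0].
  rewrite [X in E X]wsum [in RHS](wsum w) !Esum !fct_sumE (lin_sum (bounded_linear bT)).
  by apply: eq_bigr => j _; have /= := congr1 (@^~ (w j)) (TX _ (mC i j)) => <-.
(* Without a unit in [X], [x] is not visibly adherent to its own orbit. But [E] fixes every [a x],
   so every [a] in [X] kills [x - E x], and non-degeneracy makes this difference 0. *)
have Ex : E x = x.
  apply/esym/eqP; rewrite -subr_eq0; apply/eqP/funext => i.
  apply: (nondegenerate_eq0 Xstar Xn) => a Xa.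
  have -> : (x - E x) i = x i - E x i by [].
  rewrite (linB (bounded_linear (Xb _ Xa))).
  have := Eact a x Xa; rewrite (Euniq _ (fun i => a (x i))); last first.
    by apply: is_proj_D; exists a.
  by move=> /(congr1 (@^~ i)) /= ->; rewrite subrr.
move=> e e0.
have [ax _] := hE (fun k => T (x k)); have [_ [a Xa ->] h] := ax e e0.
exists a => //; move: h; rewrite (_ : E _ = fun k => T (x k)) //.
by apply/funext => i; rewrite ET Ex.
Qed.
End Amplification.

(** A weak neighbourhood involves finitely many pairs [s]; their first vectors form one tuple in
    [H^n] with [n = size s], on which [bicommutant_approx] works simultaneously. *)
Theorem bicommutant_sub_weak_closure (X : set (H -> H)) :
  star_subalgebra X -> nondegenerate X -> commutant (commutant X) `<=` weak_closure X.
Proof.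
move=> Xs Xn T TX; split; first by case: TX.
move=> s e e0.
pose x (i : 'I_(size s)) := (tnth (in_tuple s) i).1.
pose M := \sum_(p <- s) `|p.2| + 1.
have M0 : 0 < M by rewrite ltr_wpDl // sumr_ge0.
have [a Xa ha] := bicommutant_approx Xs Xn x TX (exprn_gt0 2 (divr_gt0 e0 M0)).
exists a => // p /(tnthP (in_tuple s))[i ->].
apply: le_lt_trans (inner_le _ _) _.
have h1 : `|T (x i) - a (x i)| < e / M.
  rewrite -inner_sqr_lt ?divr_gt0 //; apply: le_lt_trans ha.
  exact: (@inner_le_sum _ (fun i => T (x i) - a (x i)) i).
have h2 : `|(tnth (in_tuple s) i).2| <= M.
  rewrite /M (big_rem (tnth (in_tuple s) i)) ?mem_tnth //= -addrA lerDl.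
  by rewrite addr_ge0 // sumr_ge0.
apply: (@le_lt_trans _ _ (`|T (x i) - a (x i)| * M)); first by rewrite ler_wpM2l.
by rewrite -ltr_pdivlMr.
Qed.

Lemma sub_bicommutant (X : set (H -> H)) : X `<=` @bounded_op R H H ->
  X `<=` commutant (commutant X).
Proof. by move=> Xb S XS; split; [exact: Xb | move=> T [_ hT]; rewrite hT]. Qed.

Lemma weak_closure_inner_eq (X : set (H -> H)) (u u' v v' : H) :
  (forall S, X S -> inner (S u) u' = inner (S v) v') ->
  forall T, weak_closure X T -> inner (T u) u' = inner (T v) v'.
Proof.
move=> h T [_ hT]; apply/eqP; rewrite -subr_eq0 -normr_eq0; apply/eqP.
apply: eq0_small => // e e0; have e2 : 0 < e / 2 by rewrite divr_gt0 ?ltr0Sn.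
have [S XS hS] := hT [:: (u, u'); (v, v')] _ e2.
have h1 := hS (u, u') (mem_head _ _).
have h2 : `|inner (T v - S v) v'| < e / 2 by apply: (hS (v, v')); rewrite !inE eqxx orbT.
have -> : inner (T u) u' - inner (T v) v' = inner (T u - S u) u' - inner (T v - S v) v'.
  rewrite (ipBl (inner_semi _)) [X in _ = _ - X](ipBl (inner_semi _)) (h S XS).
  by rewrite opprB addrA subrK.
by rewrite (le_trans (ler_normB _ _)) // [e]splitr lerD // ltW.
Qed.

End Bicommutant.

(** * Amplification by an identity, followed by conjugation with a unitary *)

Section AmplifiedConjugation.
Variables (R : realType) (H K HK : hilbertType R) (ox : H -> K -> HK).
Hypothesis Hox : hilbert_tensor ox.

(* Slicing with x |-> x (x) y shows that commutation of S (x) 1 with a fixed bounded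
   operator is a linear condition on two matrix coefficients of S. *)
Lemma commute_weak_closure (X : set (H -> H)) (W : HK -> HK) :
  X `<=` @bounded_op R H H -> bounded_op W ->
  (forall S, X S -> op_tensor ox S id \o W = W \o op_tensor ox S id) ->
  forall T, weak_closure X T -> op_tensor ox T id \o W = W \o op_tensor ox T id.
Proof.
move=> Xb bW hX T XT.
have bid := bounded_op_id K.
(* Contracting the second leg puts [W] into the vectors and leaves a single matrix coefficient of
   [S] on each side. *)
pose sl x y y' := adj (ox^~ y') (W (ox x y)).
pose sr y x' y' := adj (ox^~ y) (adj W (ox x' y')).
have E1 S x y x' y' : bounded_op S ->
    inner ((op_tensor ox S id \o W) (ox x y)) (ox x' y') = inner (S (sl x y y')) x'.
  move=> bS; rewrite /= (adjP (bounded_op_tensor Hox bS bid)) adj_op_tensor // adj_id.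
  rewrite op_tensorE //; last exact: bounded_adj.
  by rewrite (adjP bS) (is_adjoint_sym (adjP (bounded_oxl Hox y'))).
have E2 S x y x' y' : bounded_op S ->
    inner ((W \o op_tensor ox S id) (ox x y)) (ox x' y') = inner (S x) (sr y x' y').
  move=> bS; rewrite /= op_tensorE // (adjP bW).
  by rewrite -(adjP (bounded_oxl Hox y)).
have bT := weak_closure_bounded XT.
have bTi := bounded_op_tensor Hox bT bid.
apply: (bounded_ext_pure Hox) => [||x y]; try exact: bounded_op_comp.
apply: (inner_inj_dense (dense_ox_lift Hox)) => _ [t _ <-].
elim/tensor_ind: t => [x' y'||t t' ht ht'].
- rewrite (ox_liftE Hox) E1 // E2 //; move: T XT {bT bTi}.
  apply: weak_closure_inner_eq => S XS.
  by rewrite -E1 ?hX ?E2 //; exact: Xb.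
- by rewrite (ox_lift0 Hox) !(ip0r (inner_semi _)).
- by rewrite (ox_liftD Hox) !(ipDr (inner_semi _)) ht ht'.
Qed.

Variable U : HK -> HK.
Hypothesis Uu : unitary_op U.

(** The second factor and [U] are arbitrary because several instances occur: [Delta1], the maps
    [Phi] and [Psi] on operators of [HH], and, for coassociativity, an amplification of [H] by
    [HH]. *)
Definition ampl (S : H -> H) : HK -> HK := U \o op_tensor ox S id \o adj U.

Let bU : bounded_op U. Proof. by case: Uu. Qed.
Let bU' : bounded_op (adj U). Proof. exact: bounded_adj. Qed.
Let UK z : adj U (U z) = z. Proof. by case: Uu => _ /(congr1 (@^~ z)). Qed.
Let UKV z : U (adj U z) = z. Proof. by case: Uu => _ _ /(congr1 (@^~ z)). Qed.

Lemma unitary_norm z : `|U z| = `|z|.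
Proof.
by apply/eqP; rewrite -(@eqrXn2 _ 2) // !inner_norm (adjP bU) UK.
Qed.
Lemma unitary_adj_norm z : `|adj U z| = `|z|.
Proof. by rewrite -[in RHS](UKV z) unitary_norm. Qed.

Lemma bounded_ampl S : bounded_op S -> bounded_op (ampl S).
Proof.
move=> bS; apply: bounded_op_comp => //; apply: bounded_op_comp => //.
by apply: (bounded_op_tensor Hox) => //; exact: bounded_op_id.
Qed.

Lemma ampl_lin c S T : bounded_op S -> bounded_op T ->
  ampl (c *: S + T) = c *: ampl S + ampl T.
Proof.
move=> bS bT; rewrite /ampl op_tensor_linl //; last exact: bounded_op_id.
by apply/funext => z; rewrite fun_linE /= fun_linE (bounded_linear bU).
Qed.

Lemma ampl_comp S T : bounded_op S -> bounded_op T -> ampl (S \o T) = ampl S \o ampl T.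
Proof.
move=> bS bT; rewrite /ampl.
have <- := op_tensor_comp Hox bS (bounded_op_id K) bT (bounded_op_id K).
by apply/funext => z; rewrite /= UK.
Qed.

Lemma ampl_adj S : bounded_op S -> ampl (adj S) = adj (ampl S).
Proof.
move=> bS; have bSi := bounded_op_tensor Hox bS (bounded_op_id K).
rewrite /ampl (adj_comp (bounded_op_comp bU bSi) bU') (adj_comp bU bSi).
rewrite adj_op_tensor //; last exact: bounded_op_id.
by rewrite adjK // adj_id.
Qed.

Lemma ampl_id : ampl id = id.
Proof. by apply/funext => z; rewrite /ampl op_tensor_id //= UKV. Qed.

Lemma ampl_lipschitz : op_lipschitz 1 ampl.
Proof.
move=> S T b bS bT b0 h y; rewrite mul1r.
have bST : bounded_op ((-1) *: T + S) by exact: bounded_op_lin.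
have hST x : `|((-1) *: T + S) x| <= b * `|x| by rewrite fun_linE scaleN1r addrC.
have -> : ampl S y - ampl T y = ampl ((-1) *: T + S) y.
  by rewrite ampl_lin // fun_linE scaleN1r addrC.
rewrite /ampl /= unitary_norm -(unitary_adj_norm y).
have := op_tensor_bound Hox bST (bounded_op_id K) b0 hST ltr01 _ (adj U y).
by rewrite mulr1; apply => z; rewrite mul1r.
Qed.

Lemma ampl_star_hom (X : set (H -> H)) (Y : set (HK -> HK)) :
  X `<=` @bounded_op R H H -> (forall S, X S -> Y (ampl S)) -> star_hom X Y ampl.
Proof.
move=> Xb XY; split=> // [c S T XS XT|S T XS XT|S XS].
- by rewrite ampl_lin //; exact: Xb.
- by rewrite ampl_comp //; exact: Xb.
- by rewrite ampl_adj //; exact: Xb.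
Qed.

(** The images of [X] are only required in the bicommutant of [Y]: for the coproduct they are
    multipliers of [A ⊗ A] and need not lie in a span of simple tensors. *)
Lemma ampl_weak_closure (X : set (H -> H)) (Y : set (HK -> HK)) :
  X `<=` @bounded_op R H H -> star_subalgebra Y -> nondegenerate Y ->
  (forall S, X S -> commutant (commutant Y) (ampl S)) ->
  forall T, weak_closure X T -> weak_closure Y (ampl T).
Proof.
move=> Xb Ys Yn XY T XT; apply: bicommutant_sub_weak_closure => //.
have bT := weak_closure_bounded XT.
split; first exact: bounded_ampl.
move=> Z ZY; have bZ : bounded_op Z by case: ZY.
have bW : bounded_op (adj U \o Z \o U) by do 2 apply: bounded_op_comp => //.
have := @commute_weak_closure X _ Xb bW _ T XT; move=> h.
have {}h : op_tensor ox T id \o (adj U \o Z \o U) = (adj U \o Z \o U) \o op_tensor ox T id.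
  apply: h => S XS; have [_ /(_ _ ZY) e] := XY _ XS.
  apply/funext => z; have := congr1 (fun F => adj U (F (U z))) e.
  by rewrite /ampl /= !UK => <-.
apply/funext => z; have := congr1 (fun F => U (F (adj U z))) h.
by rewrite /ampl /= !UKV.
Qed.
End AmplifiedConjugation.

(** * Suprema of increasing nets *)

Section Normality.
Variable R : realType.
Implicit Types H K : hilbertType R.

Lemma op_le_trans H (S T U : H -> H) : op_le S T -> op_le T U -> op_le S U.
Proof.
move=> h h' x; have -> : U x - S x = (U x - T x) + (T x - S x) by rewrite addrA subrK.
by rewrite (ipDl (inner_semi _)) addr_ge0.
Qed.

Lemma op_le_refl H (S : H -> H) : op_le S S.
Proof. by move=> x; rewrite subrr (ip0l (inner_semi _)). Qed.

Definition directed H (D : set (H -> H)) : Prop :=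
  forall T T', D T -> D T' -> exists2 U, D U & op_le T U /\ op_le T' U.

(** Directedness merges finitely many eventual properties; this controls a net at finitely many
    vectors at once. *)
Lemma directed_seq H (D : set (H -> H)) (I : eqType) (Q : I -> (H -> H) -> Prop)
    (s : seq I) T0 : directed D -> D T0 ->
  (forall i, i \in s -> exists2 T1, D T1 & forall T, D T -> op_le T1 T -> Q i T) ->
  exists2 T1, D T1 & op_le T0 T1 /\
    forall T, D T -> op_le T1 T -> forall i, i \in s -> Q i T.
Proof.
move=> dD DT0; elim: s => [|i s IH] hs.
  by exists T0 => //; split=> //; exact: op_le_refl.
have [|T1 DT1 [T01 hT1]] := IH.
  by move=> j js; apply: hs; rewrite inE js orbT.
have [T2 DT2 hT2] := hs i (mem_head _ _).
have [U DU [T1U T2U]] := dD _ _ DT1 DT2; exists U => //.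
split=> [|T DT UT j]; first exact: op_le_trans T01 T1U.
rewrite inE => /orP[/eqP ->|]; first by apply: hT2 => //; exact: op_le_trans T2U UT.
by apply: hT1 => //; exact: op_le_trans T1U UT.
Qed.

Lemma self_adjoint_adj H (S : H -> H) : self_adjoint S -> adj S = S.
Proof. exact: adj_eq. Qed.

Lemma self_adjoint_real H (S : H -> H) x : self_adjoint S -> inner (S x) x \is Num.real.
Proof. by move=> hS; rewrite CrealE -innerC hS. Qed.

(* Cauchy-Schwarz for the form <B x, y>. *)
Lemma pos_op_norm H (B : H -> H) (C : R[i]) : linear B -> self_adjoint B ->
  (forall x, 0 <= inner (B x) x) -> (forall x, inner (B x) x <= C * `|x| ^+ 2) ->
  forall x, `|B x| ^+ 2 <= C * inner (B x) x.
Proof.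
move=> lB sB B0 BC x.
have Bs : semi_inner (fun x y => inner (B x) y).
  split=> [c u v w|u v|u] //.
  - by rewrite lB (ipDl (inner_semi _)) (ipZl (inner_semi _)).
  - by rewrite -innerC sB.
have [->|Bx0] := eqVneq (B x) 0; first by rewrite normr0 expr0n (ip0l (inner_semi _)) mulr0.
have b0 : 0 < `|B x| ^+ 2 by rewrite exprn_gt0 ?normr_gt0.
have h1 := cauchy_schwarz Bs x (B x).
rewrite -inner_norm normrX normr_id -exprM in h1.
rewrite -(ler_pM2r b0) -exprD; apply: le_trans h1 _.
by rewrite mulrAC [X in _ <= X]mulrC ler_wpM2l.
Qed.

(* Vigier: the net D converges strongly, its limit is an upper bound lying in X,
   and hence dominates the supremum. *)
Lemma op_sup_approx H (X D : set (H -> H)) (S : H -> H) :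
  X `<=` @bounded_op R H H -> weak_closure X `<=` X -> D `<=` X ->
  (forall T, D T -> self_adjoint T) -> D !=set0 -> directed D -> op_sup X D S ->
  forall x (e : R[i]), 0 < e -> exists2 T, D T & inner (S x - T x) x < e.
Proof.
move=> Xb Xw DX Dsa [T0 DT0] dD [XS Ssa DS Sleast].
have lin T : D T -> linear T by move=> /DX/Xb/bounded_linear.
(* [C] bounds [S - T0], hence the quadratic form of every [T2 - T1] with [T0 <= T1 <= T2] in [D],
   since such a difference lies between 0 and [S - T0]. *)
have [C C0 hC] := bounded_bound (bounded_op_lin (-1) (Xb _ (DX _ DT0)) (Xb _ XS)).
have key T1 T2 x : D T1 -> D T2 -> op_le T0 T1 -> op_le T1 T2 ->
    `|T2 x - T1 x| ^+ 2 <= C * inner (T2 x - T1 x) x.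
  move=> DT1 DT2 T01 T12.
  have -> y : T2 y - T1 y = ((-1) *: T1 + T2) y by rewrite fun_linE scaleN1r addrC.
  apply: pos_op_norm => [|u v|u|u].
  - by apply: bounded_linear; apply: bounded_op_lin; apply: Xb; exact: DX.
  - rewrite !fun_linE (ipDl (inner_semi _)) (ipDr (inner_semi _)).
    rewrite (ipZl (inner_semi _)) (ipZr (inner_semi _)) rmorphN1.
    by rewrite (Dsa _ DT1) (Dsa _ DT2).
  - by rewrite fun_linE scaleN1r addrC.
  rewrite fun_linE scaleN1r addrC; apply: (@le_trans _ _ (inner (S u - T0 u) u)).
    rewrite -subr_ge0 -(ipBl (inner_semi _)).
    have -> : S u - T0 u - (T2 u - T1 u) = (S u - T2 u) + (T1 u - T0 u).
      by rewrite opprB addrACA [RHS]addrACA; congr (_ + _); exact: addrC.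
    by rewrite (ipDl (inner_semi _)) addr_ge0 //; exact: DS.
  rewrite -[inner _ _]ger0_norm; last by apply: DS.
  apply: le_trans (inner_le _ _) _; rewrite expr2 mulrA ler_wpM2r //.
  by have := hC u; rewrite fun_linE scaleN1r addrC.
pose E x : set R := [set complex.Re (inner (T x) x) | T in D].
have reE T x : D T -> (complex.Re (inner (T x) x))%:C%C = inner (T x) x.
  by move=> DT; rewrite RRe_real // self_adjoint_real //; exact: Dsa.
have Esup x : has_sup (E x).
  split; first by exists (complex.Re (inner (T0 x) x)), T0.
  exists (complex.Re (inner (S x) x)) => _ [T DT <-].
  rewrite -lecR reE // RRe_real ?self_adjoint_real //.
  by have := DS _ DT x; rewrite (ipBl (inner_semi _)) subr_ge0.
have cau x (e : R[i]) : 0 < e -> exists2 T1, D T1 &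
    forall T, D T -> op_le T1 T -> `|T1 x - T x| < e.
  move=> e0.
  have d0 : 0 < e ^+ 2 / C by rewrite divr_gt0 ?exprn_gt0.
  have dR : (complex.Re (e ^+ 2 / C))%:C%C = e ^+ 2 / C by rewrite RRe_real // gtr0_real.
  have d0R : 0 < complex.Re (e ^+ 2 / C) by rewrite -ltcR dR.
  (* Above [T2] the form at [x] grows by less than [e^2 / C], and [key] turns this into a variation
     of [T x] below [e]. As [key] only applies above [T0], the index [T1] is taken above both. *)
  have [_ [T2 DT2 <-] hT2] := sup_adherent d0R (Esup x).
  have [T1 DT1 [T01 T21]] := dD _ _ DT0 DT2.
  exists T1 => // T DT T1T.
  rewrite distrC -(@ltr_pXn2r _ 2) ?nnegrE ?(ltW e0) //.
  apply: le_lt_trans (key _ _ _ DT1 DT T01 T1T) _.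
  rewrite mulrC -ltr_pdivlMr // (ipBl (inner_semi _)) -(reE T) // -(reE T1) // -dR.
  rewrite -rmorphB ltcR ltrBlDr.
  have h1 : complex.Re (inner (T x) x) <= sup (E x).
    by apply: sup_upper_bound; [exact: Esup | exists T].
  have h2 : complex.Re (inner (T2 x) x) <= complex.Re (inner (T1 x) x).
    by rewrite -lecR !reE // -subr_ge0 -(ipBl (inner_semi _)).
  by move: h1 h2 hT2; lra.
have /choice[S' hS'] x : exists l, forall e : R[i], 0 < e -> exists2 T1, D T1 &
    forall T, D T -> op_le T1 T -> `|l - T x| < e.
  have n0 n : (0 : R[i]) < n.+1%:R^-1 by rewrite invr_gt0 ltr0Sn.
  (* The [u n] need not increase; two of them are compared through a common upper bound in [D]. *)
  have /choice[u hu] n : exists T1, D T1 /\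
      forall T, D T -> op_le T1 T -> `|T1 x - T x| < (n.+1%:R^-1 : R[i]).
    by have [T1 DT1 h] := cau x _ (n0 n); exists T1.
  have [e e0|l hl] := @norm_complete _ _ (fun n => u n x).
    have e2 : 0 < e / 2 by rewrite divr_gt0 ?ltr0Sn.
    have [N hN] := small_invn e2; exists N => m n Nm Nn.
    have [Dm hm] := hu m; have [Dn hn] := hu n.
    have [T DT [mT nT]] := dD _ _ Dm Dn.
    rewrite (le_lt_trans (ler_distD (T x) _ _)) // [e]splitr ltrD //.
      by rewrite (lt_trans (hm _ DT mT)) // hN.
    by rewrite distrC (lt_trans (hn _ DT nT)) // hN.
  exists l => e e0; have e2 : 0 < e / 2 by rewrite divr_gt0 ?ltr0Sn.
  have [N hN] := small_invn e2; have [N' hN'] := hl _ e2.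
  pose n := maxn N N'; have [Dn hn] := hu n; exists (u n) => // T DT nT.
  rewrite (le_lt_trans (ler_distD (u n x) _ _)) // [e]splitr ltrD //.
    by rewrite distrC hN' // leq_maxr.
  by rewrite (lt_trans (hn _ DT nT)) // hN // leq_maxl.
have common (xs : seq H) (e : R[i]) : 0 < e -> exists2 T1, D T1 & op_le T0 T1 /\
    forall T, D T -> op_le T1 T -> forall x, x \in xs -> `|S' x - T x| < e.
  by move=> e0; apply: directed_seq => // x _; exact: hS'.
have bS' : bounded_op S'.
  apply/bounded_opP; split=> [c x y|].
    apply/eqP; rewrite -subr_eq0 -normr_eq0; apply/eqP/eq0_small => // e e0.
    (* Three errors enter, with weights 1, [|c|] and 1. *)
    have M0 : 0 < `|c| + 2 by rewrite ltr_wpDl ?ltr0Sn.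
    have d0 : 0 < e / (`|c| + 2) by rewrite divr_gt0.
    have [T DT [_ hT]] := common [:: c *: x + y; x; y] _ d0.
    have {}hT := hT T DT (op_le_refl _).
    have h1 := hT (c *: x + y) (mem_head _ _).
    have h2 : `|S' x - T x| < e / (`|c| + 2) by apply: hT; rewrite !inE eqxx orbT.
    have h3 : `|S' y - T y| < e / (`|c| + 2) by apply: hT; rewrite !inE eqxx !orbT.
    have -> : S' (c *: x + y) - (c *: S' x + S' y) =
        (S' (c *: x + y) - T (c *: x + y)) - (c *: (S' x - T x) + (S' y - T y)).
      rewrite (lin _ DT) scalerBr [in RHS]addrACA -[in RHS]opprD.
      by rewrite opprB [in RHS]addrA subrK.
    apply: le_trans (ler_normB _ _) _.
    have -> : e = e / (`|c| + 2) + (`|c| * (e / (`|c| + 2)) + e / (`|c| + 2)).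
      by field; rewrite gt_eqF.
    apply: lerD; first exact: ltW.
    apply: le_trans (ler_normD _ _) _; rewrite normrZ lerD ?(ltW h3) //.
    by rewrite ler_wpM2l // ltW.
  have [C1 C10 hC1] := bounded_bound (Xb _ (DX _ DT0)).
  (* [S' x] is [T0 x], plus [T x - T0 x], which [key] bounds by [C |x|] uniformly in [T], plus an
     arbitrarily small error. *)
  exists (C1 + C) => [|x]; first exact: addr_gt0.
  apply: (@le_small _ _ _ 1) => // e e0; rewrite mul1r.
  have [T DT [T0T hT]] := common [:: x] _ e0.
  have {}hT := hT T DT (op_le_refl _) x (mem_head _ _).
  have -> : S' x = T0 x + (T x - T0 x) + (S' x - T x).
    by rewrite [T0 x + _]addrC subrK [RHS]addrC subrK.
  apply: le_trans (ler_normD _ _) _; apply: lerD; last exact: ltW.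
  apply: le_trans (ler_normD _ _) _; rewrite mulrDl lerD //.
  rewrite -(@ler_pXn2r _ 2) ?nnegrE ?mulr_ge0 ?(ltW C0) //.
  apply: le_trans (key _ _ _ DT0 DT (op_le_refl _) T0T) _.
  rewrite exprMn expr2 -mulrA ler_wpM2l ?(ltW C0) //.
  apply: (@le_trans _ _ (inner (S x - T0 x) x)).
    rewrite -subr_ge0 -(ipBl (inner_semi _)).
    have -> : S x - T0 x - (T x - T0 x) = S x - T x by rewrite opprB addrA subrK.
    exact: DS.
  rewrite -[inner _ _]ger0_norm; last by apply: DS.
  apply: le_trans (inner_le _ _) _; rewrite expr2 mulrA ler_wpM2r //.
  by have := hC x; rewrite fun_linE scaleN1r addrC.
have S'sa : self_adjoint S'.
  move=> x y; apply/eqP; rewrite -subr_eq0 -normr_eq0; apply/eqP/eq0_small => // e e0.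
  have M0 : 0 < `|x| + `|y| + 1 by rewrite ltr_wpDl // addr_ge0.
  have d0 : 0 < e / (`|x| + `|y| + 1) by rewrite divr_gt0.
  have [T DT [_ hT]] := common [:: x; y] _ d0.
  have {}hT := hT T DT (op_le_refl _).
  have h1 := hT x (mem_head _ _).
  have h2 : `|S' y - T y| < e / (`|x| + `|y| + 1) by apply: hT; rewrite !inE eqxx orbT.
  have -> : inner (S' x) y - inner x (S' y) = inner (S' x - T x) y - inner x (S' y - T y).
    rewrite (ipBl (inner_semi _)) (ipBr (inner_semi _)) (Dsa _ DT).
    by rewrite opprB addrA subrK.
  apply: le_trans (ler_normB _ _) _.
  apply: (@le_trans _ _ (e / (`|x| + `|y| + 1) * `|y| + `|x| * (e / (`|x| + `|y| + 1)))).
    apply: lerD; apply: le_trans (inner_le _ _) _.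
      by rewrite ler_wpM2r // ltW.
    by rewrite ler_wpM2l // ltW.
  rewrite [X in _ + X]mulrC -mulrDr -mulrA ler_piMr ?(ltW e0) //.
  by rewrite mulrC ler_pdivrMr // mul1r addrC lerDl.
have XS' : X S'.
  apply: Xw; split=> // s e e0.
  pose M := \sum_(p <- s) `|p.2| + 1.
  have M0 : 0 < M by rewrite ltr_wpDl // sumr_ge0.
  have [T DT [_ hT]] := common (map fst s) _ (divr_gt0 e0 M0).
  exists T; first exact: DX.
  move=> p ps; apply: le_lt_trans (inner_le _ _) _.
  have h1 := hT T DT (op_le_refl _) p.1 (map_f _ ps).
  have h2 : `|p.2| <= M.
    by rewrite /M (big_rem p) //= -addrA lerDl addr_ge0 // sumr_ge0.
  apply: (@le_lt_trans _ _ (`|S' p.1 - T p.1| * M)); first by rewrite ler_wpM2l.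
  by rewrite -ltr_pdivlMr.
have DS' T : D T -> op_le T S'.
  move=> DT x; apply: ge0_approx => e e0.
  have M0 : 0 < `|x| + 1 by rewrite ltr_wpDl.
  have [T1 DT1 hT1] := hS' x _ (divr_gt0 e0 M0).
  have [U DU [TU T1U]] := dD _ _ DT DT1.
  exists (inner (U x - T x) x); first exact: TU.
  rewrite -(ipBl (inner_semi _)) opprB addrA subrK.
  apply: le_trans (inner_le _ _) _.
  apply: (@le_trans _ _ (e / (`|x| + 1) * (`|x| + 1))); last by rewrite divfK // gt_eqF.
  by rewrite ler_pM // ?lerDl // ltW // hT1.
move=> x e e0.
have M0 : 0 < `|x| + 1 by rewrite ltr_wpDl.
have [T DT hT] := hS' x _ (divr_gt0 e0 M0); exists T => //.
apply: (@le_lt_trans _ _ (inner (S' x - T x) x)).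
  rewrite -subr_ge0 -(ipBl (inner_semi _)) opprB addrA subrK.
  exact: (Sleast S' XS' S'sa DS').
rewrite -[inner _ _]ger0_norm; last exact: DS'.
apply: le_lt_trans (inner_le _ _) _.
apply: (@le_lt_trans _ _ (`|S' x - T x| * (`|x| + 1))).
  by rewrite ler_wpM2l // lerDl.
by rewrite -ltr_pdivlMr //; apply: hT => //; exact: op_le_refl.
Qed.

Section AmplNormal.
Variables (H K HK : hilbertType R) (ox : H -> K -> HK).
Hypothesis Hox : hilbert_tensor ox.
Variable U : HK -> HK.
Hypothesis Uu : unitary_op U.
Let bU : bounded_op U. Proof. by case: Uu. Qed.

Lemma ampl_inner S z : inner (ampl ox U S z) z =
  inner (op_tensor ox S id (adj U z)) (adj U z).
Proof. by rewrite /ampl /= (adjP bU). Qed.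

Lemma ampl_sub S T z : bounded_op S -> bounded_op T ->
  ampl ox U S z - ampl ox U T z = ampl ox U ((-1) *: T + S) z.
Proof. by move=> bS bT; rewrite ampl_lin // fun_linE scaleN1r addrC. Qed.

Lemma ampl_le S T : bounded_op S -> bounded_op T -> op_le S T ->
  op_le (ampl ox U S) (ampl ox U T).
Proof.
move=> bS bT ST z; rewrite ampl_sub // ampl_inner op_tensor_ge0 //.
  exact: bounded_op_lin.
by move=> x; rewrite fun_linE scaleN1r addrC.
Qed.

(** [adj U z] is split into a tensor [w] with orthogonal right legs and a small remainder. On [w]
    the form of [(S - T) ⊗ 1] is a weighted sum of forms of [S - T] at the [f i], made small by one
    [T]; on the remainder it is dominated by the form for the fixed [T0]. *)
Lemma ampl_approx (D : set (H -> H)) S : D `<=` @bounded_op R H H -> bounded_op S ->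
  D !=set0 -> directed D -> (forall T, D T -> op_le T S) ->
  (forall x (e : R[i]), 0 < e -> exists2 T, D T & inner (S x - T x) x < e) ->
  forall z (e : R[i]), 0 < e -> exists2 T, D T &
    inner (ampl ox U S z - ampl ox U T z) z < e.
Proof.
move=> Db bS [T0 DT0] dD DS hD z e e0.
pose B T := op_tensor ox ((-1) *: T + S) id.
have bid := bounded_op_id K.
have bA T : D T -> bounded_op ((-1) *: T + S).
  by move=> DT; apply: bounded_op_lin => //; exact: Db.
have bB T : D T -> bounded_op (B T).
  by move=> DT; apply: (bounded_op_tensor Hox) => //; exact: bA.
have B0 T y : D T -> 0 <= inner (B T y) y.
  move=> DT; apply: (op_tensor_ge0 Hox); first exact: bA.
  by move=> x; rewrite fun_linE scaleN1r addrC; exact: DS.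
have Ble T T' y : D T -> D T' -> op_le T T' -> inner (B T' y) y <= inner (B T y) y.
  move=> DT DT' TT'; rewrite -subr_ge0 -(ipBl (inner_semi _)).
  have -> : B T y - B T' y = op_tensor ox ((-1) *: T + T') id y.
    have -> : (-1) *: T + T' = (-1) *: ((-1) *: T' + S) + ((-1) *: T + S).
      apply/funext => x; rewrite !fun_linE !scaleN1r opprD opprK [RHS]addrACA.
      by rewrite addNr addr0 addrC.
    rewrite (op_tensor_linl Hox (-1) (bA _ DT') (bA _ DT) bid) [RHS]fun_linE [RHS]addrC.
    by rewrite [X in _ = _ + X]scaleN1r.
  apply: (op_tensor_ge0 Hox); first by apply: bounded_op_lin; exact: Db.
  by move=> x; rewrite fun_linE scaleN1r addrC; exact: TT'.
have par T a b : D T -> inner (B T (a + b)) (a + b) <=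
    2 * inner (B T a) a + 2 * inner (B T b) b.
  move=> DT; rewrite -subr_ge0; have lB := bounded_linear (bB _ DT).
  apply: le_trans (B0 T (a - b) DT) _; rewrite (linB lB) (linD lB).
  rewrite !(ipDl (inner_semi _)) !(ipDr (inner_semi _)) !(ipNl (inner_semi _)).
  rewrite !(ipNr (inner_semi _)).
  by rewrite le_eqVlt; apply/orP; left; apply/eqP; ring.
have [C C0 hC] := bounded_bound (bB _ DT0).
set y := adj U z.
(* Chosen so that [C |y - w|^2 < e / 4]; the part on [w] also costs at most [e / 4], and [par]
   doubles both. *)
have d0 : 0 < sqrtC (e / (4 * C)) by rewrite sqrtC_gt0 divr_gt0 // mulr_gt0 ?ltr0Sn.
have [_ [t _ <-] yt] := (denseP _).1 (dense_ox_lift Hox) y _ d0.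
set w := ox_lift ox t in yt.
have [n [f [g [tE og]]]] := orthogonal_rep t.
pose M := \sum_(i < n) inner (g i) (g i) + 1.
have M0 : 0 < M by rewrite ltr_wpDl // sumr_ge0 // => i _; exact: ip_ge0 (inner_semi _) _.
have [|T DT [T0T hT]] := @directed_seq H D _
    (fun (i : 'I_n) T => inner (S (f i) - T (f i)) (f i) < e / (4 * M)) (enum 'I_n) T0 dD DT0.
  move=> i _; have [|T DT hT] := hD (f i) (e / (4 * M)).
    by rewrite divr_gt0 // mulr_gt0 ?ltr0Sn.
  exists T => // T' DT' TT'; apply: le_lt_trans hT.
  rewrite -subr_ge0 -(ipBl (inner_semi _)) opprB [X in inner X _]addrC addrA subrK.
  exact: TT'.
exists T => //.
rewrite ampl_sub //; last exact: Db.
rewrite ampl_inner -/(B T) -/y.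
have -> : y = w + (y - w) by rewrite addrC subrK.
apply: le_lt_trans (par _ _ _ DT) _.
have -> : e = 2 * (e / 4) + 2 * (e / 4) by field.
apply: ler_ltD.
  rewrite ler_pM2l ?ltr0Sn //.
  have -> : w = \sum_(i < n) ox (f i) (g i).
    by rewrite /w tE; apply: (linear_pure_sum (ox_liftE Hox)).
  rewrite (lin_sum (bounded_linear (bB _ DT))).
  rewrite (eq_bigr (fun i : 'I_n => ox (((-1) *: T + S) (f i)) (g i))); last first.
    by move=> i _; rewrite /B op_tensorE //; exact: bA.
  rewrite (inner_orthogonal_family Hox (((-1) *: T + S) \o f)) //.
  apply: (@le_trans _ _ (e / (4 * M) * \sum_(i < n) inner (g i) (g i))).
    rewrite mulr_sumr; apply: ler_sum => i _ /=.
    rewrite ler_wpM2r ?(ip_ge0 (inner_semi _)) // fun_linE scaleN1r addrC ltW //.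
    by apply: hT; rewrite ?mem_enum //; exact: op_le_refl.
  apply: (@le_trans _ _ (e / (4 * M) * M)); last first.
    by rewrite le_eqVlt; apply/orP; left; apply/eqP; field; rewrite gt_eqF.
  by rewrite ler_wpM2l ?lerDl // ltW // divr_gt0 // mulr_gt0 ?ltr0Sn.
rewrite ltr_pM2l ?ltr0Sn //; apply: le_lt_trans (Ble _ _ _ DT0 DT T0T) _.
rewrite norm_sqrtC_lt in yt; last by rewrite divr_gt0 // mulr_gt0 ?ltr0Sn.
apply: (@le_lt_trans _ _ (C * inner (y - w) (y - w))).
  rewrite -[X in X <= _]ger0_norm; last exact: B0.
  apply: le_trans (inner_le _ _) _; rewrite -inner_norm expr2 mulrA ler_wpM2r //.
rewrite mulrC -ltr_pdivlMr //; apply: lt_le_trans yt _.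
by rewrite le_eqVlt; apply/orP; left; apply/eqP; field; rewrite gt_eqF.
Qed.

(** For an upper bound [W] of the images, the form of [W - ampl S] differs from the nonnegative form
    of [W - ampl T] by that of [ampl S - ampl T], which [ampl_approx] makes small at each vector. *)
Lemma ampl_normal (X : set (H -> H)) (Y : set (HK -> HK)) :
  X `<=` @bounded_op R H H -> weak_closure X `<=` X ->
  (forall S, X S -> Y (ampl ox U S)) -> normal_map X Y (ampl ox U).
Proof.
move=> Xb Xw XY D S DX Dsa D0 dD SS.
have app := op_sup_approx Xb Xw DX Dsa D0 dD SS.
case: SS => XS Ssa DS _.
have Db : D `<=` @bounded_op R H H by move=> T /DX/Xb.
have bS := Xb _ XS.
split; first exact: XY.
- have := ampl_adj Hox Uu bS; rewrite self_adjoint_adj // => h x y.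
  by rewrite {2}h -(adjP (bounded_ampl Hox Uu bS)).
- by move=> _ [T DT <-]; apply: ampl_le; [exact: Db | | exact: DS].
move=> W YW Wsa hW z; apply: ge0_approx => e e0.
have [T DT hT] := ampl_approx Db bS D0 dD DS app z e0.
exists (inner (W z - ampl ox U T z) z); first by apply: (hW (ampl ox U T)); exists T.
rewrite -(ipBl (inner_semi _)) opprB [X in inner X _]addrC addrA subrK.
rewrite -normrN -(ipNl (inner_semi _)) opprB ger0_norm; first exact: ltW.
by apply: ampl_le; [exact: Db | | exact: DS].
Qed.
End AmplNormal.
End Normality.

(** * Closures and multipliers on tensor products *)

Section TensorClosures.
Variables (R : realType) (H K HK : hilbertType R) (ox : H -> K -> HK).
Hypothesis Hox : hilbert_tensor ox.
Implicit Types (X : set (H -> H)) (Y : set (K -> K)).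

Definition pure_ops X Y : set (HK -> HK) := [set op_tensor ox S T | S in X & T in Y].

Lemma pure_ops_bounded X Y : X `<=` @bounded_op R H H -> Y `<=` @bounded_op R K K ->
  pure_ops X Y `<=` @bounded_op R HK HK.
Proof.
by move=> Xb Yb _ [S XS [T YT <-]]; apply: (bounded_op_tensor Hox); [exact: Xb|exact: Yb].
Qed.

Lemma op_tensor_lspan X Y S T : X `<=` @bounded_op R H H -> Y `<=` @bounded_op R K K ->
  lspan X S -> lspan Y T -> lspan (pure_ops X Y) (op_tensor ox S T).
Proof.
move=> Xb Yb; have [sp0 spP] := subspace_lspan (pure_ops X Y).
have t0l T' : bounded_op T' -> op_tensor ox (0 : H -> H) T' = 0.
  move=> bT'; apply: (op_tensor_eq Hox) => // [||x y]; try exact: bounded_op0.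
  by rewrite !fun0E (lin0 (oxl_linear Hox _)).
have t0r S' : bounded_op S' -> op_tensor ox S' (0 : K -> K) = 0.
  move=> bS'; apply: (op_tensor_eq Hox) => // [||x y]; try exact: bounded_op0.
  by rewrite !fun0E (lin0 (oxr_linear Hox _)).
move=> XS YT.
suff : lspan X `<=` [set S' : H -> H | bounded_op S' /\ lspan (pure_ops X Y) (op_tensor ox S' T)].
  by move=> /(_ _ XS)[].
have bT := lspan_bounded Yb YT.
apply: lspan_subset => [|S' XS'].
  split=> [|c S1 S2 [b1 h1] [b2 h2]].
    by split; [exact: bounded_op0 | rewrite t0l].
  split; first exact: bounded_op_lin.
  by rewrite (op_tensor_linl Hox) //; exact: spP.
split; first exact: Xb.
have bS' := Xb _ XS'.
suff : lspan Y `<=` [set T' : K -> K | bounded_op T' /\ lspan (pure_ops X Y) (op_tensor ox S' T')].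
  by move=> /(_ _ YT)[].
apply: lspan_subset => [|T' YT'].
  split=> [|c S1 S2 [b1 h1] [b2 h2]].
    by split; [exact: bounded_op0 | rewrite t0r].
  split; first exact: bounded_op_lin.
  by rewrite (op_tensor_linr Hox) //; exact: spP.
by split; [exact: Yb | apply: sub_lspan; exists S' => //; exists T'].
Qed.

Lemma op_tensor_lipschitzl T : bounded_op T ->
  exists2 C, 0 < C & op_lipschitz C (fun S => op_tensor ox S T).
Proof.
move=> bT; have [C C0 hC] := bounded_bound bT; exists C => // S S' b bS bS' b0 h z.
have bd : bounded_op ((-1) *: S' + S) by exact: bounded_op_lin.
have hd x : `|((-1) *: S' + S) x| <= b * `|x| by rewrite fun_linE scaleN1r addrC.
have := op_tensor_bound Hox bd bT b0 hd C0 hC z.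
by rewrite (op_tensor_linl Hox) // fun_linE scaleN1r addrC (mulrC b).
Qed.

Lemma op_tensor_lipschitzr S : bounded_op S ->
  exists2 C, 0 < C & op_lipschitz C (fun T => op_tensor ox S T).
Proof.
move=> bS; have [C C0 hC] := bounded_bound bS; exists C => // T T' b bT bT' b0 h z.
have bd : bounded_op ((-1) *: T' + T) by exact: bounded_op_lin.
have hd x : `|((-1) *: T' + T) x| <= b * `|x| by rewrite fun_linE scaleN1r addrC.
have := op_tensor_bound Hox bS bd C0 hC b0 hd z.
by rewrite (op_tensor_linr Hox) // fun_linE scaleN1r addrC.
Qed.

(** One leg is approximated at a time, since the Lipschitz constant in one leg is a bound of the
    operator in the other. *)
Lemma op_tensor_norm_closure X Y S T :
  X `<=` @bounded_op R H H -> Y `<=` @bounded_op R K K ->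
  norm_closure X S -> norm_closure Y T -> norm_closure (pure_ops X Y) (op_tensor ox S T).
Proof.
move=> Xb Yb XS YT.
have bS := norm_closure_bounded XS.
apply: norm_closure_idem.
have [C C0 hC] := op_tensor_lipschitzr bS.
apply: (norm_closure_map Yb _ C0 hC _ YT) => [T' bT'|T' YT'].
  exact: (bounded_op_tensor Hox).
have bT' := Yb _ YT'.
have [D D0 hD] := op_tensor_lipschitzl bT'.
apply: (norm_closure_map Xb _ D0 hD _ XS) => [S' bS'|S' XS'].
  exact: (bounded_op_tensor Hox).
by exists S' => //; exists T'.
Qed.

Lemma cstar_tensor_norm_closure X Y :
  X `<=` @bounded_op R H H -> Y `<=` @bounded_op R K K ->
  cstar_tensor ox (norm_closure X) (norm_closure Y) `<=` norm_closure (lspan (pure_ops X Y)).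
Proof.
move=> Xb Yb T /norm_closureS h; apply: norm_closure_idem; apply: h.
apply: lspan_subset; first by apply: norm_closure_lin; exact: subspace_lspan.
move=> _ [S XS [S' YS' <-]]; apply: (norm_closureS (@sub_lspan _ _ _)).
exact: op_tensor_norm_closure.
Qed.

(** Cancels factors [S ⊗ T] on the right: by non-degeneracy the vectors [S x ⊗ T y] are total. *)
Lemma bounded_ext_pure_ops (L : hilbertType R) X Y (F G : HK -> L) :
  X `<=` @bounded_op R H H -> Y `<=` @bounded_op R K K ->
  nondegenerate X -> nondegenerate Y -> bounded_op F -> bounded_op G ->
  (forall S T, X S -> Y T -> F \o op_tensor ox S T = G \o op_tensor ox S T) -> F = G.
Proof.
move=> Xb Yb Xn Yn bF bG FG; apply: (bounded_ext_ox Hox bF bG Xn Yn) => x y hx hy.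
have [lF lG] := (bounded_linear bF, bounded_linear bG).
move: x hx; apply: lspan_subset => [|_ [S XS [x _ <-]] /=].
  split=> [|c x x' hx hx'] /=; first by rewrite (lin0 (oxl_linear Hox y)) (lin0 lF) (lin0 lG).
  by rewrite (oxl_linear Hox y) lF lG hx hx'.
move: y hy; apply: lspan_subset => [|_ [T YT [y _ <-]] /=].
  split=> [|c y y' hy hy'] /=; first by rewrite (lin0 (oxr_linear Hox _)) (lin0 lF) (lin0 lG).
  by rewrite (oxr_linear Hox) lF lG hy hy'.
have /= := congr1 (@^~ (ox x y)) (FG S T XS YT).
by rewrite (op_tensorE Hox) //; [exact: Xb | exact: Yb].
Qed.

Lemma ox_inner_eq0 (D : set H) (E : set K) (w : HK) :
  closure D = setT -> closure E = setT ->
  (forall x y, D x -> E y -> inner w (ox x y) = 0) -> w = 0.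
Proof.
move=> hD hE hw; apply: (inner_eq0_dense (dense_ox_lift Hox)) => _ [t _ <-].
elim/tensor_ind: t => [u v||t t' ht ht'].
- have h1 x : D x -> adj (ox x) w = 0.
    move=> Dx; apply: (inner_eq0_dense hE) => y Ey.
    by rewrite (is_adjoint_sym (adjP (bounded_oxr Hox x))) hw.
  have h2 : adj (ox^~ v) w = 0.
    apply: (inner_eq0_dense hD) => x Dx.
    rewrite (is_adjoint_sym (adjP (bounded_oxl Hox v))).
    by rewrite -(is_adjoint_sym (adjP (bounded_oxr Hox x))) h1 // (ip0l (inner_semi _)).
  rewrite (ox_liftE Hox) -(is_adjoint_sym (adjP (bounded_oxl Hox v))) h2.
  by rewrite (ip0l (inner_semi _)).
- by rewrite (ox_lift0 Hox) (ip0r (inner_semi _)).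
- by rewrite (ox_liftD Hox) (ipDr (inner_semi _)) ht ht' addr0.
Qed.

Lemma comp_cstar_tensor X Y S0 T0 : X `<=` @bounded_op R H H -> Y `<=` @bounded_op R K K ->
  bounded_op S0 -> bounded_op T0 -> (forall S, X S -> X (S0 \o S)) ->
  (forall T, Y T -> Y (T0 \o T)) ->
  forall Z, cstar_tensor ox X Y Z -> cstar_tensor ox X Y (op_tensor ox S0 T0 \o Z).
Proof.
move=> Xb Yb bS0 bT0 hS hT Z.
have bST := bounded_op_tensor Hox bS0 bT0.
have pb := lspan_bounded (pure_ops_bounded Xb Yb).
apply: (norm_closure_comp (X := [set op_tensor ox S0 T0]) pb); last first.
  by apply: sub_norm_closure => // _ ->.
move=> _ Z' -> hZ'.
suff : lspan (pure_ops X Y) `<=`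
    [set Z : HK -> HK | lspan (pure_ops X Y) (op_tensor ox S0 T0 \o Z)] by apply.
have [sp0 spP] := subspace_lspan (pure_ops X Y).
apply: lspan_subset => [|_ [S XS [T YT <-]]] /=.
  split=> [|c Z1 Z2 h1 h2] /=.
    suff -> : op_tensor ox S0 T0 \o (0 : HK -> HK) = 0 by [].
    by apply/funext => z; rewrite /= fun0E (lin0 (bounded_linear bST)).
  suff -> : op_tensor ox S0 T0 \o (c *: Z1 + Z2) =
      c *: (op_tensor ox S0 T0 \o Z1) + (op_tensor ox S0 T0 \o Z2) by exact: spP.
  by apply/funext => z; rewrite /= !fun_linE (bounded_linear bST).
rewrite (op_tensor_comp Hox bS0 bT0 (Xb _ XS) (Yb _ YT)); apply: sub_lspan.
by exists (S0 \o S); [exact: hS | exists (T0 \o T); [exact: hT|]].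
Qed.

(** Strips closures and spans off both factors, so that a density claim has to be checked on
    generators only. *)
Lemma cstar_tensor_sub X X1 Y Y1 (W : set (HK -> HK)) :
  X1 `<=` @bounded_op R H H -> Y1 `<=` @bounded_op R K K ->
  X `<=` norm_closure (lspan X1) -> Y `<=` norm_closure (lspan Y1) ->
  (forall S T, X1 S -> Y1 T -> W (op_tensor ox S T)) ->
  cstar_tensor ox X Y `<=` norm_closure (lspan W).
Proof.
move=> X1b Y1b XX1 YY1 hW Z hZ.
have {hZ} : cstar_tensor ox (norm_closure (lspan X1)) (norm_closure (lspan Y1)) Z.
  apply: norm_closureS hZ; apply: lspanS => _ [S XS [T YT <-]].
  by exists S; [exact: XX1 | exists T; [exact: YY1|]].
move=> /(cstar_tensor_norm_closure (lspan_bounded X1b) (lspan_bounded Y1b)).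
apply: norm_closureS; apply: lspan_subset; first exact: subspace_lspan.
move=> _ [S XS [T YT <-]].
have := op_tensor_lspan X1b Y1b XS YT; apply: lspanS => _ [S' XS' [T' YT' <-]].
exact: hW.
Qed.

(** Cancels factors on the left: [S ⊗ 1] moves to the other argument of the inner product as
    [adj S ⊗ 1], and the vectors [S x ⊗ y] are total. *)
Lemma op_tensor_left_eq0 X (w : HK) : star_subalgebra X -> nondegenerate X ->
  (forall S, X S -> op_tensor ox S id w = 0) -> w = 0.
Proof.
move=> [Xb _ _ _ XA] Xn hw; have bid := bounded_op_id K.
apply: (ox_inner_eq0 Xn (closure_setT _)) => x y + _.
move: x.
apply: (lspan_subset (D := [set x | inner w (ox x y) = 0])).
  split=> [|c x x' /= hx hx']; first by rewrite /= (lin0 (oxl_linear Hox y)) (ip0r (inner_semi _)).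
  by rewrite (oxl_linear Hox y) (ipDr (inner_semi _)) (ipZr (inner_semi _)) hx hx' mulr0 addr0.
move=> _ [S XS [x _ <-]] /=; have bS := Xb _ XS.
have -> : ox (S x) y = op_tensor ox S id (ox x y) by rewrite (op_tensorE Hox).
rewrite -(is_adjoint_sym (adjP (bounded_op_tensor Hox bS bid))).
by rewrite (adj_op_tensor Hox) // adj_id hw ?(ip0l (inner_semi _)) //; exact: XA.
Qed.

End TensorClosures.

(** * Unitaries, the flip, and equality of two amplifications *)

Section Unitaries.
Variable R : realType.
Implicit Types H K L : hilbertType R.

Lemma unitary_intro H (U W : H -> H) : bounded_op U -> bounded_op W -> is_adjoint U W ->
  W \o U = id -> U \o W = id -> unitary_op U.
Proof. by move=> bU bW /adj_eq UW h h'; split; rewrite ?UW. Qed.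

Lemma unitary_id H : @unitary_op R H id.
Proof. by apply: (@unitary_intro _ _ id) => //; exact: bounded_op_id. Qed.

Lemma unitary_comp H (U W : H -> H) : unitary_op U -> unitary_op W -> unitary_op (U \o W).
Proof.
move=> [bU U1 U2] [bW W1 W2]; split; first exact: bounded_op_comp.
  rewrite adj_comp //; apply/funext => x /=.
  by have /= -> := congr1 (@^~ (W x)) U1; exact: (congr1 (@^~ x) W1).
rewrite adj_comp //; apply/funext => x /=.
by have /= -> := congr1 (@^~ (adj U x)) W2; exact: (congr1 (@^~ x) U2).
Qed.

Lemma unitary_op_tensor H K L (ox : H -> K -> L) (U : H -> H) (W : K -> K) :
  hilbert_tensor ox -> unitary_op U -> unitary_op W -> unitary_op (op_tensor ox U W).
Proof.
move=> Hox [bU U1 U2] [bW W1 W2]; have bU' := bounded_adj bU; have bW' := bounded_adj bW.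
split; first exact: (bounded_op_tensor Hox).
  by rewrite (adj_op_tensor Hox) // (op_tensor_comp Hox) // U1 W1 (op_tensor_id Hox).
by rewrite (adj_op_tensor Hox) // (op_tensor_comp Hox) // U2 W2 (op_tensor_id Hox).
Qed.

(** The map comes from viewing [L] as a tensor product with exchanged factors; being involutive and
    symmetric on simple tensors, it is unitary and self-adjoint. *)
Lemma flip_exists H L (ox : H -> H -> L) : hilbert_tensor ox ->
  exists F : L -> L, [/\ unitary_op F, adj F = F & forall x y, F (ox x y) = ox y x].
Proof.
move=> Hox; have [F [bF FE]] := tensor_iso_exists Hox (hilbert_tensor_swap Hox).
have FF : F \o F = id.
  apply: (bounded_ext_pure Hox) => [||x y]; [exact: bounded_op_comp|exact: bounded_op_id|].
  by rewrite /= !FE.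
have Fi x y x' y' : inner (F (ox x y)) (ox x' y') = inner (ox x y) (F (ox x' y')).
  by rewrite !FE !(inner_ox Hox) mulrC.
have FA : adj F = F.
  apply: (bounded_ext_pure Hox) => [||x y] //; first exact: bounded_adj.
  apply: (inner_inj_dense (dense_ox_lift Hox)) => _ [t _ <-].
  rewrite (is_adjoint_sym (adjP bF)); elim/tensor_ind: t => [x' y'||t t' ht ht'].
  - by rewrite (ox_liftE Hox) Fi.
  - by rewrite (ox_lift0 Hox) (lin0 (bounded_linear bF)) !(ip0r (inner_semi _)).
  - by rewrite (ox_liftD Hox) (linD (bounded_linear bF)) !(ipDr (inner_semi _)) ht ht'.
by exists F; split=> //; split=> //; rewrite FA.
Qed.

Lemma nondegenerate_id H (X : set (H -> H)) : X id -> nondegenerate X.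
Proof.
move=> Xid; apply/seteqP; split=> // x _; apply: subset_closure.
by apply: sub_lspan; exists id => //; exists x.
Qed.

(** Equality of the two conjugates of [T ⊗ 1] says that [T ⊗ 1] commutes with [adj U' \o U], and
    this condition survives weak closure. *)
Lemma ampl_eq_weak_closure H K L (ox : H -> K -> L) (U U' : L -> L) (X : set (H -> H)) :
  hilbert_tensor ox -> unitary_op U -> unitary_op U' -> X `<=` @bounded_op R H H ->
  (forall S, X S -> ampl ox U S = ampl ox U' S) ->
  forall T, weak_closure X T -> ampl ox U T = ampl ox U' T.
Proof.
move=> Hox [bU U1 U2] [bU' U'1 U'2] Xb hX T XT.
have bW : bounded_op (adj U' \o U) by apply: bounded_op_comp => //; exact: bounded_adj.
have UK z : adj U (U z) = z := congr1 (@^~ z) U1.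
have UKV z : U (adj U z) = z := congr1 (@^~ z) U2.
have UK' z : adj U' (U' z) = z := congr1 (@^~ z) U'1.
have UKV' z : U' (adj U' z) = z := congr1 (@^~ z) U'2.
have h := commute_weak_closure Hox Xb bW _ XT.
have {}h : op_tensor ox T id \o (adj U' \o U) = (adj U' \o U) \o op_tensor ox T id.
  apply: h => S XS; apply/funext => z.
  have := congr1 (fun F => adj U' (F (U z))) (hX S XS).
  by rewrite /ampl /= UK UK' => ->.
apply/funext => z; have := congr1 (fun F => U' (F (adj U z))) h.
by rewrite /ampl /= UKV UKV' => ->.
Qed.

End Unitaries.

(** * Extension of an amplification to multiplier algebras *)

Section Multipliers.
Variables (R : realType) (H K HK : hilbertType R) (ox : H -> K -> HK).
Hypothesis Hox : hilbert_tensor ox.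
Variable U : HK -> HK.
Hypothesis Uu : unitary_op U.
(** [Q] is the source algebra, [G] a set of generators with known images, [Y] the target. The
    instances are [P] generated by [range act], for [Delta1], and [PP] generated by simple tensors,
    for [Phi] and [Psi]. *)
Variables (Q G : set (H -> H)) (Y : set (HK -> HK)).
Hypotheses (Qstar : star_subalgebra Q) (QG : Q `<=` norm_closure (lspan G)).
Hypotheses (Gb : G `<=` @bounded_op R H H).
Hypotheses (Ystar : star_subalgebra Y) (Yclosed : norm_closure Y `<=` Y).
Hypothesis GY : forall S Z, G S -> Y Z -> Y (ampl ox U S \o Z).

Lemma ampl_lspan (G' : set (H -> H)) (Y' : set (HK -> HK)) : subspace Y' ->
  G' `<=` @bounded_op R H H -> (forall S, G' S -> Y' (ampl ox U S)) ->
  forall S, lspan G' S -> Y' (ampl ox U S).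
Proof.
move=> [Y0 YP] G'b hG S GS.
suff : lspan G' `<=` [set T : H -> H | bounded_op T /\ Y' (ampl ox U T)] by move=> /(_ _ GS)[].
apply: lspan_subset => [|T GT]; last by split; [exact: G'b | exact: hG].
split=> [|c S1 S2 [b1 h1] [b2 h2]].
  split; first exact: bounded_op0.
  suff -> : ampl ox U (0 : H -> H) = 0 by [].
  have := ampl_lin Hox Uu (-1) (bounded_op0 H H) (bounded_op0 H H).
  rewrite !scaler0 addr0 => ->; apply/funext => x.
  by rewrite fun_linE scaleN1r addNr.
by split; [exact: bounded_op_lin | rewrite (ampl_lin Hox Uu) //; exact: YP].
Qed.

Lemma ampl_comp_closed S Z : Q S -> Y Z -> Y (ampl ox U S \o Z).
Proof.
case: Ystar => Yb Y0 YP YM YA QS YZ; apply: Yclosed.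
have [C C0 hC] := bounded_bound (Yb _ YZ).
have lip : op_lipschitz C (fun S => ampl ox U S \o Z).
  move=> S1 S2 b b1 b2 b0 h x /=.
  apply: le_trans (ampl_lipschitz Hox Uu b1 b2 b0 h _) _.
  by rewrite mul1r (mulrC C) -mulrA ler_wpM2l // ltW.
apply: (norm_closure_map (lspan_bounded Gb) _ C0 lip _ (QG QS)) => [T bT|T GT].
  by apply: bounded_op_comp; [exact: bounded_ampl | exact: Yb].
suff : lspan G `<=` [set T : H -> H | bounded_op T /\ Y (ampl ox U T \o Z)] by move=> /(_ _ GT)[].
apply: lspan_subset => [|S' GS']; last by split; [exact: Gb | exact: GY].
split=> [|c T1 T2 [b1 h1] [b2 h2]].
  split; first exact: bounded_op0.
  suff -> : ampl ox U (0 : H -> H) \o Z = 0 by exact: Y0.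
  have := ampl_lin Hox Uu (-1) (bounded_op0 H H) (bounded_op0 H H).
  rewrite !scaler0 addr0 => ->; apply/funext => x /=.
  by rewrite fun_linE scaleN1r addNr.
split; first exact: bounded_op_lin.
by rewrite (ampl_lin Hox Uu) //; exact: (YP c _ _ h1 h2).
Qed.

(** Right multiplication reduces to left multiplication, as [Z \o ampl S] is the adjoint of
    [ampl (adj S) \o adj Z]. *)
Lemma multiplier_adj S : bounded_op S -> (forall Z, Y Z -> Y (ampl ox U S \o Z)) ->
  (forall Z, Y Z -> Y (ampl ox U (adj S) \o Z)) -> cstar_multipliers Y (ampl ox U S).
Proof.
case: Ystar => Yb Y0 YP YM YA bS hS hS'; split; first exact: bounded_ampl.
move=> Z YZ; split; first exact: hS.
have := YA _ (hS' _ (YA _ YZ)).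
rewrite adj_comp; [|by apply: bounded_ampl => //; exact: bounded_adj|exact: Yb (YA _ YZ)].
rewrite (adjK (Yb _ YZ)) -ampl_adj //; last exact: bounded_adj.
by rewrite adjK.
Qed.

Lemma ampl_multiplier S : Q S -> cstar_multipliers Y (ampl ox U S).
Proof.
case: Qstar => Qb _ _ _ QA QS.
apply: multiplier_adj => [|Z|Z]; [exact: Qb|exact: ampl_comp_closed|].
by apply: ampl_comp_closed; exact: QA.
Qed.

Hypothesis Ynondeg :
  Y `<=` norm_closure (lspan [set ampl ox U S \o Z | S in G & Z in Y]).
Hypothesis GQ : G `<=` Q.

(** The usual extension of a non-degenerate homomorphism: [Y] is approximated by sums of
    [ampl S' \o Z'], and [ampl T \o ampl S' = ampl (T \o S')] with [T \o S'] in [Q]. Since [ampl] is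
    given on all operators, only its values have to be located. *)
Lemma ampl_multiplier_extension S :
  cstar_multipliers Q S -> cstar_multipliers Y (ampl ox U S).
Proof.
case: Ystar => Yb Y0 YP YM YA; case: Qstar => Qb _ _ _ QA.
have main T : cstar_multipliers Q T -> forall Z, Y Z -> Y (ampl ox U T \o Z).
  move=> [bT QT] Z YZ; apply: Yclosed; have bfT := bounded_ampl Hox Uu bT.
  have [C C0 hC] := bounded_bound bfT.
  have lip : op_lipschitz C (fun Z => ampl ox U T \o Z).
    move=> S1 S2 b b1 b2 b0 h x /=; rewrite -(linB (bounded_linear bfT)).
    by rewrite (le_trans (hC _)) // -mulrA ler_wpM2l // ltW.
  have sb : [set ampl ox U S \o Z | S in G & Z in Y] `<=` @bounded_op R HK HK.
    move=> _ [S' GS' [Z' YZ' <-]]; apply: bounded_op_comp; last exact: Yb.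
    by apply: bounded_ampl => //; exact: Gb.
  apply: (norm_closure_map (lspan_bounded sb) _ C0 lip _ (Ynondeg YZ)) => [W bW|W hW].
    exact: bounded_op_comp.
  suff : lspan [set ampl ox U S \o Z | S in G & Z in Y] `<=`
      [set W : HK -> HK | Y (ampl ox U T \o W)] by apply.
  apply: lspan_subset => [|_ [S' GS' [Z' YZ' <-]]] /=.
    split=> [|c T1 T2 h1 h2] /=.
      suff -> : ampl ox U T \o (0 : HK -> HK) = 0 by [].
      by apply/funext => x; rewrite /= fun0E (lin0 (bounded_linear bfT)).
    suff -> : ampl ox U T \o (c *: T1 + T2) = c *: (ampl ox U T \o T1) + (ampl ox U T \o T2).
      exact: YP.
    by apply/funext => x /=; rewrite !fun_linE (bounded_linear bfT).
  have -> : ampl ox U T \o (ampl ox U S' \o Z') = ampl ox U (T \o S') \o Z'.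
    by rewrite (ampl_comp Hox Uu bT (Gb GS')).
  by apply: ampl_comp_closed => //; case: (QT S' (GQ GS')).
move=> MS; have [bS QS] := MS; apply: multiplier_adj => //; first exact: main.
apply: main; split; first exact: bounded_adj.
move=> T QT; have [h1 h2] := QS _ (QA _ QT); split.
  by have := QA _ h2; rewrite adj_comp ?adjK //; [exact: Qb|exact: bounded_adj (Qb _ QT)].
by have := QA _ h1; rewrite adj_comp ?adjK //; [exact: Qb|exact: bounded_adj (Qb _ QT)].
Qed.

End Multipliers.

(** * Multiplier Hopf *-algebras *)

Section TensorMaps.
Variables (K : comNzRingType) (U V U' V' : lmodType K).
Variables (f : U -> U') (g : V -> V').
Hypotheses (lf : linear f) (lg : linear g).

Lemma tmap_pure u v : tmap f g (u ⊗ v) = f u ⊗ g v.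
Proof. exact: tlift_pureP (tmap_bilinear lf lg). Qed.
Lemma tmap_linear : linear (tmap f g).
Proof. exact: tlift_linearP (tmap_bilinear lf lg). Qed.
End TensorMaps.

Section AlgebraSums.
Variables (C : numClosedFieldType) (B : starAlgType C).
Lemma amul_suml (I : Type) (s : seq I) (F : I -> B) x :
  (\sum_(i <- s) F i) ∙ x = \sum_(i <- s) F i ∙ x.
Proof. exact: (lin_sum (@linear_amulr _ _ x)). Qed.
Lemma amul_sumr (I : Type) (s : seq I) (F : I -> B) x :
  x ∙ (\sum_(i <- s) F i) = \sum_(i <- s) x ∙ F i.
Proof. exact: (lin_sum (@linear_amull _ _ x)). Qed.
End AlgebraSums.

Section HopfAlgebra.
Variables (C : numClosedFieldType) (A : starAlgType C) (h : multiplier_hopf A).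
Implicit Types (a b c d x : A) (t z : tensor A A).

Lemma Delta_linear1 a : linear (Delta h a).1.
Proof. by case: (Delta_multiplier h a) => [[]]. Qed.
Lemma Delta_mulr a z t : (Delta h a).1 (z ∙ t) = (Delta h a).1 z ∙ t.
Proof. by case: (Delta_multiplier h a). Qed.
Lemma Delta_balanced a z t : z ∙ (Delta h a).1 t = (Delta h a).2 z ∙ t.
Proof. by case: (Delta_multiplier h a). Qed.

Lemma hopfT1_mull a b t : hopfT1 h (a ⊗ b) ∙ t = (Delta h a).1 (tmap id (amul b) t).
Proof. by have /(congr1 (fun m => m.1 t)) := hopfT1E h a b. Qed.
Lemma hopfT1_mulr a b t : t ∙ hopfT1 h (a ⊗ b) = tmap id (amul^~ b) ((Delta h a).2 t).
Proof. by have /(congr1 (fun m => m.2 t)) := hopfT1E h a b. Qed.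
Lemma hopfT2_mull a b t : hopfT2 h (a ⊗ b) ∙ t = tmap (amul a) id ((Delta h b).1 t).
Proof. by have /(congr1 (fun m => m.1 t)) := hopfT2E h a b. Qed.

Lemma mul_pureE a b c d : (a ⊗ b) ∙ (c ⊗ d) = (a ∙ c) ⊗ (b ∙ d) :> tensor A A.
Proof. exact: tmul_pureE. Qed.

(** On [p ⊗ q] this is [Delta(a p)(1 ⊗ q) = Delta(a) Delta(p)(1 ⊗ q)]. The factor [z] is kept and
    removed only in the Hilbert space, by [Lam2_mul_inj]. *)
Lemma mul_hopfT1_act a t z :
  z ∙ hopfT1 h (tmap (amul a) id t) = z ∙ (Delta h a).1 (hopfT1 h t).
Proof.
elim/tensor_ind: t => [p q||t t' ht ht'].
- rewrite (tmap_pure (@linear_amull _ _ a) (@linear_id _ _)) hopfT1_mulr.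
  by rewrite Delta_balanced hopfT1_mulr DeltaM.
- rewrite (lin0 (tmap_linear (@linear_amull _ _ a) (@linear_id _ _))).
  by rewrite !linear0 (lin0 (Delta_linear1 a)).
- rewrite (linD (tmap_linear (@linear_amull _ _ a) (@linear_id _ _))).
  by rewrite !linearD (linD (Delta_linear1 a)) !linearDr /= ht ht'.
Qed.

(** Both sides are [(u ⊗ 1) Delta(v) (1 ⊗ c)] applied to [x ⊗ d]. *)
Lemma hopfT2_mull_pure u v x c d : hopfT2 h (u ⊗ v) ∙ (x ⊗ (c ∙ d)) =
  \sum_(p <- repr (hopfT1 h (v ⊗ c))) (u ∙ (p.1 ∙ x)) ⊗ (p.2 ∙ d).
Proof.
rewrite hopfT2_mull.
have -> : x ⊗ (c ∙ d) = tmap id (amul c) (x ⊗ d).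
  by rewrite (tmap_pure (@linear_id _ _) (@linear_amull _ _ c)).
rewrite -hopfT1_mull {1}(tensorE (hopfT1 h (v ⊗ c))).
rewrite amul_suml.
rewrite (lin_sum (tmap_linear (@linear_amull _ _ u) (@linear_id _ _))).
apply: eq_bigr => p _; rewrite mul_pureE.
by rewrite (tmap_pure (@linear_amull _ _ u) (@linear_id _ _)).
Qed.

Variable psi : {scalar A}.

Let sl : tensor A A -> A := tlift (fun x y => psi y *: x).
Let sl_bilinear : bilinear_for *:%R *:%R (fun x y : A => psi y *: x).
Proof.
split=> [y c x x'|x c y y'] /=; first by rewrite scalerDr !scalerA mulrC.
by rewrite linearP /= scalerDl scalerA.
Qed.
Let slL : linear sl := tlift_linearP sl_bilinear.
Let slE x y : sl (x ⊗ y) = psi y *: x := tlift_pureP x y sl_bilinear.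
Let sr : tensor A A -> A := tlift (fun x y => psi x *: y).
Let sr_bilinear : bilinear_for *:%R *:%R (fun x y : A => psi x *: y).
Proof.
split=> [y c x x'|x c y y'] /=; first by rewrite linearP /= scalerDl scalerA.
by rewrite scalerDr !scalerA mulrC.
Qed.

Let srL : linear sr := tlift_linearP sr_bilinear.
Let srE x y : sr (x ⊗ y) = psi x *: y := tlift_pureP x y sr_bilinear.

(* Both sides of (a (x) b)(1 (x) c) = sum (u (x) 1) T1(v (x) c), where
   a (x) b = T2(sum u (x) v), are applied to x (x) d and sliced with psi. *)
Lemma slice_hopfT2 a b c d : exists s : seq (A * A),
  (forall x, psi (b ∙ (c ∙ d)) *: (a ∙ x) = (\sum_(p <- s) p.1 ∙ p.2) ∙ x) /\
  ((forall a' b' c', psi (a' ∙ (b' ∙ c')) = 0) ->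
   forall x, psi (a ∙ x) *: (b ∙ (c ∙ d)) = 0).
Proof.
have [T2i _ T2K] := hopfT2_bij h.
set t := T2i (a ⊗ b); have tE : a ⊗ b = \sum_(p <- repr t) hopfT2 h (p.1 ⊗ p.2).
  by rewrite -linear_sum /= -tensorE T2K.
(* [K v] is [Delta(v)(1 ⊗ c)] with the functional [y |-> psi (y ∙ d)] applied to its second leg. *)
pose K v := \sum_(q <- repr (hopfT1 h (v ⊗ c))) psi (q.2 ∙ d) *: q.1.
have E x : (a ∙ x) ⊗ (b ∙ (c ∙ d)) = \sum_(p <- repr t)
    \sum_(q <- repr (hopfT1 h (p.2 ⊗ c))) (p.1 ∙ (q.1 ∙ x)) ⊗ (q.2 ∙ d).
  rewrite -mul_pureE tE amul_suml.
  by apply: eq_bigr => p _; rewrite hopfT2_mull_pure.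
exists [seq (p.1, K p.2) | p <- repr t]; split=> [x|psi0 x].
  have := congr1 sl (E x); rewrite slE => ->.
  rewrite (lin_sum slL) big_map.
  rewrite amul_suml; apply: eq_bigr => p _.
  rewrite (lin_sum slL) -amulA.
  rewrite amul_suml amul_sumr; apply: eq_bigr => q _.
  by rewrite slE linearZl_LR linearZr_LR.
have := congr1 sr (E x); rewrite srE => ->.
rewrite (lin_sum srL) big1 // => p _.
rewrite (lin_sum srL) big1 // => q _.
by rewrite srE psi0 scale0r.
Qed.

(** If [psi] is nonzero on some triple product, slicing writes a nonzero multiple of [a] as a sum of
    products. Otherwise the second half of [slice_hopfT2], at [x0] and [y0], makes all triple
    products vanish, so [A = 0] by non-degeneracy, against [psi (x0 ∙ y0) != 0]. *)
Lemma algebra_idempotent x0 y0 : psi (x0 ∙ y0) != 0 ->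
  forall a, exists s : seq (A * A), a = \sum_(p <- s) p.1 ∙ p.2.
Proof.
move=> psi0 a.
case: (pselect (exists b c d, psi (b ∙ (c ∙ d)) != 0)) => [[b [c [d n0]]]|nex].
  have [s [hs _]] := slice_hopfT2 a b c d.
  have e : psi (b ∙ (c ∙ d)) *: a = \sum_(p <- s) p.1 ∙ p.2.
    apply/eqP; rewrite -subr_eq0; apply/eqP; apply: (nondegl h) => x.
    by rewrite linearBl /= -hs linearZl_LR subrr.
  exists [seq ((psi (b ∙ (c ∙ d)))^-1 *: p.1, p.2) | p <- s].
  rewrite big_map /= -[a](scalerK n0) e scaler_sumr; apply: eq_bigr => p _.
  by rewrite linearZl_LR.
have psi3 b c d : psi (b ∙ (c ∙ d)) = 0.
  by apply/eqP/negPn/negP => n0; apply: nex; exists b, c, d.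
have mul0 b : b = 0.
  apply: (nondegl h) => c; apply: (nondegl h) => d; rewrite -amulA.
  have [s [_ /(_ psi3 y0)/eqP]] := slice_hopfT2 x0 b c d.
  by rewrite scaler_eq0 (negPf psi0) => /eqP.
by move: psi0; rewrite (mul0 (x0 ∙ y0)) linear0 eqxx.
Qed.

End HopfAlgebra.

(** * The representation on the Hilbert space of psi *)

Section Representation.
Variables (R : realType) (A : starAlgType R[i]) (h : multiplier_hopf A).
Variables (psi : {scalar A}) (H : hilbertType R) (Lam : {linear A -> H}).
Hypothesis HLam : hilbert_completion psi Lam.
Variable act : A -> H -> H.
Hypothesis act_bounded : forall a, bounded_op (act a).
Hypothesis actE : forall a x, act a (Lam x) = Lam (a ∙ x).
Variables (HH : hilbertType R) (ox : H -> H -> HH).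
Hypothesis Hox : hilbert_tensor ox.
Variable V : HH -> HH.
Hypothesis V_unitary : unitary_op V.
Hypothesis VE : forall x x', V (ox (Lam x) (Lam x')) = Lam2 ox Lam (hopfT1 h (x ⊗ x')).

Lemma inner_Lam a a' : inner (Lam a') (Lam a) = psi (star a ∙ a').
Proof. by case: HLam. Qed.
Lemma dense_Lam : closure (range Lam) = setT.
Proof. by case: HLam. Qed.

Lemma act_linear : linear act.
Proof.
move=> c a b; apply: (bounded_ext_dense (act_bounded _) _ dense_Lam).
  exact: bounded_op_lin.
by move=> _ [x _ <-]; rewrite fun_linE !actE linearPl linearP.
Qed.

Lemma act_comp a b : act (a ∙ b) = act a \o act b.
Proof.
apply: (bounded_ext_dense (act_bounded _) _ dense_Lam).
  exact: bounded_op_comp.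
by move=> _ [x _ <-]; rewrite /= !actE amulA.
Qed.

Lemma act_adj a : adj (act a) = act (star a).
Proof.
apply: (bounded_inner_ext (bounded_adj (act_bounded a)) (act_bounded _) dense_Lam dense_Lam).
move=> _ _ [x _ <-] [y _ <-]; rewrite (is_adjoint_sym (adjP (act_bounded a))).
by rewrite !actE !inner_Lam starM amulA.
Qed.

Lemma range_act_bounded : range act `<=` @bounded_op R H H.
Proof. by move=> _ [a _ <-]. Qed.

Lemma star_range_act : star_subalgebra (range act).
Proof.
split=> [|| c _ _ [a _ <-] [b _ <-]|_ _ [a _ <-] [b _ <-]|_ [a _ <-]].
- exact: range_act_bounded.
- by exists 0 => //; exact: (lin0 act_linear).
- by exists (c *: a + b) => //; exact: act_linear.
- by exists (a ∙ b) => //; exact: act_comp.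
- by exists (star a) => //; rewrite act_adj.
Qed.

(* If psi vanishes on A A then the inner product, hence H, is zero. *)
Lemma idempotent_or_trivial :
  (forall a, exists s : seq (A * A), a = \sum_(p <- s) p.1 ∙ p.2) \/ (forall x : H, x = 0).
Proof.
case: (pselect (exists x y, psi (x ∙ y) != 0)) => [[x [y xy]]|n].
  left=> a; have := @algebra_idempotent _ A h psi x y xy a.
  by [].
right=> x; apply: (inner_eq0_dense dense_Lam) => _ [a _ <-].
suff -> : Lam a = 0 by exact: ip0r (inner_semi _) _.
apply: inner_eq0; rewrite inner_Lam; apply/eqP/negPn/negP => e.
by apply: n; exists (star a), a.
Qed.

(** Serves to split a factor off [act a], where a unital algebra would simply write [a] as [a] times
    1. *)
Definition act_products : set (H -> H) :=
  [set S \o T | S in range act & T in range act].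

Lemma lspan_act_products a : lspan act_products (act a).
Proof.
case: idempotent_or_trivial => [/(_ a)[s ->]|H0].
  rewrite (lin_sum act_linear).
  rewrite -(eq_bigr _ (fun p _ => scale1r (act (p.1 ∙ p.2)))).
  apply: subspace_sum; first exact: subspace_lspan.
  move=> p; apply: sub_lspan; exists (act p.1); first by exists p.1.
  by exists (act p.2); [exists p.2 | rewrite act_comp].
have -> : act a = 0 by apply/funext => x; rewrite fun0E; exact: H0.
by case: (subspace_lspan act_products).
Qed.

Lemma nondegenerate_act : nondegenerate (range act).
Proof.
apply/denseP => x e e0; have [_ [a _ <-] xa] := (denseP _).1 dense_Lam x e e0.
exists (Lam a) => //.
case: idempotent_or_trivial => [/(_ a)[s ->]|H0]; last first.
  by rewrite (H0 (Lam a)); case: (subspace_lspan [set T x | T in range act & x in [set: H]]).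
rewrite linear_sum /= -(eq_bigr _ (fun p _ => scale1r (Lam (p.1 ∙ p.2)))).
apply: subspace_sum; first exact: subspace_lspan.
move=> p; apply: sub_lspan; exists (act p.1); first by exists p.1.
by exists (Lam p.2).
Qed.

Definition tensor_act : tensor A A -> HH -> HH := tlift (fun a b => op_tensor ox (act a) (act b)).

Lemma act2_bilinear : bilinear_for *:%R *:%R (fun a b => op_tensor ox (act a) (act b)).
Proof.
split=> [b c a a'|a c b b'] /=; rewrite act_linear.
  by rewrite (op_tensor_linl Hox).
by rewrite (op_tensor_linr Hox).
Qed.

Lemma act2_linear : linear tensor_act.
Proof. exact: tlift_linearP act2_bilinear. Qed.

Lemma act2_pure a b : tensor_act (a ⊗ b) = op_tensor ox (act a) (act b).
Proof. exact: tlift_pureP act2_bilinear. Qed.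

Lemma act2_sub (D : set (HH -> HH)) : subspace D ->
  (forall a b, D (op_tensor ox (act a) (act b))) -> forall t, D (tensor_act t).
Proof.
move=> [D0 DP] hD; elim/tensor_ind => [a b||t t' ht ht'].
- by rewrite act2_pure.
- by rewrite (lin0 act2_linear).
- by rewrite (linD act2_linear) -[tensor_act t]scale1r; exact: DP.
Qed.

Lemma bounded_act2 t : bounded_op (tensor_act t).
Proof.
apply: (act2_sub (D := @bounded_op R HH HH)); first exact: subspace_bounded.
by move=> a b; exact: (bounded_op_tensor Hox).
Qed.

Lemma lspan_pure_range_act : lspan (pure_ops ox (range act) (range act)) `<=` range tensor_act.
Proof.
apply: lspan_subset.
  split; first by exists 0 => //; exact: (lin0 act2_linear).
  by move=> c _ _ [t _ <-] [t' _ <-]; exists (c *: t + t') => //; exact: act2_linear.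
by move=> _ [_ [a _ <-] [_ [b _ <-] <-]]; exists (a ⊗ b) => //; exact: act2_pure.
Qed.

Let L2 := Lam2 ox Lam.

Lemma Lam2_bilinear : bilinear_for *:%R *:%R (fun x x' => ox (Lam x) (Lam x')).
Proof.
split=> [b c a a'|a c b b'] /=; rewrite linearP.
  exact: (oxl_linear Hox).
exact: (oxr_linear Hox).
Qed.

Lemma Lam2_linear : linear L2.
Proof. exact: tlift_linearP Lam2_bilinear. Qed.

Lemma Lam2_pure x y : L2 (x ⊗ y) = ox (Lam x) (Lam y).
Proof. exact: tlift_pureP Lam2_bilinear. Qed.

Let L20 : L2 0 = 0 := lin0 Lam2_linear.
Let L2D t t' : L2 (t + t') = L2 t + L2 t' := linD Lam2_linear t t'.

Lemma bounded_ext_Lam2 (K : hilbertType R) (F G : HH -> K) :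
  bounded_op F -> bounded_op G -> (forall t, F (L2 t) = G (L2 t)) -> F = G.
Proof.
move=> bF bG FG; apply: (bounded_ext_ox Hox bF bG dense_Lam dense_Lam).
by move=> _ _ [x _ <-] [y _ <-]; rewrite -Lam2_pure.
Qed.

Let psi2 : tensor A A -> R[i]^o := tlift (fun x y => psi x * psi y : R[i]^o).

Lemma inner_Lam2 t c d : inner (L2 t) (ox (Lam c) (Lam d)) = psi2 (star (c ⊗ d) ∙ t).
Proof.
have pB : bilinear_for *:%R *:%R (fun x y : A => psi x * psi y : R[i]^o).
  split=> [y k x x'|x k y y'] /=; rewrite linearP /=.
    by rewrite mulrDl -mulrA.
  by rewrite mulrDr mulrCA.
have pL : linear psi2 := tlift_linearP pB.
elim/tensor_ind: t => [x y||t t' ht ht'].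
- rewrite Lam2_pure (inner_ox Hox) !inner_Lam tstar_pureE mul_pureE.
  by rewrite /psi2 (tlift_pureP _ _ pB).
- by rewrite L20 (ip0l (inner_semi _)) linear0r (lin0 pL).
- by rewrite L2D (ipDl (inner_semi _)) linearDr (linD pL) ht ht'.
Qed.

(** The inner product of [L2 s] with [Lam c ⊗ Lam d] is [psi ⊗ psi] evaluated at [star (c ⊗ d) ∙ s],
    so [L2 s] depends only on the products [z ∙ s]. *)
Lemma Lam2_mul_inj s s' : (forall z, z ∙ s = z ∙ s') -> L2 s = L2 s'.
Proof.
move=> hs; apply/eqP; rewrite -subr_eq0; apply/eqP.
apply: (ox_inner_eq0 Hox dense_Lam dense_Lam) => _ _ [x _ <-] [y _ <-].
by rewrite (ipBl (inner_semi _)) !inner_Lam2 hs subrr.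
Qed.

Lemma act2_Lam2 t s : tensor_act t (L2 s) = L2 (t ∙ s).
Proof.
elim/tensor_ind: t => [a b||t t' ht ht'].
- have bab := bounded_act2 (a ⊗ b).
  elim/tensor_ind: s => [x y||s s' hs hs'].
  + by rewrite act2_pure mul_pureE !Lam2_pure (op_tensorE Hox) // !actE.
  + by rewrite L20 (lin0 (bounded_linear bab)) linear0r L20.
  + by rewrite L2D (linD (bounded_linear bab)) linearDr L2D hs hs'.
- by rewrite (lin0 act2_linear) linear0l L20.
- by rewrite (linD act2_linear) linearDl L2D -ht -ht'.
Qed.

Lemma op_left_Lam2 a s : op_tensor ox (act a) id (L2 s) = L2 (tmap (amul a) id s).
Proof.
have b := bounded_op_tensor Hox (act_bounded a) (bounded_op_id H).
have tl := tmap_linear (@linear_amull _ _ a) (@linear_id _ A).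
elim/tensor_ind: s => [x y||s s' hs hs'].
- rewrite (tmap_pure (@linear_amull _ _ a) (@linear_id _ _)) !Lam2_pure.
  by rewrite (op_tensorE Hox) ?actE //; exact: bounded_op_id.
- by rewrite L20 (lin0 (bounded_linear b)) (lin0 tl) L20.
- by rewrite L2D (linD (bounded_linear b)) (linD tl) L2D hs hs'.
Qed.

Lemma op_right_Lam2 a s : op_tensor ox id (act a) (L2 s) = L2 (tmap id (amul a) s).
Proof.
have b := bounded_op_tensor Hox (bounded_op_id H) (act_bounded a).
have tl := tmap_linear (@linear_id _ A) (@linear_amull _ _ a).
elim/tensor_ind: s => [x y||s s' hs hs'].
- rewrite (tmap_pure (@linear_id _ _) (@linear_amull _ _ a)) !Lam2_pure.
  by rewrite (op_tensorE Hox) ?actE //; exact: bounded_op_id.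
- by rewrite L20 (lin0 (bounded_linear b)) (lin0 tl) L20.
- by rewrite L2D (linD (bounded_linear b)) (linD tl) L2D hs hs'.
Qed.

Let bV : bounded_op V. Proof. by case: V_unitary. Qed.

Lemma V_Lam2 t : V (L2 t) = L2 (hopfT1 h t).
Proof.
elim/tensor_ind: t => [x y||s s' hs hs'].
- by rewrite Lam2_pure VE.
- by rewrite L20 (lin0 (bounded_linear bV)) linear0 L20.
- by rewrite L2D (linD (bounded_linear bV)) linearD L2D hs hs'.
Qed.

(** Surjectivity of [T1] gives [s = T1(t)], so [adj V] sends [L2 s] to [L2 t]; then [V] sends
    [(a ⊗ 1) t] to [T1((a ⊗ 1) t)], which multiplicativity of [Delta] identifies with
    [Delta(a) s]. *)
Lemma ampl_act_Lam2 a s : ampl ox V (act a) (L2 s) = L2 ((Delta h a).1 s).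
Proof.
have [T1i _ T1K] := hopfT1_bij h.
rewrite -[s]T1K; set t := T1i s.
rewrite /ampl /= -V_Lam2.
have -> : adj V (V (L2 t)) = L2 t by case: V_unitary => _ /(congr1 (@^~ (L2 t))).
rewrite op_left_Lam2 V_Lam2; apply: Lam2_mul_inj => z.
exact: mul_hopfT1_act.
Qed.

Lemma ampl_act_hopfT1 a b :
  ampl ox V (act a) \o op_tensor ox id (act b) = tensor_act (hopfT1 h (a ⊗ b)).
Proof.
apply: bounded_ext_Lam2; [|exact: bounded_act2|].
  apply: bounded_op_comp; first exact: bounded_ampl.
  by apply: (bounded_op_tensor Hox) => //; exact: bounded_op_id.
by move=> t; rewrite /= op_right_Lam2 ampl_act_Lam2 act2_Lam2 hopfT1_mull.
Qed.

Lemma act_ampl_hopfT2 a b :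
  op_tensor ox (act a) id \o ampl ox V (act b) = tensor_act (hopfT2 h (a ⊗ b)).
Proof.
apply: bounded_ext_Lam2; [|exact: bounded_act2|].
  apply: bounded_op_comp; last exact: bounded_ampl.
  by apply: (bounded_op_tensor Hox) => //; exact: bounded_op_id.
by move=> t; rewrite /= ampl_act_Lam2 op_left_Lam2 act2_Lam2 hopfT2_mull.
Qed.

Lemma ampl_act_act2 a t : ampl ox V (act a) \o tensor_act t = tensor_act ((Delta h a).1 t).
Proof.
apply: bounded_ext_Lam2; [|exact: bounded_act2|].
  by apply: bounded_op_comp; [exact: bounded_ampl | exact: bounded_act2].
by move=> s; rewrite /= !act2_Lam2 ampl_act_Lam2 Delta_mulr.
Qed.

End Representation.

(** * The two coproducts *)

Section MainTheorem.
Variables (R : realType) (A : starAlgType R[i]) (h : multiplier_hopf A).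
Variables (psi : {scalar A}) (H : hilbertType R) (Lam : {linear A -> H}).
Hypothesis HLam : hilbert_completion psi Lam.
Variable act : A -> H -> H.
Hypothesis act_bounded : forall a, bounded_op (act a).
Hypothesis actE : forall a x, act a (Lam x) = Lam (a ∙ x).
Variables (HH : hilbertType R) (ox : H -> H -> HH).
Hypothesis Hox : hilbert_tensor ox.
Variables (HHH : hilbertType R) (oxl : HH -> H -> HHH) (oxr : H -> HH -> HHH).
Hypotheses (Hoxl : hilbert_tensor oxl) (Hoxr : hilbert_tensor oxr).
Hypothesis oxA : forall x y z, oxl (ox x y) z = oxr x (ox y z).
Variable V : HH -> HH.
Hypothesis V_unitary : unitary_op V.
Hypothesis VE : forall x x', V (ox (Lam x) (Lam x')) = Lam2 ox Lam (hopfT1 h (x ⊗ x')).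

Let P := norm_closure (range act).
Let M := weak_closure (range act).
Let Delta1 := ampl ox V.
Let MM := vn_tensor ox M M.
Let PP := cstar_tensor ox P P.
Local Notation act2 := (tensor_act act ox).

Let bid : bounded_op (@id H) := bounded_op_id H.
Let bid2 : bounded_op (@id HH) := bounded_op_id HH.
Let X0b : range act `<=` @bounded_op R H H := range_act_bounded act_bounded.
Let X0s : star_subalgebra (range act) := star_range_act HLam act_bounded actE.
Let X0n : nondegenerate (range act) := nondegenerate_act h HLam actE.
Let Pb : P `<=` @bounded_op R H H := @norm_closure_bounded _ _ _.
Let Mb : M `<=` @bounded_op R H H := @weak_closure_bounded _ _ _.
Let Ps : star_subalgebra P := star_norm_closure X0s.
Let Ms : star_subalgebra M := star_weak_closure X0s.
Let X0P : range act `<=` P := sub_norm_closure X0b.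
Let X0M : range act `<=` M := sub_weak_closure X0b.
Let PM : P `<=` M := @norm_sub_weak_closure _ _ _.
Let actP a : P (act a). Proof. by apply: X0P; exists a. Qed.
Let bD S : bounded_op S -> bounded_op (Delta1 S) := bounded_ampl Hox V_unitary (S := S).
Let bV : bounded_op V. Proof. by case: V_unitary. Qed.

Let M_id : M id.
Proof.
apply: (bicommutant_sub_weak_closure X0s X0n).
by split; [exact: bounded_op_id | move=> Z []].
Qed.

Lemma von_neumann_M : von_neumann_algebra M.
Proof. by split; [exact: Ms | exact: M_id | exact: weak_closure_idem]. Qed.

Lemma cstar_P : cstar_algebra P.
Proof.
split=> //; first exact: norm_closure_idem.
apply/seteqP; split=> // x _; have : closure (lspan [set T x | T in range act & x in [set: H]]) x.
  by rewrite X0n.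
apply: closure_subset; apply: lspanS => _ [S XS [y _ <-]].
by exists S; [exact: X0P | exists y].
Qed.

Let MMs : star_subalgebra (lspan (pure_ops ox M M)) := star_op_tensor Hox Ms Ms.
Let pMMb : pure_ops ox M M `<=` @bounded_op R HH HH := pure_ops_bounded Hox Mb Mb.
Let MMb : MM `<=` @bounded_op R HH HH := @weak_closure_bounded _ _ _.
Let PPb : PP `<=` @bounded_op R HH HH := @norm_closure_bounded _ _ _.
Let PPs : star_subalgebra PP := star_norm_closure (star_op_tensor Hox Ps Ps).
Let PPclosed : norm_closure PP `<=` PP := @norm_closure_idem _ _ _.
Let pPPb : pure_ops ox P P `<=` @bounded_op R HH HH := pure_ops_bounded Hox Pb Pb.
Let pPP : pure_ops ox P P `<=` PP.
Proof.
by move=> T pT; apply: (sub_norm_closure (lspan_bounded pPPb)); exact: sub_lspan.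
Qed.

Let act2_MM t : lspan (pure_ops ox M M) (act2 t).
Proof.
apply: (act2_sub HLam act_bounded actE Hox) => [|a b]; first exact: subspace_lspan.
apply: sub_lspan; exists (act a); first by apply: X0M; exists a.
by exists (act b) => //; apply: X0M; exists b.
Qed.

Let act2_PP t : PP (act2 t).
Proof.
apply: (act2_sub HLam act_bounded actE Hox) => [|a b].
  by apply: norm_closure_lin; exact: subspace_lspan.
by apply: pPP; exists (act a) => //; exists (act b).
Qed.

Let PP_act2 : PP `<=` norm_closure (range act2).
Proof.
move=> Z /(cstar_tensor_norm_closure Hox X0b X0b); apply: norm_closureS.
exact: (lspan_pure_range_act HLam act_bounded actE Hox).
Qed.

Let range_act2_bounded : range act2 `<=` @bounded_op R HH HH.
Proof. by move=> _ [t _ <-]; exact: (bounded_act2 HLam act_bounded actE Hox). Qed.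

Let act2_PP_closure : norm_closure (range act2) `<=` PP.
Proof.
move=> Z hZ; apply: PPclosed; apply: norm_closureS hZ => _ [t _ <-].
exact: act2_PP.
Qed.

Let D_T1 a b : act2 (hopfT1 h (a ⊗ b)) = Delta1 (act a) \o op_tensor ox id (act b).
Proof. exact/esym/(ampl_act_hopfT1 HLam act_bounded actE Hox V_unitary VE). Qed.
Let D_T2 a b : act2 (hopfT2 h (a ⊗ b)) = op_tensor ox (act a) id \o Delta1 (act b).
Proof. exact/esym/(act_ampl_hopfT2 HLam act_bounded actE Hox V_unitary VE). Qed.
Let D_act2 a t : Delta1 (act a) \o act2 t = act2 ((Delta h a).1 t).
Proof. exact: (ampl_act_act2 HLam act_bounded actE Hox V_unitary VE). Qed.

(** For [Z] commuting with the image of [A ⊗ A], both [b ⊗ c] and [Delta(a)(b ⊗ c)] commute with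
    [Z], so [Z Delta(a)] and [Delta(a) Z] agree after multiplication by [b ⊗ c], which
    non-degeneracy cancels. *)
Lemma Delta1_MM S : M S -> MM (Delta1 S).
Proof.
apply: (ampl_weak_closure Hox V_unitary X0b MMs).
  apply: nondegenerate_id; apply: sub_lspan; exists id => //; exists id => //.
  exact: op_tensor_id.
move=> _ [a _ <-]; split; first by apply: bD.
move=> Z [bZ ZMM].
apply: (bounded_ext_pure_ops Hox X0b X0b X0n X0n); try by apply: bounded_op_comp => //; exact: bD.
move=> _ _ [b _ <-] [c _ <-].
have E t : Z \o act2 t = act2 t \o Z by rewrite (ZMM _ (act2_MM t)).
have := E ((Delta h a).1 (b ⊗ c)); rewrite -D_act2 => e.
rewrite -(act2_pure HLam act_bounded actE Hox b c); apply/funext => z.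
have /= -> := congr1 (@^~ z) e.
by have /= -> := congr1 (@^~ z) (E (b ⊗ c)).
Qed.

Lemma Delta1_mult S : P S -> cstar_multipliers PP (Delta1 S).
Proof.
apply: (ampl_multiplier Hox V_unitary (G := range act) Ps _ X0b PPs PPclosed).
  by apply: norm_closureS; exact: sub_lspan.
move=> _ Z [a _ <-] /PP_act2 hZ; apply: act2_PP_closure.
apply: (norm_closure_comp (X := [set Delta1 (act a)]) range_act2_bounded _ _ hZ).
  by move=> _ _ -> [t _ <-]; exists ((Delta h a).1 t) => //; rewrite D_act2.
by apply: sub_norm_closure => // _ ->; exact: bD.
Qed.

Let DPP : set (HH -> HH) := [set Delta1 S \o Z | S in P & Z in PP].

Let DPPb : DPP `<=` @bounded_op R HH HH.
Proof.
by move=> _ [S PS [Z PZ <-]]; apply: bounded_op_comp; [apply: bD; exact: Pb | exact: PPb].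
Qed.

(** [T1] is onto, but [1 ⊗ b] is in general not in [PP], so [Delta(a)(1 ⊗ b)] is not yet of the
    required form. For [a = p ∙ q] it equals [Delta(p)] times [T1(q ⊗ b)], whose second factor is in
    [PP]; such products span [A]. *)
Lemma Delta1_nondegenerate : PP `<=` norm_closure (lspan DPP).
Proof.
move=> Z /PP_act2; apply: norm_closureS => _ [t _ <-].
have [T1i _ T1K] := hopfT1_bij h; rewrite -[t]T1K.
have [sp0 spP] := subspace_lspan DPP.
have a2l := act2_linear HLam act_bounded actE Hox.
elim/tensor_ind: (T1i t) => [a b||u u' hu hu'].
- rewrite D_T1.
  have bb : bounded_op (op_tensor ox id (act b)) by exact: (bounded_op_tensor Hox).
  suff : lspan (act_products act) `<=`
      [set S : H -> H | bounded_op S /\ lspan DPP (Delta1 S \o op_tensor ox id (act b))].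
    by move=> /(_ _ (lspan_act_products h HLam act_bounded actE a))[].
  apply: lspan_subset => [|_ [_ [p _ <-] [_ [q _ <-] <-]]].
    split=> [|c S1 S2 [b1 h1] [b2 h2]].
      split; first exact: bounded_op0.
      suff -> : Delta1 (0 : H -> H) \o op_tensor ox id (act b) = 0 by [].
      have := ampl_lin Hox V_unitary (-1) (bounded_op0 H H) (bounded_op0 H H).
      rewrite !scaler0 addr0 /Delta1 => ->; apply/funext => x.
      by rewrite /= fun_linE scaleN1r addNr.
    split; first exact: bounded_op_lin.
    by rewrite /Delta1 (ampl_lin Hox V_unitary) //; exact: (spP c _ _ h1 h2).
  split; first exact: bounded_op_comp.
  apply: sub_lspan; exists (act p) => //; exists (act2 (hopfT1 h (q ⊗ b))) => //.
  rewrite D_T1.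
  by rewrite /Delta1 (ampl_comp Hox V_unitary).
- by rewrite linear0 (lin0 a2l).
- by rewrite linearD (linD a2l) -[act2 _]scale1r; exact: spP.
Qed.

Lemma Delta1_tensor_right S T : P S -> P T -> PP (Delta1 S \o op_tensor ox id T).
Proof.
move=> PS PT; apply: act2_PP_closure.
have bT := Pb PT.
apply: (norm_closure_comp (X := [set Delta1 S | S in range act])
  (Y := [set op_tensor ox id T | T in range act])).
- by move=> _ [_ [a _ <-] <-]; exact: (bounded_op_tensor Hox).
- move=> _ _ [_ [a _ <-] <-] [_ [b _ <-] <-]; by exists (hopfT1 h (a ⊗ b)).
- apply: (norm_closure_map X0b _ ltr01 (ampl_lipschitz Hox V_unitary) _ PS) => // S' XS'.
  by exists S'.
- have [C C0 hC] := op_tensor_lipschitzr Hox bid.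
  apply: (norm_closure_map X0b _ C0 hC _ PT) => [T' bT'|T' XT'].
    exact: (bounded_op_tensor Hox).
  by exists T'.
Qed.

Lemma Delta1_tensor_left S T : P S -> P T -> PP (op_tensor ox S id \o Delta1 T).
Proof.
move=> PS PT; apply: act2_PP_closure.
apply: (norm_closure_comp (X := [set op_tensor ox S id | S in range act])
  (Y := [set Delta1 S | S in range act])).
- by move=> _ [_ [a _ <-] <-]; exact: bD.
- move=> _ _ [_ [a _ <-] <-] [_ [b _ <-] <-]; by exists (hopfT2 h (a ⊗ b)).
- have [C C0 hC] := op_tensor_lipschitzl Hox bid.
  apply: (norm_closure_map X0b _ C0 hC _ PS) => [T' bT'|T' XT'].
    exact: (bounded_op_tensor Hox).
  by exists T'.
- apply: (norm_closure_map X0b _ ltr01 (ampl_lipschitz Hox V_unitary) _ PT) => // S' XS'.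
  by exists S'.
Qed.

Lemma op_tensorA S T U : bounded_op S -> bounded_op T -> bounded_op U ->
  op_tensor oxl (op_tensor ox S T) U = op_tensor oxr S (op_tensor ox T U).
Proof.
move=> bS bT bU.
have bST := bounded_op_tensor Hox bS bT; have bTU := bounded_op_tensor Hox bT bU.
have bl := bounded_op_tensor Hoxl bST bU; have br := bounded_op_tensor Hoxr bS bTU.
apply: (bounded_ext_pure Hoxl bl br) => w z.
have bz := bounded_oxl Hoxl z.
suff e : op_tensor oxl (op_tensor ox S T) U \o oxl^~ z =
    op_tensor oxr S (op_tensor ox T U) \o oxl^~ z by exact: (congr1 (@^~ w) e).
apply: (bounded_ext_pure Hox); try exact: bounded_op_comp.
move=> x y /=; rewrite (op_tensorE Hoxl) // (op_tensorE Hox) // !oxA.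
by rewrite (op_tensorE Hoxr) // (op_tensorE Hox).
Qed.

(** * The maps [Delta1 ⊗ id] and [id ⊗ Delta1], and coassociativity *)

Variable F : HH -> HH.
Hypotheses (F_unitary : unitary_op F) (F_adj : adj F = F).
Hypothesis FE : forall x y, F (ox x y) = ox y x.

Let bF : bounded_op F. Proof. by case: F_unitary. Qed.
Let FF : F \o F = id. Proof. by case: F_unitary => _ <- _; rewrite F_adj. Qed.

(** [ampl oxl] adds the auxiliary leg in third place. For [id ⊗ Delta1] this is where [V23] expects
    it; for [Delta1 ⊗ id] it has to stand second, and [S23] puts it there:
    [S23 (S ⊗ T ⊗ 1) S23 = S ⊗ 1 ⊗ T]. *)
Let V12 := op_tensor oxl V id.
Let V23 := op_tensor oxr id V.
Let S23 := op_tensor oxr id F.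
Let Phi := ampl oxl (V12 \o S23).
Let Psi := ampl oxl V23.

Let V12u : unitary_op V12 := unitary_op_tensor Hoxl V_unitary (unitary_id H).
Let V23u : unitary_op V23 := unitary_op_tensor Hoxr (unitary_id H) V_unitary.
Let S23u : unitary_op S23 := unitary_op_tensor Hoxr (unitary_id H) F_unitary.
Let VSu : unitary_op (V12 \o S23) := unitary_comp V12u S23u.
Let bV12 : bounded_op V12. Proof. by case: V12u. Qed.
Let bS23 : bounded_op S23. Proof. by case: S23u. Qed.
Let S23_adj : adj S23 = S23.
Proof. by rewrite /S23 (adj_op_tensor Hoxr) // adj_id F_adj. Qed.
Let V12_adj : adj V12 = op_tensor oxl (adj V) id.
Proof. by rewrite /V12 (adj_op_tensor Hoxl) // adj_id. Qed.
Let bV' : bounded_op (adj V) := bounded_adj bV.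

Let flip_conj T : bounded_op T -> F \o op_tensor ox T id \o F = op_tensor ox id T.
Proof.
move=> bT; apply/esym/(op_tensor_eq Hox) => //.
  apply: bounded_op_comp => //; apply: bounded_op_comp => //.
  exact: (bounded_op_tensor Hox).
by move=> x y; rewrite /= FE (op_tensorE Hox) // FE.
Qed.

Lemma PhiE S T : bounded_op S -> bounded_op T ->
  Phi (op_tensor ox S T) = op_tensor oxl (Delta1 S) T.
Proof.
move=> bS bT; have bSi := bounded_op_tensor Hox bS bid.
have bTi := bounded_op_tensor Hox bT bid; have biT := bounded_op_tensor Hox bid bT.
have e : S23 \o op_tensor oxl (op_tensor ox S T) id \o S23 =
    op_tensor oxl (op_tensor ox S id) T.
  rewrite !op_tensorA // (op_tensor_comp Hoxr) // (op_tensor_comp Hoxr) //.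
    by rewrite -(flip_conj bT).
  exact: bounded_op_comp.
rewrite /Phi /ampl adj_comp // S23_adj V12_adj.
rewrite -[LHS]/(V12 \o (S23 \o op_tensor oxl (op_tensor ox S T) id \o S23) \o
  op_tensor oxl (adj V) id).
rewrite e (op_tensor_comp Hoxl) // (op_tensor_comp Hoxl) //.
exact: bounded_op_comp.
Qed.

Lemma PsiE S T : bounded_op S -> bounded_op T ->
  Psi (op_tensor ox S T) = op_tensor oxr S (Delta1 T).
Proof.
move=> bS bT; have bTi := bounded_op_tensor Hox bT bid.
rewrite /Psi /ampl /V23 op_tensorA // (adj_op_tensor Hoxr) // adj_id.
rewrite (op_tensor_comp Hoxr) // (op_tensor_comp Hoxr) //.
exact: bounded_op_comp.
Qed.

(* Through act3, the field coassoc of h becomes a relation between Phi and Psi. *)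
Let act3 : tensor A (tensor A A) -> HHH -> HHH :=
  tlift (fun x t => op_tensor oxr (act x) (act2 t)).

Let bact2 t : bounded_op (act2 t) := bounded_act2 HLam act_bounded actE Hox t.
Let act2L : linear act2 := act2_linear HLam act_bounded actE Hox.
Let act2E a b : act2 (a ⊗ b) = op_tensor ox (act a) (act b) :=
  act2_pure HLam act_bounded actE Hox a b.
Let actL : linear act := act_linear HLam act_bounded actE.

Let act3_bilinear : bilinear_for *:%R *:%R (fun x t => op_tensor oxr (act x) (act2 t)).
Proof.
split=> [t c x x'|x c t t'] /=; rewrite (actL, act2L).
  by rewrite (op_tensor_linl Hoxr).
by rewrite (op_tensor_linr Hoxr).
Qed.
Let act3L : linear act3 := tlift_linearP act3_bilinear.
Let act3E x t : act3 (x ⊗ t) = op_tensor oxr (act x) (act2 t) := tlift_pureP x t act3_bilinear.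

Let act3_assoc t y : act3 (tassoc (t ⊗ y)) = op_tensor oxl (act2 t) (act y).
Proof.
have iB (w : A) : bilinear_for *:%R *:%R (fun (u v : A) => u ⊗ (v ⊗ w)).
  split=> [v c u u'|u c v v'] /=; first by rewrite linearPl.
  by rewrite linearPl linearPr.
have oB : bilinear_for *:%R *:%R
    (fun (t : tensor A A) (w : A) => tlift (fun u v => u ⊗ (v ⊗ w)) t).
  split=> [w c u u'|u c w w'] /=; first exact: (tlift_linearP (iB w) c u u').
  elim/tensor_ind: u => [x z||s s' hs hs'].
  + by rewrite !(tlift_pureP _ _ (iB _)) !linearPr.
  + by rewrite !(lin0 (tlift_linearP (iB _))) scaler0 addr0.
  + by rewrite !(linD (tlift_linearP (iB _))) hs hs' scalerDr addrACA.
rewrite /tassoc (tlift_pureP _ _ oB).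
have act2y : bounded_op (act y) := act_bounded y.
elim/tensor_ind: t => [x z||s s' hs hs'].
- by rewrite (tlift_pureP _ _ (iB y)) act3E !act2E op_tensorA.
- rewrite (lin0 (tlift_linearP (iB y))) (lin0 act3L) (lin0 act2L).
  apply/esym/(op_tensor_eq Hoxl) => //; try exact: bounded_op0.
  by move=> u v; rewrite !fun0E (lin0 (oxl_linear Hoxl (act y v))).
- rewrite (linD (tlift_linearP (iB y))) (linD act3L) (linD act2L).
  by rewrite -[act2 s]scale1r (op_tensor_linl Hoxl) // scale1r hs hs'.
Qed.

Let PhiL c S T : bounded_op S -> bounded_op T -> Phi (c *: S + T) = c *: Phi S + Phi T :=
  ampl_lin Hoxl VSu c (S := S) (T := T).
Let PsiL c S T : bounded_op S -> bounded_op T -> Psi (c *: S + T) = c *: Psi S + Psi T :=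
  ampl_lin Hoxl V23u c (S := S) (T := T).

Let sum_act2 (f : (HH -> HH) -> HHH -> HHH) (g : A -> A -> HHH -> HHH) t :
  (forall c S T, bounded_op S -> bounded_op T -> f (c *: S + T) = c *: f S + f T) ->
  (forall x y, f (op_tensor ox (act x) (act y)) = g x y) ->
  f (act2 t) = \sum_(p <- repr t) g p.1 p.2.
Proof.
move=> fL fg.
have f0 : f 0 = 0.
  have := fL (-1) 0 0 (bounded_op0 HH HH) (bounded_op0 HH HH).
  by rewrite scaler0 addr0 scaleN1r addNr.
rewrite {1}(tensorE t) (lin_sum act2L).
elim: (repr t) => [|p s IH]; first by rewrite !big_nil.
rewrite !big_cons -IH -fg act2E -[X in f (X + _)]scale1r fL ?scale1r //.
  exact: (bounded_op_tensor Hox).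
elim/big_rec: _ => [|q S _ bS]; first exact: bounded_op0.
by rewrite -[act2 _]scale1r; exact: bounded_op_lin.
Qed.

(** At [t = T1(b ⊗ c)] the right-hand side is [act3] of one side of [coassoc]; [coassoc_right] at
    [t = T2(a ⊗ b)] gives the other. *)
Let coassoc_left a t : op_tensor oxr (act a) id \o Phi (act2 t) =
  act3 (tassoc (tlift (fun x y => hopfT2 h (a ⊗ x) ⊗ y) t)).
Proof.
have ba : bounded_op (op_tensor oxr (act a) id) by exact: (bounded_op_tensor Hoxr).
have tA : linear (fun t : tensor (tensor A A) A => act3 (tassoc t)).
  move=> c s s'; have aL : linear (@tassoc _ A A A).
    apply: tlift_linearP; split=> [w k u u'|u k w w'] /=.
      apply: tlift_linearP; split=> [v k' x x'|x k' v v'] /=; first by rewrite linearPl.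
      by rewrite linearPl linearPr.
    rewrite /tlift scaler_sumr -big_split /=; apply: eq_bigr => p _.
    by rewrite !linearPr.
  by rewrite aL act3L.
rewrite (@sum_act2 (fun Z => op_tensor oxr (act a) id \o Phi Z)
  (fun x y => act3 (tassoc (hopfT2 h (a ⊗ x) ⊗ y)))) => [|c S T bS bT|x y].
- by rewrite /tlift (lin_sum tA).
- rewrite PhiL //; apply/funext => z.
  by rewrite !fun_linE /= !fun_linE (bounded_linear ba).
- rewrite act3_assoc PhiE //.
  rewrite D_T2.
  have -> : op_tensor oxr (act a) id = op_tensor oxl (op_tensor ox (act a) id) id.
    by rewrite op_tensorA // (op_tensor_id Hox).
  rewrite (op_tensor_comp Hoxl) //; [exact: (bounded_op_tensor Hox) | exact: bD].
Qed.

Let coassoc_right c t : Psi (act2 t) \o op_tensor oxl id (act c) =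
  act3 (tlift (fun x y => x ⊗ hopfT1 h (y ⊗ c)) t).
Proof.
rewrite (@sum_act2 (fun Z => Psi Z \o op_tensor oxl id (act c))
  (fun x y => act3 (x ⊗ hopfT1 h (y ⊗ c)))) => [|k S T bS bT|x y].
- by rewrite /tlift (lin_sum act3L).
- by rewrite PsiL.
- rewrite act3E PsiE //.
  rewrite D_T1.
  have -> : op_tensor oxl id (act c) = op_tensor oxr id (op_tensor ox id (act c)).
    by rewrite -(op_tensorA bid bid (act_bounded c)) (op_tensor_id Hox).
  rewrite (op_tensor_comp Hoxr) //; [exact: bD | exact: (bounded_op_tensor Hox)].
Qed.

Let D_coassoc_act b : Phi (Delta1 (act b)) = Psi (Delta1 (act b)).
Proof.
have bPhi := bounded_ampl Hoxl VSu (bD (act_bounded b)).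
have bPsi := bounded_ampl Hoxl V23u (bD (act_bounded b)).
have key a c : op_tensor oxr (act a) id \o Phi (Delta1 (act b)) \o op_tensor oxl id (act c) =
    op_tensor oxr (act a) id \o Psi (Delta1 (act b)) \o op_tensor oxl id (act c).
  have := coassoc h a b c; move=> /(congr1 act3).
  rewrite -coassoc_left -coassoc_right.
  rewrite D_T1 D_T2.
  have bic : bounded_op (op_tensor ox id (act c)) by exact: (bounded_op_tensor Hox).
  have bai : bounded_op (op_tensor ox (act a) id) by exact: (bounded_op_tensor Hox).
  have bDb := bD (act_bounded b).
  (* Multiplicativity splits off [Phi(1 ⊗ c) = Delta1(1) ⊗ c] and [Psi(a ⊗ 1) = a ⊗ Delta1(1)],
     which are [1 ⊗ 1 ⊗ c] and [a ⊗ 1 ⊗ 1] because [Delta1] is unital. *)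
  rewrite /Phi (ampl_comp Hoxl VSu) // -/Phi PhiE // /Psi (ampl_comp Hoxl V23u) // -/Psi PsiE //.
  have -> : Delta1 id = id by exact: ampl_id.
  by [].
have key2 c : Phi (Delta1 (act b)) \o op_tensor oxl id (act c) =
    Psi (Delta1 (act b)) \o op_tensor oxl id (act c).
  apply/funext => z; apply/eqP; rewrite -subr_eq0; apply/eqP.
  apply: (op_tensor_left_eq0 Hoxr X0s X0n) => _ [a _ <-].
  have ba : bounded_op (op_tensor oxr (act a) id) by exact: (bounded_op_tensor Hoxr).
  rewrite (linB (bounded_linear ba)).
  by have /= -> := congr1 (@^~ z) (key a c); rewrite subrr.
(* [1 ⊗ 1 ⊗ c] is cancelled as a simple tensor over the non-degenerate sets [[set id]] and
   [range act]. *)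
apply: (bounded_ext_pure_ops Hoxl (X := [set id]) _ X0b _ X0n) => //.
- by move=> _ ->.
- by apply: nondegenerate_id.
- by move=> _ _ -> [c _ <-]; exact: key2.
Qed.

(** In the decomposition [oxr], both sides conjugate the same [S ⊗ 1], with [1] on [HH], by the
    unitaries [V12 \o S23 \o V12] and [V23 \o V12], so agreement on [A] passes to [M]. *)
Lemma Delta1_coassoc S : M S -> Phi (Delta1 S) = Psi (Delta1 S).
Proof.
have V123u : unitary_op (V12 \o S23 \o V12) by exact: unitary_comp.
have V2312u : unitary_op (V23 \o V12) by exact: unitary_comp.
have bV23 : bounded_op V23 by case: V23u.
have E1 T : bounded_op T -> op_tensor oxl (Delta1 T) id =
    V12 \o op_tensor oxr T id \o adj V12.
  move=> bT; have bTi := bounded_op_tensor Hox bT bid.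
  rewrite -(op_tensor_id Hox) -op_tensorA // V12_adj.
  rewrite (op_tensor_comp Hoxl) // (op_tensor_comp Hoxl) //.
  exact: bounded_op_comp.
have PhiA T : bounded_op T -> Phi (Delta1 T) = ampl oxr (V12 \o S23 \o V12) T.
  move=> bT; rewrite /Phi {1}/ampl E1 // /ampl.
  by rewrite (adj_comp (bounded_op_comp bV12 bS23) bV12).
have PsiA T : bounded_op T -> Psi (Delta1 T) = ampl oxr (V23 \o V12) T.
  by move=> bT; rewrite /Psi {1}/ampl E1 // /ampl (adj_comp bV23 bV12).
move=> MS; rewrite PhiA ?PsiA //; try exact: Mb.
apply: (ampl_eq_weak_closure Hoxr V123u V2312u X0b _ MS) => _ [b _ <-].
by rewrite -PhiA // -PsiA //; exact: D_coassoc_act.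
Qed.

Lemma vn_coproduct_Delta1 : vn_coproduct ox oxl oxr M Delta1.
Proof.
have MMw : weak_closure MM `<=` MM := @weak_closure_idem _ _ _.
have D_MM := Delta1_MM.
have MMid : MM id.
  apply: (sub_weak_closure (lspan_bounded pMMb)); apply: sub_lspan.
  by exists id => //; exists id => //; exact: op_tensor_id.
have MMstar : star_subalgebra MM := star_weak_closure MMs.
have starl := star_op_tensor Hoxl MMstar Ms.
have starr := star_op_tensor Hoxr Ms MMstar.
have nondegl' : nondegenerate (lspan (pure_ops oxl MM M)).
  apply: nondegenerate_id; apply: sub_lspan; exists id => //; exists id => //.
  exact: op_tensor_id.
have nondegr' : nondegenerate (lspan (pure_ops oxr M MM)).
  apply: nondegenerate_id; apply: sub_lspan; exists id => //; exists id => //.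
  exact: op_tensor_id.
(* Simple tensors are sent into the span by [PhiE]; the commutant criterion of [ampl_weak_closure]
   then covers their weak closure. *)
have Phi_MM Z : MM Z -> vn_tensor oxl MM M (Phi Z).
  apply: (ampl_weak_closure Hoxl VSu (lspan_bounded pMMb) starl nondegl') => S hS.
  apply: sub_bicommutant; first by case: starl.
  apply: (ampl_lspan Hoxl VSu (subspace_lspan _) pMMb _ hS) => _ [S1 M1 [S2 M2 <-]].
  rewrite -/Phi PhiE; [|exact: Mb..].
  by apply: sub_lspan; exists (Delta1 S1); [exact: D_MM | exists S2].
have Psi_MM Z : MM Z -> vn_tensor oxr M MM (Psi Z).
  apply: (ampl_weak_closure Hoxl V23u (lspan_bounded pMMb) starr nondegr') => S hS.
  apply: sub_bicommutant; first by case: starr.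
  apply: (ampl_lspan Hoxl V23u (subspace_lspan _) pMMb _ hS) => _ [S1 M1 [S2 M2 <-]].
  rewrite -/Psi PsiE; [|exact: Mb..].
  by apply: sub_lspan; exists S1 => //; exists (Delta1 S2) => //; exact: D_MM.
split.
- exact: von_neumann_M.
- exact: ampl_star_hom.
- exact: ampl_id.
- by apply: ampl_normal => //; exact: weak_closure_idem.
exists Phi, Psi; split.
- split; first exact: ampl_star_hom.
  exact: ampl_normal.
- by move=> S T MS MT; apply: PhiE; exact: Mb.
- split; first exact: ampl_star_hom.
  exact: ampl_normal.
- by move=> S T MS MT; apply: PsiE; exact: Mb.
- exact: Delta1_coassoc.
Qed.

Lemma cstar_coproduct_Delta1 : cstar_coproduct ox oxl oxr P Delta1.
Proof.
have MPPb : cstar_multipliers PP `<=` @bounded_op R HH HH by move=> T [].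
have PQ : PP `<=` norm_closure (lspan (pure_ops ox P P)) by [].
have DP S Z : P S -> PP Z -> PP (Delta1 S \o Z).
  by move=> /Delta1_mult[_ hS] /hS[].
have PPM S T : P S -> P T -> P (S \o T) by case: Ps => _ _ _ + _; apply.
have P_products : P `<=` norm_closure (lspan (act_products act)).
  by apply: norm_closureS => _ [a _ <-]; exact: (lspan_act_products h HLam act_bounded actE).
have prodb : act_products act `<=` @bounded_op R H H.
  by move=> _ [_ [a _ <-] [_ [b _ <-] <-]]; exact: bounded_op_comp.
have Phi_mult S : cstar_multipliers PP S -> cstar_multipliers (cstar_tensor oxl PP P) (Phi S).
  apply: (ampl_multiplier_extension Hoxl VSu (G := pure_ops ox P P) PPs PQ pPPb) => //.
  - exact: star_norm_closure (star_op_tensor Hoxl PPs Ps).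
  - exact: norm_closure_idem.
  - move=> _ Z [S1 P1 [S2 P2 <-]]; rewrite -/Phi PhiE; [|exact: Pb..].
    apply: (comp_cstar_tensor Hoxl PPb Pb); [by apply: bD; exact: Pb|exact: Pb|..].
      by move=> Z'; exact: DP.
    by move=> T; exact: PPM.
  apply: (cstar_tensor_sub Hoxl DPPb prodb Delta1_nondegenerate P_products).
  move=> _ _ [S1 P1 [Z1 P2 <-]] [_ [a _ <-] [_ [b _ <-] <-]].
  (* [Delta1(S1) Z1 ⊗ a b] factors as [Phi(S1 ⊗ a)] times [Z1 ⊗ b]; the third leg is taken as a
     product so that a factor [b] in [P] remains. *)
  exists (op_tensor ox S1 (act a)); first by exists S1 => //; exists (act a).
  exists (op_tensor oxl Z1 (act b)).
    apply: (sub_norm_closure (lspan_bounded (pure_ops_bounded Hoxl PPb Pb))).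
    by apply: sub_lspan; exists Z1 => //; exists (act b).
  rewrite -/Phi PhiE //; last exact: Pb.
  by rewrite (op_tensor_comp Hoxl) //; [apply: bD; exact: Pb | exact: PPb].
have Psi_mult S : cstar_multipliers PP S -> cstar_multipliers (cstar_tensor oxr P PP) (Psi S).
  apply: (ampl_multiplier_extension Hoxl V23u (G := pure_ops ox P P) PPs PQ pPPb) => //.
  - exact: star_norm_closure (star_op_tensor Hoxr Ps PPs).
  - exact: norm_closure_idem.
  - move=> _ Z [S1 P1 [S2 P2 <-]]; rewrite -/Psi PsiE; [|exact: Pb..].
    apply: (comp_cstar_tensor Hoxr Pb PPb); [exact: Pb|by apply: bD; exact: Pb|..].
      by move=> T; exact: PPM.
    by move=> Z'; exact: DP.
  apply: (cstar_tensor_sub Hoxr prodb DPPb P_products Delta1_nondegenerate).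
  move=> _ _ [_ [a _ <-] [_ [b _ <-] <-]] [S1 P1 [Z1 P2 <-]].
  exists (op_tensor ox (act a) S1); first by exists (act a) => //; exists S1.
  exists (op_tensor oxr (act b) Z1).
    apply: (sub_norm_closure (lspan_bounded (pure_ops_bounded Hoxr Pb PPb))).
    by apply: sub_lspan; exists (act b) => //; exists Z1.
  rewrite -/Psi PsiE //; last exact: Pb.
  by rewrite (op_tensor_comp Hoxr) //; [apply: bD; exact: Pb | exact: PPb].
split.
- exact: cstar_P.
- by apply: ampl_star_hom => //; exact: Delta1_mult.
- exact: Delta1_nondegenerate.
- exists Phi, Psi; split.
  + exact: ampl_star_hom.
  + by move=> S T PS PT; apply: PhiE; exact: Pb.
  + exact: ampl_star_hom.
  + by move=> S T PS PT; apply: PsiE; exact: Pb.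
  + by move=> S PS; apply: Delta1_coassoc; exact: PM.
- move=> S T PS PT; split; first exact: Delta1_tensor_right.
  exact: Delta1_tensor_left.
Qed.

End MainTheorem.

Theorem proposition2p10 (R : realType) (A : starAlgType R[i])
    (h : multiplier_hopf A)
    (phi : {scalar A}) (phi_left : left_integral h phi)
    (phi_pos : positive_functional phi)
    (psi : {scalar A}) (psi_right : right_integral h psi)
    (psi_pos : positive_functional psi)
    (H : hilbertType R) (Lam : {linear A -> H})
    (HLam : hilbert_completion psi Lam)
    (act : A -> H -> H)
    (act_bounded : forall a, bounded_op (act a))
    (actE : forall a x, act a (Lam x) = Lam (a ∙ x))
    (HH : hilbertType R) (ox : H -> H -> HH) (Hox : hilbert_tensor ox)
    (HHH : hilbertType R)
    (oxl : HH -> H -> HHH) (Hoxl : hilbert_tensor oxl)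
    (oxr : H -> HH -> HHH) (Hoxr : hilbert_tensor oxr)
    (oxA : forall x y z, oxl (ox x y) z = oxr x (ox y z))
    (V : HH -> HH) (V_unitary : unitary_op V)
    (VE : forall x x', V (ox (Lam x) (Lam x')) =
                       Lam2 ox Lam (hopfT1 h (x ⊗ x'))) :
  let P := norm_closure (range act) in
  let M := weak_closure (range act) in
  let Delta1 := fun x : H -> H => V \o op_tensor ox x id \o adj V in
  [/\ vn_coproduct ox oxl oxr M Delta1,
      cstar_coproduct ox oxl oxr P Delta1
    & forall a x x', Delta1 (act a) (ox (Lam x) (Lam x')) =
                     Lam2 ox Lam ((Delta h a).1 (x ⊗ x'))].
Proof.
have [F [F_unitary F_adj FE]] := flip_exists Hox.
split.
- exact: (vn_coproduct_Delta1 HLam act_bounded actE Hox Hoxl Hoxr oxA V_unitary VE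
    F_unitary F_adj FE).
- exact: (cstar_coproduct_Delta1 HLam act_bounded actE Hox Hoxl Hoxr oxA V_unitary VE
    F_unitary F_adj FE).
- move=> a x x'; rewrite -(Lam2_pure Lam Hox).
  exact: (ampl_act_Lam2 HLam act_bounded actE Hox V_unitary VE).
Qed.
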